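(* Let $d=6$ (so $W$ is of type $G_2$, $\mathbb{C}[\mathcal{C}]=\mathbb{C}[A,B]$). The $\mathbb{C}[A,B]$-algebra $\mathbb{C}[\mathcal{Z}^{\mu_6}]$ admits the following presentation: generators $r,R,\mathbf{eu}$ (the images of $r,R,\mathbf{eu}\in Z$); relation $$(\mathbf{eu}-3(A+B))(\mathbf{eu}+3(A+B))(\mathbf{eu}-3(A-B))(\mathbf{eu}+3(A-B))\,\mathbf{eu}^2=rR.$$ This proves Conjecture FIX of Bonnafé and Rouquier (recalled in the context) in this case, i.e. for the fixed point variety $\mathcal{Z}^{\mu_6}$ of the Calogero-Moser space of the dihedral group of type $G_2$.
   Context: Let $d=6$ and let $\zeta$ be a primitive $d$-th root of unity. $V=\mathbb{C}^2$ has canonical basis $(x,y)$, $V^*$ dual basis $(X,Y)$; $\mathbb{C}[V]=\mathbb{C}[X,Y]$, $\mathbb{C}[V^*]=\mathbb{C}[x,y]$. For $i\in\mathbb{Z}/d\mathbb{Z}$, $s_i=\begin{pmatrix}0&\zeta^i\\ \zeta^{-i}&0\end{pmatrix}$, $\alpha_i^\vee=\zeta^ix-y$, $\alpha_i=X-\zeta^iY$; $W=\langle s_0,s_1\rangle$ is dihedral of order $2d$, $\mathrm{Ref}(W)=\{s_i\}$ is its set of reflections. $\mathcal{C}$ is the space of functions $\mathrm{Ref}(W)\to\mathbb{C}$ constant on conjugacy classes, $C_i\in\mathcal{C}^*$ is evaluation at $s_i$; $C_i=C_{i+2}$, $A=C_0$, $B=C_1$. $\mathbf{H}$ (generic rational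 Cherednik algebra at $t=0$) is the quotient of $\mathbb{C}[\mathcal{C}]\otimes(T(V\oplus V^* )\rtimes W)$ by $[u,u']=[U,U']=0$, $[u,U]=-2\sum_iC_i\frac{\langle u,\alpha_i\rangle\langle\alpha_i^\vee,U\rangle}{\langle\alpha_i^\vee,\alpha_i\rangle}s_i$ ($u,u'\in V$, $U,U'\in V^*$); $Z$ is its centre, and the (generic) Calogero-Moser space $\mathcal{Z}$ is the affine variety with algebra of regular functions $Z$. Multiplication gives $\mathbb{C}[\mathcal{C}]\otimes\mathbb{C}[V]\otimes\mathbb{C}W\otimes\mathbb{C}[V^*]\cong\mathbf{H}$; $\mathrm{Trunc}$ takes the coefficient of $1\in W$ and restricts to a bijection $Z\cong\mathbb{C}[\mathcal{C}\times V\times V^*]^W$. $r=x^6+y^6$ and $R=X^6+Y^6$ lie in $Z$, and $\mathbf{eu}=\mathrm{Trunc}^{-1}(xX+yY)$. $\xi\in\mathbb{C}^\times$ acts on $\mathbf{H}$ by $\xi^{-1}$ on $V$, $\xi$ on $V^*$, trivially on $W$ and $\mathcal{C}^*$; this induces an action on $\mathcal{Z}$. For $m\ge1$, $\mu_m\subset\mathbb{C}^\times$ is the group of $m$-th roots of unity, and $\mathcal{Z}^{\mu_m}$ is the fixed point variety with its reduced structure. Conjecture FIX (Bonnafé–Rouquier): for a finite complex reflection group with Calogero-Moser space $\mathcal{Z}$ (defined analogously from the generic rational Cherednik algebra at $t=0$ of that group), all the irreducible components of the fixed point variety $\mathcal{Z}^{\mu_m}$ are isomorphic to the Calogero-Moser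 spaces of some other complex reflection groups.
   Formalization: In Conjecture FIX, ''isomorphic to the Calogero-Moser space of another group'' is read as isomorphic, over the parameter space of W, to the pull-back of that group's generic space along a linear map of parameters; with the generic space itself the claim is false for this 4-dimensional component. *)

(* Defs.v *)
From HB Require Import structures.
From mathcomp Require Import all_boot all_order all_fingroup all_algebra all_character.
From mathcomp Require Import boolp classical_sets functions reals complex mpoly.

Set Implicit Arguments.
Unset Strict Implicit.
Unset Printing Implicit Defensive.

Import GRing.Theory.
Local Open Scope ring_scope.

(* The unital associative K-algebra presented by a type X of generators and   *)
(* a set of relations rel: formal expressions in the generators modulo the    *)
(* smallest congruence that contains rel and the axioms of K-algebras.        *)

Inductive expr (K X : Type) : Type :=
| Cst of K
| Gen of X
| Add of expr K X & expr K X
| Mul of expr K X & expr K X.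

Arguments Cst {K X}.
Arguments Gen {K X}.
Arguments Add {K X}.
Arguments Mul {K X}.

HB.instance Definition _ (K X : Type) := gen_eqMixin (expr K X).
HB.instance Definition _ (K X : Type) := gen_choiceMixin (expr K X).

Section PresentedAlgebra.
Variables (K : comNzRingType) (X : Type) (rel : expr K X -> expr K X -> Prop).

Inductive pres_eqv : expr K X -> expr K X -> Prop :=
| Pres_rel t u : rel t u -> pres_eqv t u
| Pres_refl t : pres_eqv t t
| Pres_sym t u : pres_eqv t u -> pres_eqv u t
| Pres_trans u t v : pres_eqv t u -> pres_eqv u v -> pres_eqv t v
| Pres_add t t' u u' :
    pres_eqv t t' -> pres_eqv u u' -> pres_eqv (Add t u) (Add t' u')
| Pres_mul t t' u u' :
    pres_eqv t t' -> pres_eqv u u' -> pres_eqv (Mul t u) (Mul t' u')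
| Pres_addA t u v : pres_eqv (Add t (Add u v)) (Add (Add t u) v)
| Pres_addC t u : pres_eqv (Add t u) (Add u t)
| Pres_add0 t : pres_eqv (Add (Cst 0) t) t
| Pres_mulA t u v : pres_eqv (Mul t (Mul u v)) (Mul (Mul t u) v)
| Pres_mul0 t : pres_eqv (Mul (Cst 0) t) (Cst 0)
| Pres_mul1 t : pres_eqv (Mul (Cst 1) t) t
| Pres_mulDl t u v : pres_eqv (Mul (Add t u) v) (Add (Mul t v) (Mul u v))
| Pres_mulDr t u v : pres_eqv (Mul t (Add u v)) (Add (Mul t u) (Mul t v))
| Pres_cstD a b : pres_eqv (Cst (a + b)) (Add (Cst a) (Cst b))
| Pres_cstM a b : pres_eqv (Cst (a * b)) (Mul (Cst a) (Cst b))
| Pres_cstC a t : pres_eqv (Mul (Cst a) t) (Mul t (Cst a)).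

Definition pres_rel (t u : expr K X) : bool := `[< pres_eqv t u >].

Lemma pres_rel_equiv : equiv_class_of pres_rel.
Proof.
split=> [t|t u|u t v]; first exact/asboolP/Pres_refl.
- by apply/asboolP/asboolP; apply: Pres_sym.
- by move=> /asboolP tu /asboolP uv; apply/asboolP; apply: Pres_trans tu uv.
Qed.

Canonical pres_rel_equiv_rel := EquivRelPack pres_rel_equiv.

Definition pres_alg : Type := {eq_quot pres_rel}%qT.

HB.instance Definition _ := Choice.on pres_alg.
HB.instance Definition _ := EqQuotient.on pres_alg.

Definition pcls (t : expr K X) : pres_alg := \pi_pres_alg%qT t.

Lemma pclsP t u : pcls t = pcls u <-> pres_eqv t u.
Proof.
split=> [/eqP|tu]; last by apply/eqP; rewrite /pcls piE; apply/asboolP.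
by rewrite /pcls piE => /asboolP.
Qed.

Lemma pcls_repr (h : pres_alg) : pcls (generic_quotient.repr h) = h.
Proof. exact: reprK. Qed.

Lemma pres_algW (P : pres_alg -> Prop) :
  (forall t, P (pcls t)) -> forall h, P h.
Proof. by move=> Pt h; rewrite -[h]pcls_repr. Qed.

Definition pres_add (g h : pres_alg) := pcls (Add (generic_quotient.repr g) (generic_quotient.repr h)).
Definition pres_mul (g h : pres_alg) := pcls (Mul (generic_quotient.repr g) (generic_quotient.repr h)).
Definition pres_scale (a : K) (h : pres_alg) := pcls (Mul (Cst a) (generic_quotient.repr h)).
Definition pres_opp (h : pres_alg) := pres_scale (-1) h.

Lemma repr_pcls t : pres_eqv (generic_quotient.repr (pcls t)) t.
Proof. by apply/pclsP; rewrite pcls_repr. Qed.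

Lemma pres_addE t u : pres_add (pcls t) (pcls u) = pcls (Add t u).
Proof. by apply/pclsP/Pres_add; apply: repr_pcls. Qed.

Lemma pres_mulE t u : pres_mul (pcls t) (pcls u) = pcls (Mul t u).
Proof. by apply/pclsP/Pres_mul; apply: repr_pcls. Qed.

Lemma pres_scaleE a t : pres_scale a (pcls t) = pcls (Mul (Cst a) t).
Proof. by apply/pclsP/Pres_mul; [apply: Pres_refl | apply: repr_pcls]. Qed.

Fact pres_addA : associative pres_add.
Proof.
do 3![elim/pres_algW=> ?]; rewrite !pres_addE; exact/pclsP/Pres_addA.
Qed.

Fact pres_addC : commutative pres_add.
Proof. by do 2![elim/pres_algW=> ?]; rewrite !pres_addE; exact/pclsP/Pres_addC. Qed.

Fact pres_add0 : left_id (pcls (Cst 0)) pres_add.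
Proof. by elim/pres_algW=> ?; rewrite !pres_addE; exact/pclsP/Pres_add0. Qed.

Fact pres_mulA : associative pres_mul.
Proof.
do 3![elim/pres_algW=> ?]; rewrite !pres_mulE; exact/pclsP/Pres_mulA.
Qed.

Fact pres_mul1l : left_id (pcls (Cst 1)) pres_mul.
Proof. by elim/pres_algW=> ?; rewrite !pres_mulE; exact/pclsP/Pres_mul1. Qed.

Fact pres_mul1r : right_id (pcls (Cst 1)) pres_mul.
Proof.
elim/pres_algW=> t; rewrite !pres_mulE; apply/pclsP.
by apply: Pres_trans (Pres_mul1 t); apply/Pres_sym/Pres_cstC.
Qed.

Fact pres_mulDl : left_distributive pres_mul pres_add.
Proof.
do 3![elim/pres_algW=> ?]; rewrite !(pres_addE, pres_mulE).
exact/pclsP/Pres_mulDl.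
Qed.

Fact pres_mulDr : right_distributive pres_mul pres_add.
Proof.
do 3![elim/pres_algW=> ?]; rewrite !(pres_addE, pres_mulE).
exact/pclsP/Pres_mulDr.
Qed.

Fact pres_scaleDl v : {morph pres_scale^~ v : a b / a + b >-> pres_add a b}.
Proof.
elim/pres_algW: v => t a b; rewrite !pres_scaleE pres_addE; apply/pclsP.
by apply: Pres_trans (Pres_mulDl _ _ _); apply: Pres_mul (Pres_cstD _ _) (Pres_refl _).
Qed.

Fact pres_scale1 : left_id 1 pres_scale.
Proof. by elim/pres_algW=> t; rewrite pres_scaleE; exact/pclsP/Pres_mul1. Qed.

Fact pres_addN : left_inverse (pcls (Cst 0)) pres_opp pres_add.
Proof.
move=> h; rewrite /pres_opp -[X in pres_add _ X]pres_scale1 -pres_scaleDl addNr.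
by elim/pres_algW: h => t; rewrite pres_scaleE; exact/pclsP/Pres_mul0.
Qed.

HB.instance Definition _ := GRing.isPzRing.Build pres_alg
  pres_addA pres_addC pres_add0 pres_addN
  pres_mulA pres_mul1l pres_mul1r pres_mulDl pres_mulDr.

Fact pres_scaleA a b v : pres_scale a (pres_scale b v) = pres_scale (a * b) v.
Proof.
elim/pres_algW: v => t; rewrite !pres_scaleE; apply/pclsP.
apply: Pres_trans (Pres_mulA _ _ _) _; apply: Pres_mul (Pres_refl _).
exact/Pres_sym/Pres_cstM.
Qed.

Fact pres_scaleDr : right_distributive pres_scale +%R.
Proof.
move=> a g h; rewrite -[LHS]/(pres_scale a (pres_add g h)).
rewrite -[RHS]/(pres_add (pres_scale a g) (pres_scale a h)).
elim/pres_algW: g => t; elim/pres_algW: h => u.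
by rewrite !(pres_addE, pres_scaleE); exact/pclsP/Pres_mulDr.
Qed.

HB.instance Definition _ := GRing.Zmodule_isLmodule.Build K pres_alg
  pres_scaleA pres_scale1 pres_scaleDr pres_scaleDl.

Definition pgen (x : X) : pres_alg := pcls (Gen x).

Lemma pcls_Add t u : pcls (Add t u) = pcls t + pcls u.
Proof. by rewrite -pres_addE. Qed.

Lemma pcls_Mul t u : pcls (Mul t u) = pcls t * pcls u.
Proof. by rewrite -pres_mulE. Qed.

Lemma pcls_scale a t : pcls (Mul (Cst a) t) = a *: pcls t.
Proof. by rewrite -pres_scaleE. Qed.

Lemma pcls_Cst a : pcls (Cst a) = a *: (1 : pres_alg).
Proof. by rewrite -pcls_scale pcls_Mul [RHS]mulr1. Qed.

Lemma pcls_sum (I : Type) (r : seq I) (P : pred I) F :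
  pcls (\big[Add/Cst 0]_(i <- r | P i) F i) = \sum_(i <- r | P i) pcls (F i).
Proof. by apply: (big_morph _ pcls_Add); rewrite pcls_Cst scale0r. Qed.

Lemma pres_scaleAl a (u v : pres_alg) : a *: (u * v) = (a *: u) * v.
Proof.
elim/pres_algW: u => t; elim/pres_algW: v => u.
rewrite -pcls_Mul -!pcls_scale -pcls_Mul; exact/pclsP/Pres_mulA.
Qed.

Lemma pres_scaleAr a (u v : pres_alg) : a *: (u * v) = u * (a *: v).
Proof.
elim/pres_algW: u => t; elim/pres_algW: v => u.
rewrite -pcls_Mul -!pcls_scale -pcls_Mul; apply/pclsP.
apply: Pres_trans (Pres_mulA _ _ _) _.
apply: Pres_trans (Pres_mul (Pres_cstC _ _) (Pres_refl _)) _.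
exact/Pres_sym/Pres_mulA.
Qed.

(* The universal property. pres_map f is the homomorphism that extends f only *)
(* if f respects the relations.                                               *)
Variable S : algType K.

Fixpoint expr_eval (f : X -> S) (t : expr K X) : S :=
  match t with
  | Cst a => a *: 1
  | Gen x => f x
  | Add t u => expr_eval f t + expr_eval f u
  | Mul t u => expr_eval f t * expr_eval f u
  end.

Definition pres_map (f : X -> S) (h : pres_alg) : S := expr_eval f (generic_quotient.repr h).

Section Respects.
Variable f : X -> S.
Hypothesis f_rel : forall t u, rel t u -> expr_eval f t = expr_eval f u.

Lemma expr_eval_eqv t u : pres_eqv t u -> expr_eval f t = expr_eval f u.
Proof.
elim=> //= {t u}.
- by move=> u t v _ -> _ ->.
- by move=> t t' u u' _ -> _ ->.
- by move=> t t' u u' _ -> _ ->.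
- by move=> *; rewrite addrA.
- by move=> *; rewrite addrC.
- by move=> *; rewrite scale0r add0r.
- by move=> *; rewrite mulrA.
- by move=> *; rewrite scale0r mul0r.
- by move=> *; rewrite scale1r mul1r.
- by move=> *; rewrite mulrDl.
- by move=> *; rewrite mulrDr.
- by move=> *; rewrite scalerDl.
- by move=> *; rewrite -scalerAl mul1r scalerA.
- by move=> *; rewrite -scalerAl mul1r -scalerAr mulr1.
Qed.

Lemma pres_map_cls t : pres_map f (pcls t) = expr_eval f t.
Proof. exact/expr_eval_eqv/repr_pcls. Qed.

Lemma pres_map_gen x : pres_map f (pgen x) = f x.
Proof. exact: pres_map_cls. Qed.

Lemma pres_mapD : {morph pres_map f : g h / g + h}.
Proof.
by elim/pres_algW=> ?; elim/pres_algW=> ?; rewrite -pcls_Add !pres_map_cls.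
Qed.

Lemma pres_mapM : {morph pres_map f : g h / g * h}.
Proof.
by elim/pres_algW=> ?; elim/pres_algW=> ?; rewrite -pcls_Mul !pres_map_cls.
Qed.

Lemma pres_map1 : pres_map f 1 = 1.
Proof. by rewrite -[1 in LHS]scale1r -pcls_Cst pres_map_cls /= scale1r. Qed.

Lemma pres_mapZ a : {morph pres_map f : h / a *: h}.
Proof.
elim/pres_algW=> t; rewrite -pcls_scale !pres_map_cls /=.
by rewrite -scalerAl mul1r.
Qed.

End Respects.
End PresentedAlgebra.

Arguments pgen {K X}.

(* Complex reflection groups: W is given by a faithful representation on      *)
(* V = C^n (column vectors); V^* is the space of row vectors and the pairing  *)
(* of u in V and U in V^* is the entry of the 1 x 1 matrix U *m u.            *)

Definition is_refl (C : fieldType) (gT : finGroupType) (n : nat)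
    (rho : mx_representation C [set: gT] n) (s : gT) : bool :=
  \rank (rho s - 1%:M) == 1%N.

(* The values of root and coroot outside the reflections are irrelevant.      *)
Record refl_group (C : fieldType) := ReflGroup {
  rgdim : nat;
  rgT : finGroupType;
  rgrep : mx_representation C [set: rgT] rgdim;
  rg_faithful : mx_faithful rgrep;
  rg_gen : <<[set s | is_refl rgrep s]>>%g = [set: rgT];
  root : rgT -> 'rV[C]_rgdim;
  coroot : rgT -> 'cV[C]_rgdim;
  rootP : forall s, is_refl rgrep s -> forall v : 'cV[C]_rgdim,
    rgrep s *m v = v <-> root s *m v = 0;
  corootP : forall s, is_refl rgrep s -> forall v : 'cV[C]_rgdim,
    (exists c, v = c *: coroot s) <-> (exists u, v = rgrep s *m u - u)
}.

Arguments rgrep {C} r.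
Arguments root {C r}.
Arguments coroot {C r}.

Definition refl_group_iso (C : fieldType) (W W' : refl_group C) : Prop :=
  exists (f : rgT W -> rgT W')
         (P : 'M[C]_(rgdim W', rgdim W)) (Q : 'M[C]_(rgdim W, rgdim W')),
    [/\ bijective f, {morph f : v w / (v * w)%g},
        P *m Q = 1%:M, Q *m P = 1%:M
      & forall w, P *m rgrep W w = rgrep W' (f w) *m P].

Section Cherednik.
Variables (C : fieldType) (W : refl_group C).

Notation n := (rgdim W).
Notation rho := (rgrep W).

Definition Ref : Type := {s : rgT W | is_refl rho s}.
HB.instance Definition _ := Finite.on Ref.

Definition pairing (u : 'cV[C]_n) (U : 'rV[C]_n) : C := (U *m u) 0 0.

(* Generators of the generic rational Cherednik algebra at t = 0: the         *)
(* functions C_s on the parameter space, V, V^* and W.                        *)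
Inductive cher_gen : Type :=
| Par of Ref
| Vec of 'cV[C]_n
| Cov of 'rV[C]_n
| Grp of rgT W.

(* The factor det s - 1 of the general definition is -2 when s is an          *)
(* involution.                                                                *)
Definition comm_coef (u : 'cV[C]_n) (U : 'rV[C]_n) (s : rgT W) : C :=
  (\det (rho s) - 1) * (pairing u (root s) * pairing (coroot s) U
                          / pairing (coroot s) (root s)).

Local Notation cexpr := (expr C cher_gen).
Local Notation G := (fun x : cher_gen => Gen x : cexpr).

Inductive cher_rel : cexpr -> cexpr -> Prop :=
| Cher_Vec_lin a u v :
    cher_rel (G (Vec (a *: u + v))) (Add (Mul (Cst a) (G (Vec u))) (G (Vec v)))
| Cher_Cov_lin a u v :
    cher_rel (G (Cov (a *: u + v))) (Add (Mul (Cst a) (G (Cov u))) (G (Cov v)))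
| Cher_Grp1 : cher_rel (G (Grp 1%g)) (Cst 1)
| Cher_GrpM w w' :
    cher_rel (G (Grp (w * w')%g)) (Mul (G (Grp w)) (G (Grp w')))
| Cher_Grp_Vec w u :
    cher_rel (Mul (G (Grp w)) (G (Vec u))) (Mul (G (Vec (rho w *m u))) (G (Grp w)))
| Cher_Grp_Cov w U :
    cher_rel (Mul (G (Grp w)) (G (Cov U)))
             (Mul (G (Cov (U *m rho w^-1%g))) (G (Grp w)))
| Cher_Par_conj (s s' : Ref) w :
    val s' = (val s ^ w)%g -> cher_rel (G (Par s)) (G (Par s'))
| Cher_Par_central s x :
    cher_rel (Mul (G (Par s)) (G x)) (Mul (G x) (G (Par s)))
| Cher_VecC u u' :
    cher_rel (Mul (G (Vec u)) (G (Vec u'))) (Mul (G (Vec u')) (G (Vec u)))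
| Cher_CovC U U' :
    cher_rel (Mul (G (Cov U)) (G (Cov U'))) (Mul (G (Cov U')) (G (Cov U)))
| Cher_comm u U :
    cher_rel (Mul (G (Vec u)) (G (Cov U)))
      (Add (Mul (G (Cov U)) (G (Vec u)))
           (\big[Add/Cst 0]_(s : Ref)
              Mul (Cst (comm_coef u U (val s))) (Mul (G (Par s)) (G (Grp (val s)))))).

Definition cher : Type := pres_alg cher_rel.

HB.instance Definition _ := GRing.PzRing.on cher.
HB.instance Definition _ := GRing.Lmodule.on cher.

(* The trivial character of W, extended by 0, shows that the algebra is       *)
(* nonzero.                                                                   *)
Definition triv_gen (x : cher_gen) : C^o := if x is Grp _ then 1 else 0.

Lemma triv_gen_rel t u : cher_rel t u -> expr_eval triv_gen t = expr_eval triv_gen u.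
Proof.
case=> //= *; rewrite ?(mulr0, mul0r, mulr1, mul1r, scaler0, scale1r, addr0) //.
rewrite add0r; elim/big_ind: _ => //= [|t' u' <- <-|s _].
- by rewrite scale0r.
- by rewrite addr0.
- by rewrite mul0r mulr0.
Qed.

Fact cher_neq0 : (1 : cher) != 0.
Proof.
apply/eqP => H; have := pres_map1 triv_gen_rel.
rewrite -[1 in LHS]/(1 : cher) H -[0 : cher](scale0r 0) (pres_mapZ triv_gen_rel).
by rewrite scale0r => /esym/eqP; rewrite oner_eq0.
Qed.

HB.instance Definition _ := GRing.PzSemiRing_isNonZero.Build cher cher_neq0.
HB.instance Definition _ :=
  GRing.Lmodule_isLalgebra.Build C cher (@pres_scaleAl _ _ _).
HB.instance Definition _ :=
  GRing.Lalgebra_isAlgebra.Build C cher (@pres_scaleAr _ _ _).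

Definition hpar (s : Ref) : cher := pgen cher_rel (Par s).
Definition hvec (u : 'cV[C]_n) : cher := pgen cher_rel (Vec u).
Definition hcov (U : 'rV[C]_n) : cher := pgen cher_rel (Cov U).
Definition hgrp (w : rgT W) : cher := pgen cher_rel (Grp w).

Definition central : {pred cher} := fun z => `[< forall h : cher, z * h = h * z >].

Lemma centralP z : reflect (forall h : cher, z * h = h * z) (z \in central).
Proof. exact: asboolP. Qed.

Fact central_subsemialg : GRing.subsemialg_closed central.
Proof.
split.
- by apply/centralP=> h; rewrite mul1r mulr1.
- split=> [|y z /centralP yC /centralP zC].
    by apply/centralP=> h; rewrite mul0r mulr0.
  by apply/centralP=> h; rewrite mulrDl mulrDr yC zC.
- by move=> a z /centralP zC; apply/centralP=> h; rewrite -scalerAl -scalerAr zC.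
- move=> y z /centralP yC /centralP zC.
  by apply/centralP=> h; rewrite mulrA -yC -!mulrA zC.
Qed.

Definition centre : Type := {z : cher | z \in central}.
HB.instance Definition _ := SubChoice.on centre.
HB.instance Definition _ :=
  GRing.SubChoice_isSubAlgebra.Build C cher central centre central_subsemialg.

Fact centre_mulC : commutative (@GRing.mul centre).
Proof.
by move=> y z; apply: val_inj; rewrite !rmorphM /=; apply/centralP/(valP y).
Qed.

HB.instance Definition _ := GRing.PzRing_hasCommutativeMul.Build centre centre_mulC.

Fact hpar_central s : hpar s \in central.
Proof.
apply/centralP; elim/pres_algW; elim=> [a|x|t tC u uC|t tC u uC].
- by rewrite pcls_Cst -scalerAr mulr1 -scalerAl mul1r.
- by rewrite -!pcls_Mul; apply/pclsP/Pres_rel/Cher_Par_central.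
- by rewrite pcls_Add mulrDr mulrDl tC uC.
- by rewrite pcls_Mul mulrA tC -mulrA uC mulrA.
Qed.

Definition zpar (s : Ref) : centre := Sub (hpar s) (hpar_central s).

(* The action of xi in C^* on the algebra, by algebra automorphisms           *)
(* (cher_actD ... cher_act1); the definition is junk for xi = 0.              *)
Definition act_gen (xi : C) (x : cher_gen) : cher :=
  match x with
  | Par s => hpar s
  | Vec u => xi^-1 *: hvec u
  | Cov U => xi *: hcov U
  | Grp w => hgrp w
  end.

Definition cher_act (xi : C) (h : cher) : cher := pres_map (act_gen xi) h.

Section Action.
Variable xi : C.
Hypothesis xi_neq0 : xi != 0.

Lemma act_gen_rel t u :
  cher_rel t u -> expr_eval (act_gen xi) t = expr_eval (act_gen xi) u.
Proof.
have relE t' u' : cher_rel t' u' -> pcls cher_rel t' = pcls cher_rel u'.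
  by move=> r; apply/pclsP/Pres_rel.
case=> [a x y|a x y||w w'|w x|w x|s s' w sw|s x|x y|x y|x y] /=.
- have := relE _ _ (Cher_Vec_lin a x y).
  rewrite pcls_Add pcls_scale /= => E; rewrite [hvec _]E scalerDr.
  by rewrite -scalerAl mul1r !scalerA mulrC.
- have := relE _ _ (Cher_Cov_lin a x y).
  rewrite pcls_Add pcls_scale /= => E; rewrite [hcov _]E scalerDr.
  by rewrite -scalerAl mul1r !scalerA mulrC.
- by have := relE _ _ Cher_Grp1; rewrite pcls_Cst.
- by have := relE _ _ (Cher_GrpM w w'); rewrite pcls_Mul.
- have := relE _ _ (Cher_Grp_Vec w x); rewrite !pcls_Mul => E.
  by rewrite -scalerAr -scalerAl; congr (_ *: _).
- have := relE _ _ (Cher_Grp_Cov w x); rewrite !pcls_Mul => E.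
  by rewrite -scalerAr -scalerAl; congr (_ *: _).
- exact: relE _ _ (Cher_Par_conj sw).
- exact/centralP/hpar_central.
- have := relE _ _ (Cher_VecC x y); rewrite !pcls_Mul => E.
  by rewrite -!scalerAr -!scalerAl; do 2!congr (_ *: _).
- have := relE _ _ (Cher_CovC x y); rewrite !pcls_Mul => E.
  by rewrite -!scalerAr -!scalerAl; do 2!congr (_ *: _).
- have := relE _ _ (Cher_comm x y); rewrite pcls_Add !pcls_Mul pcls_sum => E.
  rewrite -!scalerAr -!scalerAl !scalerA mulfV // mulVf // !scale1r.
  rewrite [LHS]E; congr (_ + _); symmetry.
  rewrite (big_morph (expr_eval (act_gen xi)) (id1 := 0) (op1 := +%R)) //=; last first.
    by rewrite scale0r.
  by apply: eq_bigr => s _; rewrite pcls_scale pcls_Mul /= -scalerAl mul1r.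
Qed.

Lemma cher_act_gen x : cher_act xi (pgen cher_rel x) = act_gen xi x.
Proof. exact: (pres_map_gen act_gen_rel). Qed.

Lemma cher_actD : {morph cher_act xi : g h / g + h}.
Proof. exact: (pres_mapD act_gen_rel). Qed.

Lemma cher_actM : {morph cher_act xi : g h / g * h}.
Proof. exact: (pres_mapM act_gen_rel). Qed.

Lemma cher_actZ a : {morph cher_act xi : h / a *: h}.
Proof. exact: (pres_mapZ act_gen_rel). Qed.

Lemma cher_act1 : cher_act xi 1 = 1.
Proof. exact: (pres_map1 act_gen_rel). Qed.

End Action.
End Cherednik.

(* Affine varieties over C in the classical sense: a set of points together   *)
(* with an algebra of regular functions, which are the restrictions to the    *)
(* points of the functions in vfun.                                           *)

Record variety (C : fieldType) := Variety {
  vtype : Type;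
  vpts : set vtype;
  vfun : set (vtype -> C)
}.

Section Varieties.
Local Open Scope classical_set_scope.
Variable C : fieldType.
Implicit Types X Y : variety C.

Definition regular X (f : vtype X -> C) : Prop :=
  exists2 g, vfun g & forall x, vpts x -> f x = g x.

Definition zariski_closed X (F : set (vtype X)) : Prop :=
  exists2 E : set (vtype X -> C), (forall f, E f -> regular f)
    & F = [set x | vpts x /\ forall f, E f -> f x = 0].

Definition zariski_irreducible X (F : set (vtype X)) : Prop :=
  F !=set0 /\ forall F1 F2 : set (vtype X),
    zariski_closed F1 -> zariski_closed F2 -> F `<=` F1 `|` F2 ->
    F `<=` F1 \/ F `<=` F2.

Definition irreducible_component X (F : set (vtype X)) : Prop :=
  [/\ zariski_closed F, zariski_irreducible F
    & forall F' : set (vtype X), zariski_closed F' -> zariski_irreducible F' ->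
        F `<=` F' -> F' = F].

(* The subvariety carried by a closed subset, with its reduced structure.     *)
Definition subvariety X (F : set (vtype X)) : variety C :=
  Variety F (@vfun C X).

Definition variety_iso X Y (f : vtype X -> vtype Y) : Prop :=
  set_bij (@vpts C X) (@vpts C Y) f /\
  forall g : vtype Y -> C, regular g <-> @regular X (g \o f).

(* The algebra of regular functions of X is presented, as an algebra over the *)
(* polynomial ring C[T_0, ..., T_(m-1)] whose variables act as the functions  *)
(* base_i, by the generators gen_j and the single relation rel = 0.           *)
Definition presented_by X (m n : nat)
    (base : 'I_m -> vtype X -> C) (gen : 'I_n -> vtype X -> C)
    (rel : {mpoly {mpoly C[m]}[n]}) : Prop :=
  let ev (p : {mpoly {mpoly C[m]}[n]}) (x : vtype X) : C :=
    mmap (fun c : {mpoly C[m]} => c.@[base^~ x]) (gen^~ x) p in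
  (forall f : vtype X -> C,
     regular f <-> exists p, forall x, vpts x -> f x = ev p x) /\
  (forall p, (forall x, vpts x -> ev p x = 0) <-> exists q, p = q * rel).

End Varieties.

Section CalogeroMoser.
Local Open Scope classical_set_scope.
Variables (C : fieldType) (W : refl_group C).

(* The parameter space: class functions on the reflections.                   *)
Definition param_space : variety C :=
  Variety
    [set c : {ffun Ref W -> C^o} |
       forall (s s' : Ref W) w, val s' = (val s ^ w)%g -> c s' = c s]
    [set f : {ffun Ref W -> C^o} -> C | exists p : {mpoly C[#|{: Ref W}|]},
       forall c, f c = p.@[fun i => c (enum_val i)]].

(* The generic Calogero-Moser space: its points are the C-algebra             *)
(* homomorphisms from the centre to C.                                        *)
Definition cm_space : variety C :=
  Variety
    [set chi : centre W -> C | scalar chi /\ GRing.monoid_morphism chi]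
    [set f | exists z, forall chi, f chi = chi z].

Definition cm_param (chi : centre W -> C) : {ffun Ref W -> C^o} :=
  [ffun s => chi (zpar s)].

(* The points fixed by the group of m-th roots of unity.                      *)
Definition cm_fixed (m : nat) : variety C :=
  @subvariety C cm_space
    [set chi : centre W -> C | (scalar chi /\ GRing.monoid_morphism chi) /\
       forall xi : C, xi ^+ m = 1 ->
       forall z z' : centre W, val z' = cher_act xi (val z) -> chi z' = chi z].

End CalogeroMoser.

Section FIX.
Local Open Scope classical_set_scope.

(* The fibre product of the parameter space of W and the Calogero-Moser space *)
(* of W' over the parameter space of W', along the linear map lam.            *)
Definition cm_base_change (C : fieldType) (W W' : refl_group C)
    (lam : {linear {ffun Ref W -> C^o} -> {ffun Ref W' -> C^o}}) : variety C :=
  Variety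
    [set p : {ffun Ref W -> C^o} * (centre W' -> C) |
       [/\ vpts (v := param_space W) p.1, vpts (v := cm_space W') p.2
         & cm_param p.2 = lam p.1]]
    [set f | exists (k : nat) (a : 'I_k -> {ffun Ref W -> C^o} -> C)
                              (b : 'I_k -> (centre W' -> C) -> C),
       [/\ forall i, vfun (v := param_space W) (a i),
           forall i, vfun (v := cm_space W') (b i)
         & forall p, f p = \sum_i a i p.1 * b i p.2]].

(* Conjecture FIX for W and m. Both sides are families of Calogero-Moser      *)
(* spaces, so that an irreducible component is compared, over the parameter   *)
(* space of W, with the family of Calogero-Moser spaces of W' whose parameter *)
(* depends linearly on that of W.                                             *)
Definition conjecture_FIX (C : fieldType) (W : refl_group C) (m : nat) : Prop :=
  forall F : set (vtype (cm_fixed W m)), irreducible_component F ->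
  exists2 W' : refl_group C, ~ refl_group_iso W W'
  & exists lam : {linear {ffun Ref W -> C^o} -> {ffun Ref W' -> C^o}},
    (forall c, vpts (v := param_space W) c ->
       vpts (v := param_space W') (lam c)) /\
    exists2 f : vtype (subvariety F) -> vtype (cm_base_change lam),
      variety_iso f
    & forall chi, F chi -> (f chi).1 = cm_param chi.

End FIX.

(* The dihedral group of order 12: (k, b) stands for the matrix               *)
(* diag(zeta^k, zeta^-k) * s_0^b.                                             *)

Definition dih6 : Type := ('Z_6 * bool)%type.
HB.instance Definition _ := Finite.on dih6.

Definition dih6_mul (v w : dih6) : dih6 :=
  (v.1 + (if v.2 then - w.1 else w.1), v.2 (+) w.2).
Definition dih6_one : dih6 := (0, false).
Definition dih6_inv (v : dih6) : dih6 := (if v.2 then v.1 else - v.1, v.2).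

Fact dih6_mulA : associative dih6_mul.
Proof.
move=> [k b] [l c] [m d]; rewrite /dih6_mul /= addbA; congr (_, _).
by case: b; case: c; rewrite /= ?opprD ?opprK addrA.
Qed.

Fact dih6_mul1 : left_id dih6_one dih6_mul.
Proof. by case=> k b; rewrite /dih6_mul /= add0r. Qed.

Fact dih6_mulV : left_inverse dih6_one dih6_inv dih6_mul.
Proof. by case=> k []; rewrite /dih6_mul /dih6_inv /= ?subrr ?addNr. Qed.

HB.instance Definition _ := isMulGroup.Build dih6 dih6_mulA dih6_mul1 dih6_mulV.

Lemma dih6_mulE (v w : dih6) : (v * w)%g = dih6_mul v w.
Proof. by []. Qed.

Definition s_ (i : 'Z_6) : dih6 := (i, true).

Lemma dih6_gen : <<[set s_ 0%R; s_ 1%R]>>%g = [set: dih6].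
Proof.
apply/eqP; rewrite -finset.subTset; apply/fintype.subsetP=> [[k b]] _.
have s0 : s_ 0 \in <<[set s_ 0%R; s_ 1%R]>>%g by apply/mem_gen/set21.
have s1 : s_ 1 \in <<[set s_ 0%R; s_ 1%R]>>%g by apply/mem_gen/set22.
have -> : (k, b) = (((s_ 1%R * s_ 0%R) ^+ k) * (s_ 0%R ^+ b) : dih6)%g.
  have E m : ((s_ 1%R * s_ 0%R : dih6) ^+ m)%g = (m%:R, false) :> dih6.
    elim: m => [|m IHm]; first by rewrite expg0.
    rewrite expgS IHm !dih6_mulE /dih6_mul /= oppr0 addr0.
    by rewrite mulrS.
  rewrite E natr_Zp; case: b; rewrite ?expg1 ?expg0 ?mulg1 //.
  by rewrite dih6_mulE /dih6_mul /= addr0.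
by rewrite groupM ?groupX ?groupM.
Qed.

Section TypeG2.
Variables (C : fieldType) (zeta : C).

Definition mx2 (a b c d : C) : 'M[C]_2 :=
  \matrix_(i, j) if i == 0 then (if j == 0 then a else b)
                 else (if j == 0 then c else d).

Definition dih6_mx (w : dih6) : 'M[C]_2 :=
  if w.2 then mx2 0 (zeta ^+ w.1) (zeta ^- w.1) 0
  else mx2 (zeta ^+ w.1) 0 0 (zeta ^- w.1).

Definition dih6_root (w : dih6) : 'rV[C]_2 :=
  \row_j if j == 0 then 1 else - zeta ^+ w.1.
Definition dih6_coroot (w : dih6) : 'cV[C]_2 :=
  \col_j if j == 0 then zeta ^+ w.1 else -1.

Hypothesis zeta_prim : 6.-primitive_root zeta.

Lemma mx2M a b c d a' b' c' d' :
  mx2 a b c d *m mx2 a' b' c' d' =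
  mx2 (a * a' + b * c') (a * b' + b * d') (c * a' + d * c') (c * b' + d * d').
Proof.
apply/matrixP=> i j; rewrite !mxE !big_ord_recl big_ord0 !mxE /= addr0.
by case: ifP; case: ifP.
Qed.

Lemma mx2_inj a b c d a' b' c' d' :
  mx2 a b c d = mx2 a' b' c' d' -> [/\ a = a', b = b', c = c' & d = d'].
Proof.
move/matrixP=> E; have := E 0 0; have := E 0 1; have := E 1 0; have := E 1 1.
by rewrite !mxE.
Qed.

Lemma col2P (u v : 'cV[C]_2) : u 0 0 = v 0 0 -> u 1 0 = v 1 0 -> u = v.
Proof.
move=> E0 E1; apply/colP=> -[[|[|]]] //= lti.
  by rewrite [Ordinal _](_ : _ = 0) //; apply: val_inj.
by rewrite [Ordinal _](_ : _ = 1) //; apply: val_inj.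
Qed.

Lemma mx2_mulc a b c d (v : 'cV[C]_2) :
  ((mx2 a b c d *m v) 0 0 = a * v 0 0 + b * v 1 0) *
  ((mx2 a b c d *m v) 1 0 = c * v 0 0 + d * v 1 0).
Proof.
have e1 : lift ord0 ord0 = 1 :> 'I_2 by apply: val_inj.
by split; rewrite !mxE !big_ord_recl big_ord0 !mxE /= addr0 e1.
Qed.

Lemma mx2_1 : mx2 1 0 0 1 = 1%:M.
Proof. by apply/matrixP=> -[[|[|]]] //= ? [[|[|]]] //= ?; rewrite !mxE. Qed.

Lemma zeta_unit : zeta \is a GRing.unit.
Proof.
rewrite unitfE; apply/eqP=> z0; have := prim_expr_order zeta_prim.
by rewrite z0 expr0n => /eqP; rewrite eq_sym oner_eq0.
Qed.

Lemma zeta_mod m n : m = n %[mod 6] -> zeta ^+ m = zeta ^+ n.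
Proof. by move=> E; apply/eqP; rewrite (eq_prim_root_expr zeta_prim); apply/eqP. Qed.

Lemma zetaD (k l : 'Z_6) : zeta ^+ (k + l)%R = zeta ^+ k * zeta ^+ l.
Proof. by rewrite -exprD; apply: zeta_mod; rewrite /= modn_mod. Qed.

Lemma zetaX_neq0 m : zeta ^+ m != 0.
Proof. by rewrite -unitfE unitrX ?zeta_unit. Qed.

Lemma zetaN (k : 'Z_6) : zeta ^+ (- k)%R = zeta ^- k.
Proof.
by apply: (mulfI (zetaX_neq0 k)); rewrite mulfV ?zetaX_neq0 // -zetaD subrr.
Qed.

Lemma zeta_eq1 (k : 'Z_6) : zeta ^+ k = 1 -> k = 0.
Proof.
move/eqP; rewrite -(prim_order_dvd zeta_prim) /dvdn modn_small; last exact: ltn_ord.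
by move/eqP=> k0; apply: val_inj.
Qed.

Lemma dih6_mx_repr : mx_repr [set: dih6] dih6_mx.
Proof.
split=> [|[k b] [l c] _ _]; first by rewrite /dih6_mx /= expr0 invr1 mx2_1.
have El : zeta ^+ (if b then - l else l)%R = if b then zeta ^- l else zeta ^+ l.
  by case: b; rewrite ?zetaN.
rewrite dih6_mulE /dih6_mul /dih6_mx /fst /snd.
rewrite !zetaD El; case: b {El}; case: c; rewrite /= mx2M;
  by rewrite !(mul0r, mulr0, addr0, add0r) ?invfM ?invrK.
Qed.

Definition dih6_repr := MxRepresentation dih6_mx_repr.

Lemma dih6_faithful : mx_faithful dih6_repr.
Proof.
apply/fintype.subsetP=> [[k b]]; rewrite inE => /andP[_ /eqP].
rewrite mul1mx /= /dih6_mx -mx2_1; case: b => /= /mx2_inj[E E'] ? _.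
  by move/eqP: E; rewrite eq_sym oner_eq0.
by rewrite (zeta_eq1 E); apply/set1P.
Qed.

Lemma dih6_is_refl w : is_refl dih6_repr w = w.2.
Proof.
case: w => k b; rewrite /is_refl /= /dih6_mx /=.
have subE a b' c d : mx2 a b' c d - 1%:M = mx2 (a - 1) b' c (d - 1).
  rewrite -mx2_1; apply/matrixP=> i j; rewrite !mxE.
  by case: ifP; case: ifP; rewrite ?subr0.
case: b; rewrite subE.
  rewrite eqn_leq lt0n mxrank_eq0; apply/andP; split; last first.
    rewrite !sub0r; apply/eqP=> /matrixP/(_ 0 0); rewrite !mxE /= => /eqP.
    by rewrite oppr_eq0 oner_eq0.
  have -> : mx2 (0 - 1) (zeta ^+ k) (zeta ^- k) (0 - 1) =
     (\col_i if i == 0 then 1 else - zeta ^- k) *m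
     (\row_j if j == 0 then -1 else zeta ^+ k).
    apply/matrixP=> i j; rewrite !mxE big_ord1 !mxE sub0r.
    by case: ifP; case: ifP; rewrite ?mul1r ?mulrNN ?mulr1 // mulNr mulVf ?zetaX_neq0.
  exact: leq_trans (mulmx_max_rank _ _) _.
have [->|k0] := eqVneq k 0.
  rewrite expr0 invr1 subrr.
  have -> : mx2 0 0 0 0 = 0 by apply/matrixP=> i j; rewrite !mxE; case: ifP; case: ifP.
  by rewrite mxrank0.
have z1 : zeta ^+ k - 1 != 0 by rewrite subr_eq0; apply: contra_neq k0; exact: zeta_eq1.
have z2 : zeta ^- k - 1 != 0.
  by rewrite subr_eq0 -zetaN; apply: contra_neq k0 => /zeta_eq1/eqP; rewrite oppr_eq0 => /eqP.
rewrite mxrank_unit // unitmxE.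
have -> : \det (mx2 (zeta ^+ k - 1) 0 0 (zeta ^- k - 1)) =
    (zeta ^+ k - 1) * (zeta ^- k - 1).
  rewrite det_trig ?big_ord_recl ?big_ord0 ?mxE /= ?mulr1 //.
  by apply/is_trig_mxP=> -[[|[|]]] //= ? [[|[|]]] //= ?; rewrite !mxE.
by rewrite unitfE mulf_neq0.
Qed.

Lemma dih6_gen_refl : <<[set s | is_refl dih6_repr s]>>%g = [set: dih6].
Proof.
apply/eqP; rewrite finset.eqEsubset finset.subsetT /= -dih6_gen genS //.
by apply/fintype.subsetP=> w /set2P[]->; rewrite inE dih6_is_refl.
Qed.

Lemma dih6_rootP s : is_refl dih6_repr s -> forall v : 'cV[C]_2,
  dih6_repr s *m v = v <-> dih6_root s *m v = 0.
Proof.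
case: s => k b; rewrite dih6_is_refl /= => -> v; rewrite /dih6_mx /=.
split=> [/matrixP/(_ 0 0)|/matrixP/(_ 0 0)].
  rewrite !mxE !big_ord_recl big_ord0 !mxE /= mul0r add0r addr0 => E.
  apply/matrixP=> i j; rewrite !ord1 !mxE !big_ord_recl big_ord0 !mxE /=.
  by rewrite -E mul1r addr0 mulNr subrr.
rewrite !mxE !big_ord_recl big_ord0 !mxE /= mul1r addr0 mulNr => /eqP.
rewrite subr_eq0 => /eqP E; apply/matrixP=> i j; rewrite !ord1.
rewrite !mxE !big_ord_recl big_ord0 !mxE /= addr0.
case: i => [[|[|]]] //= ?; rewrite mul0r ?add0r ?addr0 ?E.
  by rewrite -E; congr (v _ _); apply: val_inj.
by rewrite mulKf ?zetaX_neq0 //; congr (v _ _); apply: val_inj.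
Qed.

Lemma dih6_corootP s : is_refl dih6_repr s -> forall v : 'cV[C]_2,
  (exists c, v = c *: dih6_coroot s) <-> (exists u, v = dih6_repr s *m u - u).
Proof.
case: s => k b; rewrite dih6_is_refl /= => -> v; rewrite /dih6_mx /=.
split=> [[c ->]|[u ->]].
  exists (\col_i if i == 0 then 0 else c).
  apply: col2P; rewrite [RHS]mxE ?(mx2_mulc _ _ _ _ _).1 ?(mx2_mulc _ _ _ _ _).2.
    by rewrite !mxE /= mul0r add0r subr0 mulrC.
  by rewrite !mxE /= mulr0 mul0r add0r sub0r mulrN1.
exists (u 1 0 - zeta ^- k * u 0 0).
apply: col2P; rewrite [LHS]mxE ?(mx2_mulc _ _ _ _ _).1 ?(mx2_mulc _ _ _ _ _).2.
  by rewrite !mxE /= mul0r add0r mulrBl mulrAC mulVf ?zetaX_neq0 // mul1r mulrC.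
by rewrite !mxE /= mul0r addr0 mulrN1 opprB.
Qed.

Definition G2 : refl_group C :=
  ReflGroup dih6_faithful dih6_gen_refl dih6_rootP dih6_corootP.

Lemma s_is_refl i : is_refl (rgrep G2) (s_ i).
Proof. by rewrite dih6_is_refl. Qed.

Definition refl_s (i : 'Z_6) : Ref G2 := exist _ (s_ i) (s_is_refl i).

Definition hx : cher G2 := hvec (W := G2) (delta_mx 0 0).
Definition hy : cher G2 := hvec (W := G2) (delta_mx 1 0).
Definition hX : cher G2 := hcov (W := G2) (delta_mx 0 0).
Definition hY : cher G2 := hcov (W := G2) (delta_mx 0 1).

Definition zA : centre G2 := zpar (refl_s 0).
Definition zB : centre G2 := zpar (refl_s 1).

(* The multiplication map C[A, B] (x) C[X, Y] (x) C W (x) C[x, y] -> H, an    *)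
(* element of the source being a family F, indexed by W, of polynomials in    *)
(* the commuting variables A, B, X, Y, x, y.                                  *)
Definition pbw (F : dih6 -> {mpoly C[6]}) : cher G2 :=
  \sum_(w : dih6) \sum_(m <- msupp (F w)) (F w)@_m *:
    (val zA ^+ m (inord 0) * val zB ^+ m (inord 1)
     * hX ^+ m (inord 2) * hY ^+ m (inord 3)
     * hgrp (W := G2) w
     * hx ^+ m (inord 4) * hy ^+ m (inord 5)).

Definition var_X : {mpoly C[6]} := 'X_(inord 2).
Definition var_Y : {mpoly C[6]} := 'X_(inord 3).
Definition var_x : {mpoly C[6]} := 'X_(inord 4).
Definition var_y : {mpoly C[6]} := 'X_(inord 5).

(* Trunc h = f.                                                               *)
Definition is_trunc (h : cher G2) (f : {mpoly C[6]}) : Prop :=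
  exists2 F, pbw F = h & F 1%g = f.

(* Trunc^-1 f = z.                                                            *)
Definition is_trunc_inv (f : {mpoly C[6]}) (z : centre G2) : Prop :=
  forall z' : centre G2, is_trunc (val z') f <-> z' = z.

End TypeG2.
Arguments var_X {C}.
Arguments var_Y {C}.
Arguments var_x {C}.
Arguments var_y {C}.

(* Main.v *)
(* Let e be the averaging idempotent of W; every e h e equals s e for a unique
   central s (Satake isomorphism). Given a fixed point chi, put psi(h) = chi(s):
   it vanishes on words in x, y, X, Y whose degree is not divisible by 6, and
   reordering the words gives recurrences for b_a = psi(X^a x^a) and
   c_a = psi(X^a y^a) which express all values of chi as polynomials in those of
   A, B, r, R, eu and yield the relation. Conversely, the representation of H on
   functions on the orbit of the point (p, 0), p <> 0, gives a fixed point for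
   each solution with R = p^6. These solutions are dense in the hypersurface,
   which is irreducible, so there are no further relations and every solution
   comes from a fixed point.
   The relation reads prod_a (eu - gamma_a) = r R, where gamma is 3(A+B),
   -3(A+B), 3(A-B), -3(A-B), 0, 0. This is the equation of the Calogero-Moser
   space of the cyclic group of order 6 at the parameter whose discrete Fourier
   transform is gamma; hence Conjecture FIX. *)

Require Import Defs.
From HB Require Import structures.
From mathcomp Require Import all_boot all_order all_fingroup all_algebra all_character.
From mathcomp Require Import boolp classical_sets functions reals complex mpoly.
From mathcomp Require Import ring zify.
From mathcomp Require ssrcomplements.

Set Implicit Arguments.
Unset Strict Implicit.
Unset Printing Implicit Defensive.

Import GRing.Theory Num.Theory.
Local Open Scope ring_scope.

(** * Polynomial functions on a hypersurface *)

(** The recurrence for c_a always comes multiplied by eu, so it leaves c_3 and c_6 undetermined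
    where eu = 0. The missing information is multiplicative: psi(h e h') = psi(h) psi(h'), and
    averaging over W turns this into quadratic relations between values on words. The constants
    3(A+B) and 3(A-B) are the only nonzero values of the Fourier sums of the parameters, at
    frequencies 0 and 3 mod 6. Uniqueness, both of s in the Satake isomorphism and of a central
    element with given truncation, rests on linear independence of the ordered monomials. It is
    obtained from the same orbit representations, taken over C[T] with momenta proportional to T:
    the degree in T counts the letters x and y, and the leading coefficient reads off the top part
    in x, y. The point (p, 0) is chosen because a sixth root of unity moves it inside its orbit,
    which makes the resulting character invariant under the group of sixth roots of unity. On the
    cyclic side the idempotents of the group algebra replace e: on each of them the products x X and
    X x are eu minus a constant. *)

Section MpolyVanish.
Variable C : numFieldType.

Lemma poly_vanish (p : {poly C}) : (forall x, p.[x] = 0) -> p = 0.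
Proof.
move=> p0; apply/eqP/negPn/negP=> nz.
pose rs : seq C := [seq i%:R | i <- iota 0 (size p)].
have urs : uniq rs.
  by rewrite map_inj_uniq ?iota_uniq // => i j /eqP; rewrite eqr_nat => /eqP.
have := max_poly_roots nz (rs := rs); rewrite size_map size_iota ltnn.
by move=> H; apply: notF; apply: H => //; apply/allP=> x _; apply/eqP.
Qed.

(** Induction on the number of variables: [pk k] is the coefficient of the k-th power of the last
    variable. Once the other variables have values, the polynomial [P] in the last one has every
    element of [C] as a root. *)
Lemma mpoly_vanish n (p : {mpoly C[n]}) : (forall v, p.@[v] = 0) -> p = 0.
Proof.
elim: n p => [|n IHn] p p0.
  have := p0 (fun=> 0); rewrite mevalE => E; apply/mpolyP=> m.
  rewrite mcoeff0; case: (boolP (m \in msupp p)) => [mp|/memN_msupp_eq0//].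
  rewrite -[RHS]E (bigD1_seq m) ?msupp_uniq //= big_ord0 mulr1 big1 ?addr0 //.
  by move=> m' /eqP[]; apply/mnmP=> -[].
pose res (m : 'X_{1..n.+1}) := [multinom m (widen_ord (leqnSn n) i) | i < n].
pose pk k := \sum_(m <- msupp p | m ord_max == k) p@_m *: 'X_[res m] : {mpoly C[n]}.
have pk0 k : pk k = 0.
  apply: IHn => v.
  pose P := \sum_(m <- msupp p) (p@_m * \prod_i v i ^+ res m i) *: 'X^(m ord_max).
  suff P0 : P = 0.
    rewrite -[RHS](coef0 C k) -P0 /P coef_sum raddf_sum /= big_mkcond /=.
    apply: eq_bigr => m _; rewrite coefZ coefXn eq_sym.
    by case: eqP => _; rewrite ?mulr1 ?mulr0 ?meval0 // mevalZ mevalX.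
  apply: poly_vanish => x.
  rewrite horner_sum -[RHS](p0 (fun i => if unlift ord_max i is Some j then v j else x)).
  rewrite mevalE; apply: eq_bigr => m _; rewrite hornerZ hornerXn -mulrA; congr (_ * _).
  rewrite big_ord_recr /= unlift_none; congr (_ * _); apply: eq_bigr => i _.
  rewrite mnmE; have -> : widen_ord (leqnSn n) i = lift ord_max i.
    by apply: val_inj; rewrite /= /bump leqNgt ltn_ord.
  by rewrite liftK.
apply/mpolyP=> m; rewrite mcoeff0; have /(congr1 (mcoeff (res m))) := pk0 (m ord_max).
rewrite mcoeff0 raddf_sum /= => E.
case: (boolP (m \in msupp p)) => [mp|/memN_msupp_eq0//].
rewrite -[RHS]E big_mkcond (bigD1_seq m) ?msupp_uniq //= eqxx mcoeffZ mcoeffX.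
rewrite eqxx mulr1 -[LHS]addr0; congr (_ + _).
rewrite big1 // => m' m'm; case: eqP => // e; rewrite mcoeffZ mcoeffX.
case: eqP => [/mnmP E'|]; last by rewrite mulr0.
case/eqP: m'm; apply/mnmP=> i; case: (unliftP ord_max i) => [j|] ->; last by [].
have -> : lift ord_max j = widen_ord (leqnSn n) j.
  by apply: val_inj; rewrite /= /bump leqNgt ltn_ord.
by have := E' j; rewrite !mnmE.
Qed.

Lemma mpoly_gen_ind (R : comNzRingType) n (P : {mpoly R[n]} -> Prop) :
  (forall c, P c%:MP) -> (forall i, P 'X_i) ->
  (forall p q, P p -> P q -> P (p + q)) ->
  (forall p q, P p -> P q -> P (p * q)) -> forall p, P p.
Proof.
move=> Pc PX PD PM; elim/mpolyind=> [|c m p _ _ Pp]; first exact: Pc 0.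
apply: PD => //; rewrite -mul_mpolyC; apply: (PM) => //; rewrite mpolyXE_id.
elim/big_ind: _ => [||i _]; [exact: (Pc 1) | exact: (PM) |].
elim: (m i) => [|k IHk]; first by rewrite expr0; exact: (Pc 1).
by rewrite exprS; apply: PM.
Qed.

Section Evaluation.
Variables (K : idomainType) (B : Type) (at_ : B -> {rmorphism K -> C}).
Hypothesis at_sep : forall c, (forall b, at_ b c = 0) -> c = 0.

Section Ev.
Variable n : nat.

(** The coefficient ring [K] is seen through the evaluations [at_ b]. When [K] is a polynomial ring
    in the parameters, [b] is a value of the parameters and [v] a value of the generators. *)
Definition ev2 (b : B) (v : 'I_n -> C) (p : {mpoly K[n]}) : C := mmap (at_ b) v p.

HB.instance Definition _ b v := GRing.RMorphism.copy (@ev2 b v) (mmap (at_ b) v).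

Lemma ev2C b v c : ev2 b v c%:MP = at_ b c.
Proof. exact: mmapC. Qed.

Lemma ev2X b v i : ev2 b v 'X_i = v i.
Proof. by rewrite /ev2 mmapX mmap1U. Qed.

Lemma ev2_vanish (p : {mpoly K[n]}) : (forall b v, ev2 b v p = 0) -> p = 0.
Proof.
move=> p0; apply/mpolyP=> k; rewrite mcoeff0; apply: at_sep => b.
pose q := map_mpoly (at_ b) p.
rewrite -mcoeff_map_mpoly (_ : map_mpoly _ _ = 0) ?mcoeff0 //.
apply: mpoly_vanish => v; rewrite -[RHS](p0 b v) /q.
elim/mpoly_gen_ind: (p) => [c|i|p1 p2|p1 p2].
- by rewrite map_mpolyC mevalC ev2C.
- by rewrite map_mpolyX mevalXU ev2X.
- by rewrite !raddfD /= => -> ->.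
- by rewrite !rmorphM /= => -> ->.
Qed.
End Ev.

(* On the hypersurface [G = X_0 X_1], [G] a product of linear factors in [X_2],
   the points with [X_1 != 0] are parametrized freely by the parameters, [X_1]
   and [X_2]; they are dense because [X_1] is not a zero divisor modulo the
   relation ([X1_cancel]). *)
Section Hypersurface.
Variable cs : seq K.

Local Notation A := {mpoly K[3]}.
Local Notation X0 := ('X_(inord 0) : A).
Local Notation X1 := ('X_(inord 1) : A).
Local Notation X2 := ('X_(inord 2) : A).

Definition hypG : A := \prod_(c <- cs) (X2 - c%:MP).
Definition hyp_rel : A := hypG - X0 * X1.

Definition pt3 (r R e : C) : 'I_3 -> C := fun j => nth 0 [:: r; R; e] j.

Lemma pt3_0 r R e : pt3 r R e (inord 0) = r.
Proof. by rewrite /pt3 inordK. Qed.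
Lemma pt3_1 r R e : pt3 r R e (inord 1) = R.
Proof. by rewrite /pt3 inordK. Qed.
Lemma pt3_2 r R e : pt3 r R e (inord 2) = e.
Proof. by rewrite /pt3 inordK. Qed.

Lemma pt3E v : v = pt3 (v (inord 0)) (v (inord 1)) (v (inord 2)).
Proof.
apply/funext=> j; rewrite /pt3 -[j in LHS]inord_val.
by case: j => [[|[|[|]]]].
Qed.

Lemma ev2_hypG b v : ev2 b v hypG = \prod_(c <- cs) (v (inord 2) - at_ b c).
Proof.
by rewrite rmorph_prod /=; apply: eq_bigr => c _; rewrite rmorphB /= ev2X ev2C.
Qed.

Lemma ev2_hyp_rel b v : ev2 b v hyp_rel =
  \prod_(c <- cs) (v (inord 2) - at_ b c) - v (inord 0) * v (inord 1).
Proof. by rewrite rmorphB /= rmorphM /= ev2_hypG !ev2X. Qed.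

Definition on_chart b v := v (inord 1) != 0 /\ ev2 b v hyp_rel = 0.

Lemma on_chartP b R e : R != 0 ->
  on_chart b (pt3 ((\prod_(c <- cs) (e - at_ b c)) / R) R e).
Proof.
move=> R0; split; first by rewrite pt3_1.
by rewrite ev2_hyp_rel pt3_0 pt3_1 pt3_2 divfK // subrr.
Qed.

(** Independence of a variable is stated on values, which is all that [ev2_vanish] looks at. *)
Definition indep (i : 'I_3) (p : A) := forall b v v',
  (forall j, j != i -> v j = v' j) -> ev2 b v p = ev2 b v' p.

Lemma indepD i p q : indep i p -> indep i q -> indep i (p + q).
Proof. by move=> Ip Iq b v v' E; rewrite !raddfD /= (Ip b v v') ?(Iq b v v'). Qed.

Lemma indepM i p q : indep i p -> indep i q -> indep i (p * q).
Proof. by move=> Ip Iq b v v' E; rewrite !rmorphM /= (Ip b v v') ?(Iq b v v'). Qed.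

Lemma indepC i c : indep i c%:MP.
Proof. by move=> b v v' _; rewrite !ev2C. Qed.

Lemma indepX i j : j != i -> indep i 'X_j.
Proof. by move=> ji b v v' E; rewrite !ev2X E. Qed.

Lemma indepXn i p k : indep i p -> indep i (p ^+ k).
Proof.
move=> Ip; elim: k => [|k IHk]; first exact: indepC.
by rewrite exprS; apply: indepM.
Qed.

Lemma inord3_neq i j : (i < 3)%N -> (j < 3)%N -> i != j -> inord i != inord j :> 'I_3.
Proof. by move=> i3 j3 ij; apply: contra_neq ij => /(congr1 val); rewrite /= !inordK. Qed.

Lemma indep_hypG i : i != inord 2 -> indep i hypG.
Proof.
move=> i2 b v v' E; rewrite !ev2_hypG; apply: eq_bigr => c _.
by rewrite E // eq_sym.
Qed.

Lemma hypG_neq0 : hypG != 0.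
Proof.
rewrite /hypG; elim/big_ind: _ => [|p q|c _]; first exact: oner_neq0.
  exact: mulf_neq0.
apply/eqP=> E.
have := congr1 (mcoeff U_(inord 2)%MM) E.
rewrite mcoeffB mcoeffX eqxx mcoeffC mcoeff0 mnm1_eq0 mulr0 subr0 => /eqP.
by rewrite oner_eq0.
Qed.

(** Modulo [hyp_rel] the product X_0 X_1 is [hypG], which does not involve X_0; each factor X_1
    therefore trades one X_0 for the other variables. *)
Lemma elim_X0 (p : A) : exists N p' q,
  X1 ^+ N * p = q * hyp_rel + p' /\ indep (inord 0) p'.
Proof.
have i10 : inord 1 != inord 0 :> 'I_3 by exact: inord3_neq.
have IX1 k : indep (inord 0) (X1 ^+ k) by exact/indepXn/indepX.
elim/mpoly_gen_ind: p => [c|i|p1 p2|p1 p2].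
- exists 0%N, c%:MP, 0; rewrite mul1r mul0r add0r; split=> //; exact: indepC.
- have [->|i0] := eqVneq i (inord 0).
    exists 1%N, hypG, (-1); rewrite expr1 /hyp_rel mulN1r opprB mulrC addrNK.
    by split=> //; apply: indep_hypG; apply: inord3_neq.
  exists 0%N, 'X_i, 0; rewrite mul1r mul0r add0r; split=> //; exact: indepX.
- case=> N1 [p1' [q1 [E1 I1]]] [N2 [p2' [q2 [E2 I2]]]].
  exists (N1 + N2)%N, (X1 ^+ N2 * p1' + X1 ^+ N1 * p2'), (X1 ^+ N2 * q1 + X1 ^+ N1 * q2).
  split; last by apply: indepD; apply: indepM.
  transitivity (X1 ^+ N2 * (X1 ^+ N1 * p1) + X1 ^+ N1 * (X1 ^+ N2 * p2)).
    by rewrite exprD; ring.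
  by rewrite E1 E2; ring.
- case=> N1 [p1' [q1 [E1 I1]]] [N2 [p2' [q2 [E2 I2]]]].
  exists (N1 + N2)%N, (p1' * p2'), (q1 * q2 * hyp_rel + q1 * p2' + p1' * q2).
  split; last exact: indepM.
  transitivity ((X1 ^+ N1 * p1) * (X1 ^+ N2 * p2)); first by rewrite exprD; ring.
  by rewrite E1 E2; ring.
Qed.

Lemma split_X1 (p : A) : exists p0 p1, p = p0 + X1 * p1 /\ indep (inord 1) p0.
Proof.
elim/mpoly_gen_ind: p => [c|i|p q|p q].
- by exists c%:MP, 0; rewrite mulr0 addr0; split=> //; exact: indepC.
- have [->|i0] := eqVneq i (inord 1).
    by exists 0, 1; rewrite add0r mulr1; split=> // b v v' _; rewrite !raddf0.
  by exists 'X_i, 0; rewrite mulr0 addr0; split=> //; exact: indepX.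
- case=> p0 [p1 [-> Ip]] [q0 [q1 [-> Iq]]]; exists (p0 + q0), (p1 + q1).
  by split; [ring | exact: indepD].
- case=> p0 [p1 [-> Ip]] [q0 [q1 [-> Iq]]].
  exists (p0 * q0), (p0 * q1 + p1 * q0 + X1 * p1 * q1).
  by split; [ring | exact: indepM].
Qed.

Lemma X1_neq0 : X1 != 0.
Proof.
apply/eqP=> /(congr1 (mcoeff U_(inord 1)%MM)); rewrite mcoeffX eqxx mcoeff0.
by move/eqP; rewrite oner_eq0.
Qed.

(** At X_1 = 0 the relation becomes [hypG], which is nonzero and free of X_1. Hence the part [q0] of
    [q] free of X_1 satisfies q0 hypG = 0, so [q] is divisible by X_1. *)
Lemma X1_cancel N (p q : A) : X1 ^+ N * p = q * hyp_rel -> exists q', p = q' * hyp_rel.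
Proof.
elim: N q => [|N IHN] q; first by rewrite mul1r => ->; exists q.
have [q0 [q1 [-> Iq]]] := split_X1 q => E.
suff q00 : q0 = 0.
  apply: (IHN q1).
  apply: (mulfI X1_neq0).
  rewrite mulrA.
  rewrite -exprS.
  rewrite E. rewrite q00. rewrite add0r.  rewrite mulrA. by [].
apply: (mulIf hypG_neq0); rewrite mul0r; apply: ev2_vanish => b v.
pose v' j := if j == inord 1 then 0 else v j.
have ev' : forall j, j != inord 1 -> v j = v' j by move=> j /negPf j1; rewrite /v' j1.
have IG : indep (inord 1) (q0 * hypG).
  by apply: indepM => //; apply: indep_hypG; apply: inord3_neq.
rewrite (IG b v v') // -[RHS](_ : ev2 b v' (X1 ^+ N.+1 * p) = 0); last first.
  by rewrite rmorphM rmorphXn /= ev2X /v' eqxx expr0n mul0r.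
have v'1 : v' (inord 1) = 0 by rewrite /v' eqxx.
by rewrite E /hyp_rel !(rmorphM, rmorphD, rmorphN) /= !ev2X !v'1 mul0r mulr0 oppr0 !addr0.
Qed.

(** Where X_1 is nonzero, X_0 can be adjusted to satisfy the relation without changing the value of
    [p]. The extra factor X_1 takes care of the remaining points. *)
Lemma indep_chart_vanish (p : A) : indep (inord 0) p ->
  (forall b v, on_chart b v -> ev2 b v p = 0) -> p = 0.
Proof.
move=> Ip p0; apply: (mulfI X1_neq0); rewrite mulr0; apply: ev2_vanish => b v.
rewrite rmorphM /= ev2X; have [->|v1] := eqVneq (v (inord 1)) 0; first by rewrite mul0r.
have /p0 E := on_chartP b (v (inord 2)) v1; rewrite -[RHS](mulr0 (v (inord 1))) -E.
congr (_ * _); apply: Ip => j j0; rewrite [v in LHS]pt3E /pt3.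
by case: j j0 => [[|[|[|]]]] //= j3 /eqP[]; apply: val_inj; rewrite /= inordK.
Qed.

(** Elimination of X_0 turns a product vanishing on the chart into a zero product in a domain. The
    lemma serves twice: with one factor equal to 1 it gives the ideal of relations, and in general
    the irreducibility of the fixed point variety. *)
Lemma chart_irreducible (p1 p2 : A) :
  (forall b v, on_chart b v -> ev2 b v (p1 * p2) = 0) ->
  (exists q, p1 = q * hyp_rel) \/ (exists q, p2 = q * hyp_rel).
Proof.
move=> p0; have [N1 [p1' [q1 [E1 I1]]]] := elim_X0 p1.
have [N2 [p2' [q2 [E2 I2]]]] := elim_X0 p2.
have /eqP : p1' * p2' = 0.
  apply: indep_chart_vanish => [|b v bv]; first exact: indepM.
  have -> : p1' * p2' = X1 ^+ (N1 + N2) * (p1 * p2)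
     - (q1 * (X1 ^+ N2 * p2 ) + q2 * p1') * hyp_rel.
    have -> : p1' = X1 ^+ N1 * p1 - q1 * hyp_rel by rewrite E1; ring.
    have -> : p2' = X1 ^+ N2 * p2 - q2 * hyp_rel by rewrite E2; ring.
    by rewrite exprD; ring.
  by rewrite rmorphB /= rmorphM /= p0 // rmorphM /= bv.2 !mulr0 subr0.
rewrite mulf_eq0 => /orP[]/eqP E; [left|right].
  by apply: (X1_cancel (N := N1) (q := q1)); rewrite E1 E addr0.
by apply: (X1_cancel (N := N2) (q := q2)); rewrite E2 E addr0.
Qed.

Lemma chart_vanish (p : A) :
  (forall b v, on_chart b v -> ev2 b v p = 0) -> exists q, p = q * hyp_rel.
Proof.
move=> p0; have [//|[q E]] : (exists q, p = q * hyp_rel) \/ (exists q, 1 = q * hyp_rel).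
  by apply: chart_irreducible => b v /p0; rewrite mulr1.
by exists (p * q); rewrite -mulrA -E mulr1.
Qed.

End Hypersurface.
End Evaluation.
End MpolyVanish.

(** * The Cherednik algebra of type G2 *)

Section PresentedModule.
Variables (K : comNzRingType) (X : Type) (rel : expr K X -> expr K X -> Prop).
Variables (M : lmodType K) (f : X -> M -> M).

(** Expressions act on vectors directly, so that compatibility with a relation is an equality of two
    functions on [M]. *)
Fixpoint expr_op (t : expr K X) (v : M) : M :=
  match t with
  | Cst a => a *: v
  | Gen x => f x v
  | Add t u => expr_op t v + expr_op u v
  | Mul t u => expr_op t (expr_op u v)
  end.

Definition pres_op (h : pres_alg rel) : M -> M := expr_op (generic_quotient.repr h).

Hypothesis f_lin : forall x, linear (f x).
Hypothesis f_rel : forall t u, rel t u -> expr_op t =1 expr_op u.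

Lemma expr_op_lin t : linear (expr_op t).
Proof.
elim: t => [a|x|t IHt u IHu|t IHt u IHu] b v w /=.
- by rewrite scalerDr !scalerA mulrC.
- exact: f_lin.
- by rewrite IHt IHu scalerDr addrACA.
- by rewrite IHu IHt.
Qed.

Lemma expr_opD t : {morph expr_op t : v w / v + w}.
Proof. by move=> v w; have := expr_op_lin t 1 v w; rewrite !scale1r. Qed.

Lemma expr_op0 t : expr_op t 0 = 0.
Proof. by apply: (addIr (expr_op t 0)); rewrite -expr_opD !add0r. Qed.

Lemma expr_opZ t a : {morph expr_op t : v / a *: v}.
Proof. by move=> v; have := expr_op_lin t a v 0; rewrite expr_op0 !addr0. Qed.

Lemma expr_op_eqv t u : pres_eqv rel t u -> expr_op t =1 expr_op u.
Proof.
elim=> {t u} /=.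
- by [].
- by [].
- by move=> t u _ E v; rewrite E.
- by move=> t u v _ E _ E' w; rewrite E E'.
- by move=> t t' u u' _ E _ E' w; rewrite E E'.
- by move=> t t' u u' _ E _ E' w; rewrite E E'.
- by move=> t u v w; rewrite addrA.
- by move=> t u v; rewrite addrC.
- by move=> t v; rewrite scale0r add0r.
- by [].
- by move=> t v; rewrite !scale0r.
- by move=> t v; rewrite scale1r.
- by [].
- by move=> t u v w; rewrite expr_opD.
- by move=> a b v; rewrite scalerDl.
- by move=> a b v; rewrite scalerA.
- by move=> a t v; rewrite expr_opZ.
Qed.

Lemma pres_op_cls t : pres_op (pcls rel t) =1 expr_op t.
Proof. exact/expr_op_eqv/repr_pcls. Qed.

Lemma pres_op_gen x : pres_op (pgen rel x) =1 f x.
Proof. exact: pres_op_cls. Qed.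

Lemma pres_opD g h v : pres_op (g + h) v = pres_op g v + pres_op h v.
Proof.
by elim/pres_algW: g => t; elim/pres_algW: h => u; rewrite -pcls_Add !pres_op_cls.
Qed.

Lemma pres_opM g h v : pres_op (g * h) v = pres_op g (pres_op h v).
Proof.
by elim/pres_algW: g => t; elim/pres_algW: h => u; rewrite -pcls_Mul !pres_op_cls.
Qed.

Lemma pres_opZ a h v : pres_op (a *: h) v = a *: pres_op h v.
Proof. by elim/pres_algW: h => t; rewrite -pcls_scale !pres_op_cls. Qed.

Lemma pres_op1 v : pres_op 1 v = v.
Proof. by rewrite -[1]scale1r -pcls_Cst pres_op_cls /= scale1r. Qed.

Lemma pres_op_lin h : linear (pres_op h).
Proof. exact: expr_op_lin. Qed.

(** Applied to multiplication by an element of the commutative algebra [K] of coefficients, it makes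
    the orbit representations [K]-linear. *)
Lemma pres_op_comm (D : M -> M) : linear D ->
  (forall x v, f x (D v) = D (f x v)) -> forall h v, pres_op h (D v) = D (pres_op h v).
Proof.
move=> D_lin Df.
have DD v w : D (v + w) = D v + D w by have := D_lin 1 v w; rewrite !scale1r.
have D0 : D 0 = 0 by apply: (addIr (D 0)); rewrite -DD !add0r.
have DZ a v : D (a *: v) = a *: D v by have := D_lin a v 0; rewrite D0 !addr0.
move=> h; rewrite /pres_op; elim: (generic_quotient.repr h) => //= [t IHt u IHu|t IHt u IHu] v.
  by rewrite IHt IHu DD.
by rewrite IHu IHt.
Qed.

End PresentedModule.

Section Cher.
Variables (C : fieldType) (W : refl_group C).
Local Notation rel := (@cher_rel C W).
Local Notation H := (cher W).

Lemma cher_relE t u : rel t u -> pcls rel t = pcls rel u.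
Proof. by move=> r; apply/pclsP/Pres_rel. Qed.

Lemma hvec_lin a u v : hvec (a *: u + v) = a *: hvec u + hvec v :> H.
Proof. by have := cher_relE (Cher_Vec_lin a u v); rewrite pcls_Add pcls_scale. Qed.

Lemma hcov_lin a u v : hcov (a *: u + v) = a *: hcov u + hcov v :> H.
Proof. by have := cher_relE (Cher_Cov_lin a u v); rewrite pcls_Add pcls_scale. Qed.

Lemma hgrp1 : hgrp 1%g = 1 :> H.
Proof. by have := cher_relE (Cher_Grp1 W); rewrite pcls_Cst scale1r. Qed.

Lemma hgrpM v w : hgrp (v * w)%g = hgrp v * hgrp w :> H.
Proof. by have := cher_relE (Cher_GrpM v w); rewrite pcls_Mul. Qed.

Lemma hgrp_vec w u : hgrp w * hvec u = hvec (rgrep W w *m u) * hgrp w :> H.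
Proof. by have := cher_relE (Cher_Grp_Vec w u); rewrite !pcls_Mul. Qed.

Lemma hgrp_cov w U : hgrp w * hcov U = hcov (U *m rgrep W w^-1%g) * hgrp w :> H.
Proof. by have := cher_relE (Cher_Grp_Cov w U); rewrite !pcls_Mul. Qed.

Lemma hpar_conj (s s' : Ref W) w : val s' = (val s ^ w)%g -> hpar s = hpar s' :> H.
Proof. by move/Cher_Par_conj/cher_relE. Qed.

Lemma hpar_comm s h : hpar s * h = h * hpar s :> H.
Proof. exact/centralP/hpar_central. Qed.

Lemma hvecC u v : hvec u * hvec v = hvec v * hvec u :> H.
Proof. by have := cher_relE (Cher_VecC u v); rewrite !pcls_Mul. Qed.

Lemma hcovC u v : hcov u * hcov v = hcov v * hcov u :> H.
Proof. by have := cher_relE (Cher_CovC u v); rewrite !pcls_Mul. Qed.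

Lemma hvec_cov u U : hvec u * hcov U = hcov U * hvec u +
  \sum_(s : Ref W) Defs.comm_coef u U (val s) *: (hpar s * hgrp (val s)) :> H.
Proof.
have := cher_relE (Cher_comm u U); rewrite pcls_Add !pcls_Mul pcls_sum => E.
by rewrite [LHS]E; congr (_ + _); apply: eq_bigr => s _; rewrite pcls_scale pcls_Mul.
Qed.

Lemma cher_ind (P : H -> Prop) : P 1 ->
  (forall a u v, P u -> P v -> P (a *: u + v)) ->
  (forall x u, P u -> P ((pgen rel x : H) * u)) -> forall h, P h.
Proof.
move=> P1 Plin Pgen h.
have P0 : P 0 by rewrite -(subrr 1) -scaleN1r addrC; apply: (Plin).
suff H' : forall t u, P u -> P ((pcls rel t : H) * u).
  by rewrite -[h](mulr1 (h : H)) -[h](pcls_repr h); exact: H'.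
elim=> [a|x|t IHt t' IHt'|t IHt t' IHt'] u Pu.
- by rewrite pcls_Cst -[_ * u]scalerAl mul1r -[_ *: _]addr0; apply: (Plin).
- exact: Pgen.
- by rewrite pcls_Add mulrDl -[X in X + _]scale1r; apply: (Plin); auto.
- by rewrite pcls_Mul -mulrA; auto.
Qed.

End Cher.

(** The scalar that the letter [L a b] acquires when [g w] moves past it. The rotation (k, false)
    scales x and Y by zeta^k, and y and X by the inverse; for a reflection the exponent changes
    sign, as s_0 acts before the rotation. *)
Definition ph (C : fieldType) (z : C) (w : dih6) (a b : bool) : C :=
  if w.2 (+) a (+) b then z ^- w.1 else z ^+ w.1.

(** The scalar -2 <u, alpha_i> <alpha_i^vee, U> / <alpha_i^vee, alpha_i> for u in {x, y} and U in
    {X, Y}, simplified by <alpha_i^vee, alpha_i> = 2 zeta^i. *)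
Definition kap (C : fieldType) (z : C) (i : 'Z_6) (b b' : bool) : C :=
  if b == b' then -1 else if b then z ^+ i else z ^- i.

(* [L false] lists x, y and [L true] lists X, Y; [c b] is the parameter of the
   reflections s_i with i = b mod 2. *)
Record is_g2 (C : fieldType) (z : C) (H : algType C)
    (g : dih6 -> H) (L : bool -> bool -> H) (c : bool -> H) : Prop := IsG2 {
  g2_1 : g 1%g = 1;
  g2_M : forall v w, g (v * w)%g = g v * g w;
  g2_c : forall b h, c b * h = h * c b;
  g2_gL : forall w a b, g w * L a b = ph z w a b *: (L a (b (+) w.2) * g w);
  g2_LC : forall a b b', L a b * L a b' = L a b' * L a b;
  g2_LL : forall b b', L false b * L true b' =
    L true b' * L false b + \sum_(i : 'Z_6) kap z i b b' *: (c (odd i) * g (s_ i));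
  g2_ind : forall P : H -> Prop, P 1 ->
    (forall a u v, P u -> P v -> P (a *: u + v)) -> (forall w u, P u -> P (g w * u)) ->
    (forall a b u, P u -> P (L a b * u)) -> (forall b u, P u -> P (c b * u)) ->
    forall h, P h }.

Section Instance.
Variables (C : numFieldType) (z : C) (zp : 6.-primitive_root z).
Local Notation W := (G2 zp).

Definition cher_L (a b : bool) : cher W :=
  if a then if b then hY zp else hX zp else if b then hy zp else hx zp.
Definition cher_c (b : bool) : cher W := hpar (refl_s zp (if b then 1 else 0)).

Lemma refl_s_bij : bijective (refl_s zp).
Proof.
exists (fun s : Ref W => (val s : dih6).1) => [i|[[k b] Hs]] //; apply: val_inj => /=.
by have : b by [have := Hs; rewrite dih6_is_refl]; case: (b).
Qed.

Lemma Zp6_odd2 (i : 'Z_6) : i = (odd i)%:R + (i./2)%:R *+ 2.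
Proof. by rewrite -[LHS]natr_Zp -{1}[i : nat]odd_double_half natrD -muln2 natrM mulr_natr. Qed.

(** This is why the parameter of s_i depends only on the parity of i. *)
Lemma s_conj (i k : 'Z_6) : (s_ (i + k *+ 2) : dih6) = (s_ i ^ ((- k, false) : dih6))%g.
Proof.
rewrite conjgE !dih6_mulE /dih6_mul /=; congr (_, _).
by rewrite opprK addrCA addrC -addrA -mulr2n.
Qed.

Lemma cher_cE i : hpar (refl_s zp i) = cher_c (odd i).
Proof.
symmetry; apply: (@hpar_conj _ W _ (refl_s zp i) (- (i./2)%:R, false)).
by rewrite /= -s_conj [in LHS](Zp6_odd2 i); case: (odd i).
Qed.

Lemma hvecE u : hvec u = u 0 0 *: hx zp + u 1 0 *: hy zp :> cher W.
Proof.
have -> : u = u 0 0 *: delta_mx 0 0 + (u 1 0 *: delta_mx 1 0 + 0).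
  by apply: col2P; rewrite !mxE /= ?mulr1 ?mulr0 ?addr0 ?add0r.
have h0 : hvec 0 = 0 :> cher W.
  have := hvec_lin (W := W) 0 0 0; rewrite !scaler0 addr0 scale0r add0r => E.
  have /(congr1 (fun h => h - hvec 0)) := hvec_lin (W := W) 1 0 0.
  by rewrite scaler0 add0r scale1r subrr addrK.
by rewrite !hvec_lin h0 addr0 !mxE /= !mulr1 !mulr0 !addr0 add0r.
Qed.

Lemma hcovE U : hcov U = U 0 0 *: hX zp + U 0 1 *: hY zp :> cher W.
Proof.
have -> : U = U 0 0 *: delta_mx 0 0 + (U 0 1 *: delta_mx 0 1 + 0).
  by apply/trmx_inj/col2P; rewrite !mxE /= ?mulr1 ?mulr0 ?addr0 ?add0r.
have h0 : hcov 0 = 0 :> cher W.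
  have /(congr1 (fun h => h - hcov 0)) := hcov_lin (W := W) 1 0 0.
  by rewrite scaler0 add0r scale1r subrr addrK.
by rewrite !hcov_lin h0 addr0 !mxE /= !mulr1 !mulr0 !addr0 add0r.
Qed.
 
Lemma cher_g2 : is_g2 z (fun w => hgrp (W := W) w) cher_L cher_c.
Proof.
have zk0 := zetaX_neq0 zp.
split.
- exact: (@hgrp1 _ W).
- by move=> v w; exact: (@hgrpM _ W v w).
- by move=> b h; exact: hpar_comm.
- have vecE (w : dih6) (j : 'I_2) : hgrp (W := W) w * hvec (W := W) (delta_mx j 0 : 'cV_2) =
      (dih6_mx z w 0 j *: hx zp + dih6_mx z w 1 j *: hy zp) * hgrp (W := W) w.
    by rewrite hgrp_vec hvecE -colE !mxE.
  have covE (w : dih6) (j : 'I_2) : hgrp (W := W) w * hcov (W := W) (delta_mx 0 j : 'rV_2) =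
      (dih6_mx z w^-1%g j 0 *: hX zp + dih6_mx z w^-1%g j 1 *: hY zp) * hgrp (W := W) w.
    by rewrite hgrp_cov hcovE -rowE !mxE.
  case=> k w2 [] b; case: w2; case: b;
    rewrite /cher_L ?vecE ?covE /dih6_mx /= !mxE /= ?scale0r ?addr0 ?add0r -?scalerAl
      /ph /= ?(zetaN zp) ?invrK //.
- case; case; case; [reflexivity | exact: hcovC | exact: hcovC | reflexivity |
    reflexivity | exact: hvecC | exact: hvecC | reflexivity].
- move=> b b'; pose u : 'cV[C]_2 := delta_mx (if b then 1 else 0) 0.
  pose U : 'rV[C]_2 := delta_mx 0 (if b' then 1 else 0).
  have -> : cher_L false b = hvec (W := W) u by case: b @u.
  have -> : cher_L true b' = hcov (W := W) U by case: b' @U.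
  rewrite hvec_cov; congr (_ + _); rewrite {}/u {}/U.
  rewrite (reindex _ (onW_bij _ refl_s_bij)) /=; apply: eq_bigr => i _.
  rewrite cher_cE; congr (_ *: _).
  rewrite /Defs.comm_coef /pairing /= -!colE -!rowE !mxE /=.
  have -> : \det (dih6_mx z (s_ i)) = -1.
    rewrite (expand_det_row _ 0) !big_ord_recl big_ord0 /dih6_mx /= !mxE /= mul0r add0r addr0.
    by rewrite /cofactor det_mx11 !mxE /= expr1 mulN1r mulrN mulfV.
  have z2 : 2%:R != 0 :> C by rewrite pnatr_eq0.
  rewrite ?big_ord_recl ?big_ord0 ?mxE /=.
  rewrite /kap; move: (z ^+ i) (zk0 i) => t t0.
  rewrite (_ : 1 * t + (- t * -1 + 0) = 2 * t); last by ring.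
  by case: b; case: b' => /=; field; rewrite ?t0 ?z2.
- move=> P P1 Plin Pg PL Pc; apply: cher_ind => // -[s|u|U|w] h Ph.
  + have [i ->] : exists i, s = refl_s zp i.
      by have [f _ fK] := refl_s_bij; exists (f s); rewrite fK.
    by rewrite -[pgen _ _]/(hpar _) cher_cE; apply: Pc.
  + rewrite -[pgen _ _]/(hvec _) hvecE mulrDl -!scalerAl; apply: (Plin).
      exact: (PL false false).
    rewrite -[X in P X]addr0; apply: (Plin); first exact: (PL false true).
    by rewrite -(subrr h) -scaleN1r addrC; apply: (Plin).
  + rewrite -[pgen _ _]/(hcov _) hcovE mulrDl -!scalerAl; apply: (Plin).
      exact: (PL true false).
    rewrite -[X in P X]addr0; apply: (Plin); first exact: (PL true true).
    by rewrite -(subrr h) -scaleN1r addrC; apply: (Plin).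
  + exact: Pg.
Qed.

End Instance.

(** * Central elements: x y, X Y, eu and the family interpolating between r and R *)

Section PowerSum.
Variables (K : nzRingType) (I : finType) (p p' P : K) (t w : I -> K).

Lemma comm_exp (D : K) n : p * P = P * p + D ->
  p ^+ n * P = P * p ^+ n + \sum_(j < n) p ^+ j * D * p ^+ (n.-1 - j).
Proof.
move=> pP; elim: n => [|n IHn]; first by rewrite big_ord0 mul1r mulr1 addr0.
rewrite exprS -mulrA IHn mulrDr mulrA pP mulrDl -!mulrA -exprS -addrA; congr (_ + _).
rewrite big_ord_recl /= expr0 mul1r subn0; congr (_ + _); rewrite mulr_sumr.
apply: eq_bigr => -[j jn] _ /=; rewrite !mulrA -exprS; congr (_ * p ^+ _).
by rewrite /bump add1n subnS -!subn1 subnAC.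
Qed.

Lemma skew_exp (a b s : K) (u : K) n : (forall h, u * h = h * u) ->
  s * a = u * b * s -> s * a ^+ n = u ^+ n * b ^+ n * s.
Proof.
move=> uC sa; elim: n => [|n IHn]; first by rewrite !mul1r mulr1.
rewrite exprSr mulrA IHn -!mulrA sa !mulrA; congr (_ * _).
by rewrite -[u ^+ n * _ * u]mulrA -uC !mulrA -exprSr -mulrA -exprSr.
Qed.
End PowerSum.

(** By the Leibniz rule both commutators are sums of terms with one [t i] inside a power. Moving
    [t i] to the right exchanges p and p' up to powers of the central element [w i], whose inverse
    is written [w i ^+ 5]; the terms coming from p and from p' then cancel in pairs. *)
Lemma power_sum_comm (K : nzRingType) (I : finType) (p p' P : K) (t w : I -> K) :
  p * p' = p' * p -> (forall i h, w i * h = h * w i) -> (forall i, w i ^+ 6 = 1) ->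
  (forall i, t i * p = w i ^+ 5 * p' * t i) -> (forall i, t i * p' = w i * p * t i) ->
  p * P = P * p + \sum_i t i -> p' * P = P * p' + \sum_i - (w i * t i) ->
  (p ^+ 6 + p' ^+ 6) * P = P * (p ^+ 6 + p' ^+ 6).
Proof.
move=> pp' wC w6 tp tp' pP p'P.
have wXC i k h : w i ^+ k * h = h * w i ^+ k by apply/esym/commrX/esym/wC.
rewrite mulrDl mulrDr (comm_exp 6 pP) (comm_exp 6 p'P) addrACA -[RHS]addr0; congr (_ + _).
(* The j-th term for p is paired with the term of index 5 - j for p'. *)
rewrite [X in _ + X](reindex_inj rev_ord_inj) /= -big_split big1 //= => j _.
rewrite mulr_sumr !mulr_suml mulr_sumr mulr_suml -big_split big1 //= => i _.
have jE : (5 - (6 - j.+1) = j)%N by rewrite subSS subKn // -ltnS.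
have wE : w i ^+ 5 ^+ (5 - j) = w i ^+ j.+1.
  rewrite -exprM -(expr_mod _ (w6 i)) -[RHS](expr_mod _ (w6 i)); congr (_ ^+ _).
  by case: j {jE} => [[|[|[|[|[|[|]]]]]]].
have E1 : p ^+ j * t i * p ^+ (5 - j) = w i ^+ j.+1 * (p ^+ j * p' ^+ (5 - j) * t i).
  by rewrite -mulrA (skew_exp _ (wXC i 5%N) (tp i)) wE !mulrA -wXC.
have E2 : p' ^+ (5 - j) * - (w i * t i) * p' ^+ j =
    - (w i ^+ j.+1 * (p' ^+ (5 - j) * p ^+ j * t i)).
  rewrite mulrN mulNr -!mulrA (skew_exp _ (wC i) (tp' i)) !mulrA -wC -!mulrA.
  by rewrite [p' ^+ _ * (w i ^+ _ * _)]mulrA -wXC !mulrA -exprS.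
rewrite jE subSS E1 E2; apply/eqP; rewrite subr_eq0; apply/eqP; congr (_ * (_ * _)).
exact/commrX/commr_sym/commrX/commr_sym.
Qed.

Section Central.
Variables (C : numFieldType) (z : C) (zp : 6.-primitive_root z) (H : algType C).
Variables (g : dih6 -> H) (L : bool -> bool -> H) (c : bool -> H).
Hypothesis ax : is_g2 z g L c.

Definition centr (h : H) := forall h', h * h' = h' * h.

Lemma centr_gen h : (forall w, h * g w = g w * h) ->
  (forall a b, h * L a b = L a b * h) -> centr h.
Proof.
move=> hg hL; apply: (g2_ind ax) => [|a u v hu hv|w u hu|a b u hu|b u hu].
- by rewrite mulr1 mul1r.
- by rewrite mulrDr mulrDl -scalerAr -scalerAl hu hv.
- by rewrite mulrA hg -!mulrA hu.
- by rewrite mulrA hL -!mulrA hu.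
- by rewrite mulrA -(g2_c ax) -!mulrA hu.
Qed.

Definition cs (i : 'Z_6) := c (odd i) * g (s_ i).
Definition TT b b' := \sum_(i : 'Z_6) kap z i b b' *: cs i.

Lemma L_comm b b' : L false b * L true b' = L true b' * L false b + TT b b'.
Proof. exact: (g2_LL ax). Qed.

Lemma cs_L i a b : cs i * L a b = ph z (s_ i) a b *: (L a (~~ b) * cs i).
Proof.
by rewrite /cs -mulrA (g2_gL ax) addbT -scalerAr !mulrA (g2_c ax _ (L a _)).
Qed.

Lemma TT_L b b' a d : TT b b' * L a d =
  L a (~~ d) * \sum_(i : 'Z_6) (kap z i b b' * ph z (s_ i) a d) *: cs i.
Proof.
rewrite /TT mulr_suml mulr_sumr; apply: eq_bigr => i _.
by rewrite -scalerAl cs_L scalerA scalerAr.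
Qed.

Lemma TTtt : TT true true = TT false false. Proof. by []. Qed.

Lemma zV (i : nat) : z ^+ i * z ^- i = 1.
Proof. by rewrite mulfV // zetaX_neq0. Qed.

Definition hq := L false false * L false true.
Definition hQ := L true false * L true true.
(** The mixed order x X + Y y absorbs the reflection terms: since [x, X] = [y, Y], the same element
    is X x + y Y. Using one form on each side of a letter gives centrality. *)
Definition heu := L false false * L true false + L true true * L false true.

Lemma heuE : heu = L true false * L false false + L false true * L true true.
Proof. by rewrite /heu !L_comm TTtt addrAC -addrA. Qed.

(** The commutator with X or Y has two parts, one for each factor of x y. Once the reflections have
    moved past the remaining letter, the two coefficients of each s_i are opposite. *)
Lemma hq_comm a b : hq * L a b = L a b * hq.
Proof.
rewrite /hq; case: a.
  rewrite -mulrA L_comm mulrDr mulrA L_comm mulrDl -!mulrA -addrA; apply/eqP.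
  rewrite eq_sym -subr_eq0 opprD addNKr oppr_eq0 TT_L -mulrDr /TT -big_split /=.
  rewrite big1 ?mulr0 // => i _; rewrite -scalerDl.
  by case: b; rewrite /kap /ph /= ?mulN1r ?(mulrC (z ^- i)) ?zV ?addrN ?addNr scale0r.
by rewrite -mulrA (g2_LC ax false true b) !mulrA (g2_LC ax false false b).
Qed.

Lemma hQ_comm a b : hQ * L a b = L a b * hQ.
Proof.
rewrite /hQ; case: a.
  by rewrite -mulrA (g2_LC ax true true b) !mulrA (g2_LC ax true false b).
rewrite mulrA L_comm mulrDl -[X in _ = X + _]mulrA L_comm mulrDr !mulrA -[RHS]addrA.
rewrite -[LHS]addr0; congr (_ + _); rewrite TT_L -mulrDr /TT -big_split /=; symmetry.
rewrite big1 ?mulr0 // => i _; rewrite -scalerDl.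
by case: b; rewrite /kap /ph /= ?mulN1r ?zV ?addrN ?addNr scale0r.
Qed.

Lemma heu_comm a b : heu * L a b = L a b * heu.
Proof.
have QE : L true true * L true false = hQ by rewrite (g2_LC ax).
have qE : L false true * L false false = hq by rewrite (g2_LC ax).
case: a; case: b.
- rewrite [heu in RHS]heuE /heu mulrDl mulrDr !mulrA QE; congr (_ + _).
  by rewrite hQ_comm -!mulrA.
- rewrite [heu in LHS]heuE /heu mulrDl mulrDr !mulrA -/hQ; congr (_ + _).
  by rewrite hQ_comm -!mulrA QE.
- rewrite [heu in LHS]heuE /heu mulrDl mulrDr !mulrA qE; congr (_ + _).
  by rewrite hq_comm -!mulrA.
- rewrite [heu in RHS]heuE /heu mulrDl mulrDr !mulrA -/hq; congr (_ + _).
  by rewrite hq_comm -!mulrA qE.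
Qed.

Lemma ph6 w a b : ph z w a b ^+ 6 = 1.
Proof.
have z6 : z ^+ 6 = 1 := prim_expr_order zp.
by rewrite /ph; case: ifP => _; rewrite ?exprVn -exprM mulnC exprM z6 expr1n ?invr1.
Qed.

Lemma ph_opp w a b a' b' : a' (+) b' = ~~ (a (+) b) -> ph z w a b * ph z w a' b' = 1.
Proof.
rewrite /ph -!addbA => ->; rewrite addbN.
by case: (_ (+) _) => /=; rewrite ?zV // mulrC zV.
Qed.

Lemma ph_same w a b a' b' : a' (+) b' = a (+) b -> ph z w a' b' = ph z w a b.
Proof. by rewrite /ph -!addbA => ->. Qed.

Lemma g_LL w a b a' b' : g w * (L a b * L a' b') =
  (ph z w a b * ph z w a' b') *: (L a (b (+) w.2) * L a' (b' (+) w.2) * g w).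
Proof.
rewrite mulrA (g2_gL ax) -scalerAl -[L _ _ * g w * _]mulrA (g2_gL ax) -scalerAr scalerA.
by rewrite mulrA.
Qed.

Lemma hq_centr : centr hq.
Proof.
apply: centr_gen hq_comm => w; rewrite /hq g_LL ph_opp // scale1r; congr (_ * _).
by case: (w.2); rewrite //= (g2_LC ax).
Qed.

Lemma hQ_centr : centr hQ.
Proof.
apply: centr_gen hQ_comm => w; rewrite /hQ g_LL ph_opp // scale1r; congr (_ * _).
by case: (w.2); rewrite //= (g2_LC ax).
Qed.

Lemma heu_centr : centr heu.
Proof.
apply: centr_gen heu_comm => w; rewrite {2}/heu mulrDr !g_LL !ph_opp // !scale1r.
by rewrite -mulrDl; congr (_ * _); case: (w.2); rewrite //= heuE addrC.
Qed.

Lemma c_centr b : centr (c b).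
Proof. exact: (g2_c ax). Qed.

(* In H[T], x + Y T and y + X T commute, and the sum of their sixth powers is
   central; the coefficients [ha i] interpolate between r = [ha 0] and
   R = [ha 6]. *)
Definition Lp b : {poly H} := (L false b)%:P + (L true (~~ b))%:P * 'X.
Definition A6 : {poly H} := Lp false ^+ 6 + Lp true ^+ 6.
Definition ha i := A6`_i.

Lemma kapX (i : 'Z_6) b : kap z i true b = - (z ^+ i * kap z i false b).
Proof.
by case: b; rewrite /kap /= ?zV // mulrN1 opprK.
Qed.

Lemma kapX' (i : 'Z_6) b : kap z i b false = - (z ^+ i * kap z i b true).
Proof.
by case: b; rewrite /kap /= ?zV // mulrN1 opprK.
Qed.

Lemma mul_lin (p0 p1 q0 q1 : H) :
  (p0%:P + p1%:P * 'X) * (q0%:P + q1%:P * 'X) =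
  (p0 * q0)%:P + (p0 * q1 + p1 * q0)%:P * 'X + (p1 * q1)%:P * 'X * 'X.
Proof.
have XC (p : {poly H}) : 'X * p = p * 'X by rewrite (commr_polyX p).
rewrite !(mulrDl, mulrDr) !polyCM polyCD mulrDl !polyCM !mulrA !addrA.
by rewrite -[p1%:P * 'X * q0%:P]mulrA -[p1%:P * 'X * q1%:P]mulrA !XC !mulrA.
Qed.

(** The constant and quadratic coefficients are x y and X Y; the linear coefficients of the two
    products are the two forms of eu. *)
Lemma LpC : Lp false * Lp true = Lp true * Lp false.
Proof.
rewrite /Lp !mul_lin /=; congr (_%:P + _%:P * 'X + _%:P * 'X * 'X).
- exact: (g2_LC ax).
- by rewrite -/heu heuE addrC.
- exact: (g2_LC ax).
Qed.

Lemma Lp_Y b b' : Lp b * (L true b')%:P =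
  (L true b')%:P * Lp b + \sum_i (kap z i b b' *: cs i)%:P.
Proof.
have XC (p : {poly H}) : 'X * p = p * 'X by rewrite (commr_polyX p).
rewrite /Lp mulrDl mulrDr -polyCM L_comm polyCD polyCM -!addrA; congr (_ + _).
rewrite -mulrA XC !mulrA -!polyCM (g2_LC ax true (~~ b)) addrC; congr (_ + _).
by rewrite /TT rmorph_sum.
Qed.

Lemma Lp_y b b' : Lp b * (L false b')%:P =
  (L false b')%:P * Lp b + \sum_i - ((kap z i b' (~~ b) *: cs i)%:P * 'X).
Proof.
have XC (p : {poly H}) : 'X * p = p * 'X by rewrite (commr_polyX p).
rewrite /Lp mulrDl mulrDr -!polyCM (g2_LC ax) -!addrA; congr (_ + _).
rewrite -mulrA XC !mulrA -!polyCM L_comm polyCD mulrDl -addrA -[LHS]addr0; congr (_ + _).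
by rewrite sumrN -mulr_suml /TT rmorph_sum /= addrN.
Qed.

(** Each s_i exchanges [Lp false] and [Lp true] up to a power of zeta^i, and the commutators of the
    two with a letter differ by the factors -zeta^i; so [power_sum_comm] applies with w_i = zeta^i.
    The claim [key] covers both kinds of letters, with u = 1 for X, Y and u = T for x, y. *)
Lemma A6_comm a b : A6 * (L a b)%:P = (L a b)%:P * A6.
Proof.
pose w (i : 'Z_6) : {poly H} := ((z ^+ i)%:A)%:P.
have XC (p : {poly H}) : 'X * p = p * 'X by rewrite (commr_polyX p).
have AC (k : C) (h : H) : k%:A * h = h * k%:A by rewrite -scalerAl -scalerAr mul1r mulr1.
have wC i p : w i * p = p * w i by apply/polyP=> j; rewrite coefCM coefMC AC.
have wX i k : w i ^+ k = ((z ^+ i ^+ k)%:A)%:P by rewrite /w -rmorphXn exprZn expr1n.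
have w6 i : w i ^+ 6 = 1.
  by rewrite wX -exprM mulnC exprM (prim_expr_order zp) expr1n scale1r.
have csLp i b' : (cs i)%:P * Lp b' =
    ((ph z (s_ i) false b')%:A)%:P * Lp (~~ b') * (cs i)%:P.
  rewrite /Lp !mulrDr mulrDl !mulrA -!polyCM !cs_L; congr (_ + _).
    by rewrite -mulrA -scalerAl mul1r.
  rewrite -[RHS]mulrA (XC (cs i)%:P) [RHS]mulrA -polyCM; congr (_%:P * _).
  by rewrite negbK -mulrA -scalerAl mul1r; congr (_ *: _).
have tE i k : (k *: cs i)%:P = (k%:A)%:P * (cs i)%:P.
  by rewrite -polyCM -scalerAl mul1r.
have ph_t i : ph z (s_ i) false true = z ^+ i by [].
have ph_f i : ph z (s_ i) false false = z ^+ i ^+ 5.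
  have zi : z ^+ i * z ^+ i ^+ 5 = 1.
    by rewrite -exprS -exprM mulnC exprM (prim_expr_order zp) expr1n.
  by rewrite /ph /= -[LHS]mulr1 -zi mulrA [z ^- _ * _]mulrC zV mul1r.
pose t0 i : {poly H} := (cs i)%:P.
have t0p i : t0 i * Lp false = w i ^+ 5 * Lp true * t0 i by rewrite /t0 csLp ph_f wX.
have t0p' i : t0 i * Lp true = w i * Lp false * t0 i by rewrite /t0 csLp ph_t.
have kC k (p : {poly H}) : (k%:A)%:P * p = p * (k%:A)%:P.
  by apply/polyP=> j; rewrite coefCM coefMC AC.
have key (P : {poly H}) (k : 'Z_6 -> C) (u : {poly H}) :
   (forall p, u * p = p * u) ->
   Lp false * P = P * Lp false + \sum_i (k i *: cs i)%:P * u ->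
   Lp true * P = P * Lp true + \sum_(i : 'Z_6) (- (z ^+ i * k i) *: cs i)%:P * u ->
   A6 * P = P * A6.
  move=> uC E0 E1.
  have sC i p : ((k i)%:A)%:P * u * p = p * (((k i)%:A)%:P * u).
    by rewrite -mulrA uC !mulrA kC.
  apply: (@power_sum_comm _ _ _ _ _ (fun i => ((k i)%:A)%:P * u * t0 i) w) => //.
  - exact: LpC.
  - by move=> i /=; rewrite -[LHS]mulrA t0p [LHS]mulrA (sC _ (_ * _)) -!mulrA.
  - by move=> i /=; rewrite -[LHS]mulrA t0p' [LHS]mulrA (sC _ (_ * _)) -!mulrA.
  - rewrite E0; congr (_ + _); apply: eq_bigr => i _.
    by rewrite /= tE -[RHS]mulrA uC [RHS]mulrA.
  - rewrite E1; congr (_ + _); apply: eq_bigr => i _.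
    rewrite /= scaleNr polyCN mulNr; congr (- _).
    rewrite -[_ * u * _]mulrA uC !mulrA -!polyCM; congr (_%:P * _).
    by rewrite -!scalerAl mul1r -scalerAl mul1r scalerA.
case: a.
  apply: (key _ (fun i => kap z i false b) 1) => [p||]; first by rewrite mulr1 mul1r.
    by rewrite Lp_Y; congr (_ + _); apply: eq_bigr => i _; rewrite mulr1.
  by rewrite Lp_Y; congr (_ + _); apply: eq_bigr => i _; rewrite mulr1 kapX.
apply: (key _ (fun i => - kap z i b true) 'X) => [p||]; first by rewrite XC.
  by rewrite Lp_y; congr (_ + _); apply: eq_bigr => i _; rewrite scaleNr polyCN mulNr.
rewrite Lp_y; congr (_ + _); apply: eq_bigr => i _.
by rewrite mulrN opprK kapX' scaleNr polyCN mulNr opprK.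
Qed.

Lemma g_Lp w b : (g w)%:P * Lp b =
  ((ph z w false b)%:A)%:P * Lp (b (+) w.2) * (g w)%:P.
Proof.
have XC (p : {poly H}) : 'X * p = p * 'X by rewrite (commr_polyX p).
rewrite /Lp !mulrDr mulrDl !mulrA -!polyCM !(g2_gL ax); congr (_ + _).
  by rewrite -mulrA -scalerAl mul1r.
rewrite -[RHS]mulrA (XC (g w)%:P) [RHS]mulrA -polyCM; congr (_%:P * _).
rewrite -mulrA -scalerAl mul1r addNb; congr (_ *: _).
by apply: ph_same; case: (b).
Qed.

(** Group elements permute [Lp false] and [Lp true] up to sixth roots of unity, which disappear in
    the sixth powers. *)
Lemma ha_centr i : centr (ha i).
Proof.
have kC k (p : {poly H}) : (k%:A)%:P * p = p * (k%:A)%:P.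
  by apply/polyP=> j; rewrite coefCM coefMC -scalerAl -scalerAr mul1r mulr1.
apply: centr_gen => [w|a b]; last first.
  by have /(congr1 (fun p : {poly H} => p`_i)) := A6_comm a b; rewrite coefMC coefCM.
suff /(congr1 (fun p : {poly H} => p`_i)) : A6 * (g w)%:P = (g w)%:P * A6.
  by rewrite coefMC coefCM.
have gX b : (g w)%:P * Lp b ^+ 6 = Lp (b (+) w.2) ^+ 6 * (g w)%:P.
  rewrite (skew_exp (u := ((ph z w false b)%:A)%:P) _ (kC _) (g_Lp w b)).
  by rewrite -rmorphXn exprZn expr1n ph6 scale1r mul1r.
by rewrite /A6 mulrDl mulrDr !gX; case: (w.2); rewrite //= addrC.
Qed.

End Central.

(** * The spherical subalgebra *)

Section Satake.
Variables (C : numFieldType) (z : C) (zp : 6.-primitive_root z) (H : algType C).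
Variables (g : dih6 -> H) (L : bool -> bool -> H) (c : bool -> H).
Hypothesis ax : is_g2 z g L c.

Local Notation centr := (@centr C H).

Lemma centr1 : centr 1. Proof. by move=> h; rewrite mul1r mulr1. Qed.

Lemma centr_lin a s t : centr s -> centr t -> centr (a *: s + t).
Proof. by move=> sC tC h; rewrite mulrDl mulrDr -scalerAl -scalerAr sC tC. Qed.

Lemma centrM s t : centr s -> centr t -> centr (s * t).
Proof. by move=> sC tC h; rewrite -mulrA tC mulrA sC mulrA. Qed.

Lemma centr0 : centr 0. Proof. by move=> h; rewrite mul0r mulr0. Qed.

Fact avg_key : unit. Proof. exact: tt. Qed.
Definition avg : H := locked_with avg_key ((12%:R^-1 : C) *: \sum_(w : dih6) g w).
Lemma avgE : avg = (12%:R^-1 : C) *: \sum_(w : dih6) g w.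
Proof. exact: unlock. Qed.
Local Notation e := avg.

Lemma g_avg w : g w * e = e.
Proof.
rewrite avgE -scalerAr mulr_sumr; congr (_ *: _).
rewrite [RHS](reindex_inj (mulgI w)); apply: eq_bigr => v _.
by rewrite (g2_M ax).
Qed.

Lemma avg_g w : e * g w = e.
Proof.
rewrite avgE -scalerAl mulr_suml; congr (_ *: _).
rewrite [RHS](reindex_inj (mulIg w)); apply: eq_bigr => v _.
by rewrite (g2_M ax).
Qed.

Lemma card_dih6 : #|{: dih6}| = 12%N.
Proof. by rewrite card_prod card_ord card_bool. Qed.

Lemma avg_idem : e * e = e.
Proof.
rewrite {1}avgE -scalerAl mulr_suml (eq_bigr (fun _ => e)) => [|w _]; last exact: g_avg.
by rewrite sumr_const card_dih6 -scaler_nat scalerA mulVf ?pnatr_eq0 // scale1r.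
Qed.

Definition sat h := exists2 s, centr s & e * h * e = s * e.

Lemma sat_lin a u v : sat u -> sat v -> sat (a *: u + v).
Proof.
case=> s sC Es [t tC Et]; exists (a *: s + t); first exact: centr_lin.
by rewrite mulrDr !mulrDl -!(scalerAr, scalerAl) Es Et.
Qed.

Lemma sat_centr s h : centr s -> sat h -> sat (s * h).
Proof.
move=> sC [t tC Et]; exists (s * t); first exact: centrM.
by rewrite mulrA -sC -!mulrA [e * (h * e)]mulrA Et.
Qed.

Lemma sat1 : sat 1.
Proof. by exists 1; [exact: centr1 | rewrite mulr1 avg_idem mul1r]. Qed.

Lemma sat0 : sat 0.
Proof. by exists 0; [exact: centr0 | rewrite mulr0 !mul0r]. Qed.

Lemma satZ a h : sat h -> sat (a *: h).
Proof. by move=> Sh; rewrite -[_ *: _]addr0; apply: sat_lin Sh sat0. Qed.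

Lemma satD u v : sat u -> sat v -> sat (u + v).
Proof. by move=> Su Sv; rewrite -[u]scale1r; apply: sat_lin. Qed.

Lemma satB u v : sat u -> sat v -> sat (u - v).
Proof. by move=> Su Sv; rewrite -scaleN1r addrC; apply: sat_lin. Qed.

Lemma sat_unscale a h : a != 0 -> sat (a *: h) -> sat h.
Proof. by move=> a0 /(satZ a^-1); rewrite scalerA mulVf // scale1r. Qed.

Lemma sat_sum (I : finType) (F : I -> H) : (forall i, sat (F i)) -> sat (\sum_i F i).
Proof. by move=> SF; elim/big_ind: _ => // [|u v]; [exact: sat0 | exact: satD]. Qed.

Lemma sat_sub u v : sat (u - v) -> sat v -> sat u.
Proof. by move=> Suv Sv; rewrite -(subrK v u); apply: satD. Qed.

Lemma sat_subC u v : sat (u - v) -> sat (v - u).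
Proof. by move=> S; rewrite -opprB -scaleN1r; apply: satZ. Qed.

Lemma sat_subT v u w : sat (u - v) -> sat (v - w) -> sat (u - w).
Proof. by move=> S1 S2; rewrite -(subrK v u) -addrA; apply: satD. Qed.

Lemma sat_gl w h : sat h -> sat (g w * h).
Proof. by case=> s sC E; exists s; rewrite // mulrA avg_g. Qed.

Lemma sat_gr w h : sat h -> sat (h * g w).
Proof. by case=> s sC E; exists s; rewrite // -!mulrA g_avg mulrA. Qed.

Definition wd (v : seq (bool * bool)) : H := \prod_(l <- v) L l.1 l.2.

Definition flip (w : dih6) v := [seq (l.1, l.2 (+) w.2) | l <- v] : seq (bool * bool).

Definition phw (w : dih6) (v : seq (bool * bool)) := \prod_(l <- v) ph z w l.1 l.2.

Lemma wd_cat u v : wd (u ++ v) = wd u * wd v.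
Proof. exact: big_cat. Qed.

Lemma wd_cons l v : wd (l :: v) = L l.1 l.2 * wd v.
Proof. exact: big_cons. Qed.

Lemma g_wd w v : g w * wd v = phw w v *: (wd (flip w v) * g w).
Proof.
elim: v => [|l v IHv]; first by rewrite /wd /phw !big_nil mul1r mulr1 scale1r.
rewrite /= !wd_cons /phw big_cons -/(phw w v) /= mulrA (g2_gL ax) -scalerAl.
by rewrite -[L _ _ * g w * _]mulrA IHv -scalerAr scalerA !mulrA.
Qed.

Lemma ph_neq0 w a b : ph z w a b != 0.
Proof. by rewrite /ph; case: ifP; rewrite ?invr_eq0 zetaX_neq0. Qed.

Lemma phw_neq0 w v : phw w v != 0.
Proof. by rewrite /phw prodf_seq_neq0; apply/allP=> l _; exact: ph_neq0. Qed.

(** A group element inserted next to one e travels through the word to the other. Depending on the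
    word this is a symmetry, or, when the word is fixed and the scalar is not 1, a proof that the
    value is zero. *)
Lemma avg_flip w v : e * wd v * e = phw w v *: (e * wd (flip w v) * e).
Proof.
rewrite -{1}(avg_g w) -[e * g w * _]mulrA g_wd -scalerAr -scalerAl mulrA.
by rewrite -[_ * g w * e]mulrA g_avg.
Qed.

(** The commutator of two letters is a combination of elements c s_i. The parameter is central and
    s_i slides through the rest of the word to be absorbed by e, which leaves a word two letters
    shorter. *)
Lemma sat_swap n u a b v : (forall v, (size v < n)%N -> sat (wd v)) ->
  size (u ++ a :: b :: v) = n -> sat (wd (u ++ a :: b :: v) - wd (u ++ b :: a :: v)).
Proof.
move=> IH; rewrite size_cat /= !addnS => szn.
have satT d d' : sat (wd u * TT z g c d d' * wd v).
  rewrite /TT mulr_sumr mulr_suml; apply: sat_sum => i.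
  rewrite -scalerAr -scalerAl; apply: satZ; rewrite /cs mulrA -(g2_c ax) -!mulrA.
  apply: sat_centr; first exact: (c_centr ax).
  rewrite g_wd -scalerAr; apply: satZ; rewrite mulrA -wd_cat; apply: sat_gr.
  by apply: IH; rewrite size_cat size_map -szn.
rewrite (_ : _ - _ = wd u * (L a.1 a.2 * L b.1 b.2 - L b.1 b.2 * L a.1 a.2) * wd v).
  2: by rewrite !wd_cat !wd_cons mulrBr mulrBl !mulrA.
case: a b {szn} => [[] a] [[] b] /=.
- by rewrite (g2_LC ax) subrr mulr0 mul0r; exact: sat0.
- by rewrite (L_comm ax) opprD addNKr mulrN mulNr -scaleN1r; apply: satZ.
- by rewrite (L_comm ax) addrAC subrr add0r.
- by rewrite (g2_LC ax) subrr mulr0 mul0r; exact: sat0.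
Qed.

(** The prefix [u] holds the letters already in place; the next one is brought to the front of the
    rest by adjacent swaps. *)
Lemma sat_perm n u v v' : (forall v, (size v < n)%N -> sat (wd v)) ->
  perm_eq v v' -> size (u ++ v) = n -> sat (wd (u ++ v) - wd (u ++ v')).
Proof.
move=> IH.
have front u0 v1 a v3 : size (u0 ++ v1 ++ a :: v3) = n ->
    sat (wd (u0 ++ v1 ++ a :: v3) - wd (u0 ++ a :: v1 ++ v3)).
  elim: v1 u0 => [|b v1 IHv] u0 /= sz; first by rewrite subrr; exact: sat0.
  apply: (@sat_subT (wd (u0 ++ b :: a :: v1 ++ v3))).
    have := IHv (rcons u0 b); rewrite !cat_rcons => H'; apply: H'; exact: sz.
  apply: (@sat_swap n); rewrite // -sz !size_cat /= !size_cat /=; lia.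
elim: v' u v => [|a v' IHv] u v vv' sz.
  by move: vv' => /perm_nilP->; rewrite subrr; exact: sat0.
have av : a \in v by rewrite (perm_mem vv') mem_head.
case/splitPr: av vv' sz => v1 v3 vv' sz.
apply: (@sat_subT (wd (u ++ a :: v1 ++ v3))); first exact: front.
have := IHv (rcons u a) (v1 ++ v3); rewrite !cat_rcons; apply.
  rewrite -(perm_cons a); apply: perm_trans vv'.
  by rewrite -[a :: v3]cat1s -[a :: (v1 ++ _)]cat1s perm_catCA.
by rewrite -sz !size_cat /= !size_cat /=; lia.
Qed.

Lemma sat_perm0 n v v' : (forall v, (size v < n)%N -> sat (wd v)) ->
  size v = n -> perm_eq v v' -> sat (wd v') -> sat (wd v).
Proof. by move=> IH sz vv'; apply/sat_sub/(@sat_perm n [::]). Qed.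

Lemma perm_pair (T : eqType) (a b : T) v : a != b -> a \in v -> b \in v ->
  exists v', perm_eq v [:: a, b & v'].
Proof.
move=> ab av bv; exists (rem b (rem a v)); apply: perm_trans (perm_to_rem av) _.
by rewrite perm_cons; apply: perm_to_rem; rewrite rem_mem // eq_sym.
Qed.

Lemma sat_same n a v : (forall v, (size v < n)%N -> sat (wd v)) -> size v = n ->
  (a, false) \in v -> (a, true) \in v -> sat (wd v).
Proof.
move=> IH sz v0 v1; have [//|v' vv'] := perm_pair _ v0 v1; first by case: (a).
apply: (sat_perm0 IH sz vv'); rewrite !wd_cons mulrA; apply: sat_centr.
  by case: (a); [exact: (hQ_centr zp ax) | exact: (hq_centr zp ax)].
by apply: IH; rewrite -sz (perm_size vv') /= ltnS leqnSn.
Qed.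

Lemma heu2E b : heu L =
  L true b * L false b + (if b then L false false * L true false
                          else L false true * L true true).
Proof. by case: b; [rewrite /heu addrC | exact: (heuE ax)]. Qed.

(** Multiplying the rest of the word by eu gives the wanted word plus the one in which the pair has
    the other index [~~ b], so it suffices to treat one of the two. *)
Lemma sat_eu n b v : (forall v, (size v < n)%N -> sat (wd v)) -> size v = n ->
  (true, b) \in v -> (false, b) \in v -> sat (wd v).
Proof.
move=> IH sz v1 v0; have [//|v' vv'] := perm_pair _ v1 v0.
have szv' : size v = (size v').+2 by rewrite (perm_size vv').
have Sv' : sat (wd v') by apply: IH; rewrite -sz szv' ltnS leqnSn.
have Seu : sat (heu L * wd v') by apply: sat_centr Sv'; exact: (heu_centr zp ax).
pose v2 := [:: (false, ~~ b), (true, ~~ b) & v'].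
have sz2 : size v2 = n by rewrite /= -szv'.
have E : heu L * wd v' = wd [:: (true, b), (false, b) & v'] + wd v2.
  by rewrite (heu2E b) mulrDl !wd_cons !mulrA /=; case: (b).
apply: (sat_perm0 IH sz vv'); case: v' => [|[a b'] v'] in vv' szv' Sv' Seu v2 sz2 E *.
  (* For a word of length two the summands of eu are exchanged by s_0, hence equal between two e's
     up to the order of the letters. *)
  apply: (@sat_unscale 2%:R); first by rewrite pnatr_eq0.
  have fl : flip (s_ 0) [:: (true, b); (false, b)] = [:: (true, ~~ b); (false, ~~ b)].
    by rewrite /flip /= !addbT.
  have e2 : e * wd [:: (true, b); (false, b)] * e =
            e * wd [:: (true, ~~ b); (false, ~~ b)] * e.
    rewrite (avg_flip (s_ 0)) fl /phw !big_cons big_nil /ph /=.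
    by case: (b) => /=; rewrite invr1 !mulr1 scale1r.
  have S2 : sat (wd [:: (true, ~~ b); (false, ~~ b)] - wd v2).
    apply: (@sat_perm n [::] _ _ IH); first by rewrite -[_ :: _]cat1s perm_catC.
    by rewrite -sz szv'.
  case: (satD Seu S2) => s sC Es; exists s => //; rewrite -Es E.
  rewrite scaler_nat mulr2n !mulrDr !mulrDl mulrN mulNr e2.
  by rewrite addrACA addrN addr0.
have mem2 (u : seq (bool * bool)) k : (a, k) \in u -> (a, ~~ k) \in u ->
    (a, false) \in u /\ (a, true) \in u by case: k.
(* One more letter (a, b') forms a pair x y or X Y with a letter of the companion word if b' = b,
   and with a letter of the given word otherwise; [sat_same] then applies. *)
have [bb'|bb'] := eqVneq b' b.
  rewrite -[wd _](addrK (wd v2)) -E; apply: satB => //.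
  have [||m0 m1] := mem2 v2 b.
  - by rewrite !inE bb' eqxx !orbT.
  - by rewrite !inE; case: (a); rewrite eqxx ?orbT.
  exact: (sat_same IH sz2 m0 m1).
have {}bb' : b' = ~~ b by case: (b) (b') bb' => [] [].
have [||m0 m1] := mem2 [:: (true, b), (false, b), (a, b') & v'] b.
- by rewrite !inE; case: (a); rewrite eqxx ?orbT.
- by rewrite !inE bb' eqxx !orbT.
by apply: (sat_same IH _ m0 m1); rewrite -sz szv'.
Qed.

(* The rotation (k, false) scales a letter by z^k or z^-k according to [chg]. *)
Definition chg (l : bool * bool) := l.1 (+) l.2.

Lemma sat_mixed n v l1 l2 : (forall v, (size v < n)%N -> sat (wd v)) -> size v = n ->
  l1 \in v -> l2 \in v -> chg l1 != chg l2 -> sat (wd v).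
Proof.
case: l1 l2 => [a1 b1] [a2 b2] IH sz v1 v2; rewrite /chg /=.
case: (eqVneq a1 a2) v2 => [<-{a2}|a12] v2.
  move=> b12; apply: (@sat_same n a1 _ IH sz);
    by case: b1 b2 b12 v1 v2 => [] [] //; rewrite addbC ?eqxx.
have {a12} e2 : a2 = ~~ a1 by case: a1 a2 a12 {v1 v2} => [] [].
rewrite {a2}e2 in v2 * => b12; have {b12} e2 : b2 = b1.
  by case: a1 b1 b2 b12 {v1 v2} => [] [] [].
rewrite {b2}e2 in v2; apply: (@sat_eu n b1 _ IH sz); by case: a1 v1 v2.
Qed.

(** All letters having the same charge, the rotation by zeta scales the word by zeta or its inverse
    to the power of the length, which is not 1; so the word dies between two e's. *)
Lemma sat_rot v k : {in v, forall l, chg l = k} -> ~~ (6 %| size v)%N -> sat (wd v).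
Proof.
move=> vk n6; exists 0; first exact: centr0.
pose w : dih6 := (1, false).
have fl : flip w v = v.
  by rewrite /flip -[RHS]map_id; apply: eq_map => -[a b] /=; rewrite addbF.
have := avg_flip w v; rewrite fl mul0r => /eqP.
rewrite -subr_eq0 -{1}[_ * _ * e]scale1r -scalerBl scaler_eq0 => /orP[|/eqP//].
rewrite subr_eq0 => /eqP; suff : phw w v != 1 by move=> + E; rewrite -E eqxx.
have -> : phw w v = (if k then z^-1 else z) ^+ size v.
  rewrite /phw; elim: (v) vk => [|l v' IHv] vk; first by rewrite big_nil.
  rewrite big_cons IHv; last by move=> l' v'l'; apply: vk; rewrite inE v'l' orbT.
  rewrite /= exprS /ph -(vk l (mem_head _ _)) /chg /=.
  by case: (_ (+) _); rewrite expr1.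
by case: (k); rewrite ?exprVn ?invr_eq1 -(prim_order_dvd zp).
Qed.

(** The letters of charge [b] are exactly the two that occur in [Lp b]; this is the sorted word with
    i and j of them. *)
Definition canon (b : bool) i j := nseq i (true, ~~ b) ++ nseq j (false, b).

Lemma chg_canon b i j : {in canon b i j, forall l, chg l = b}.
Proof.
move=> l; rewrite mem_cat !mem_nseq => /orP[]/andP[_ /eqP->]; rewrite /chg //=.
exact: negbK.
Qed.

Lemma size_canon b i j : size (canon b i j) = (i + j)%N.
Proof. by rewrite size_cat !size_nseq. Qed.

(** Expanding the power gives binomially many words with the same letters, equal modulo shorter
    words. The prefix [u] collects the factors already expanded, and Pascal's rule closes the
    induction. *)
Lemma sat_binom n b m i u v : (forall v, (size v < n)%N -> sat (wd v)) ->
  size (u ++ v) = (n - m)%N -> (m <= n)%N ->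
  sat (wd u * (Lp L b ^+ m)`_i * wd v - 'C(m, i)%:R *: wd (u ++ canon b i (m - i) ++ v)).
Proof.
move=> IH; elim: m i u => [|m IHm] i u szuv mn.
  rewrite expr0 coef1; case: i => [|i] /=; rewrite ?bin0 ?bin0n /=.
    by rewrite mulr1 scale1r -wd_cat subrr; exact: sat0.
  by rewrite mulr0 mul0r scale0r subr0; exact: sat0.
have szr l : size (rcons u l ++ v) = (n - m)%N.
  by rewrite cat_rcons size_cat /= addnS -size_cat szuv; lia.
have IH1 j l := IHm j (rcons u l) (szr l) (ltnW mn).
have wdr l : wd (rcons u l) = wd u * L l.1 l.2 by rewrite -cats1 wd_cat /wd big_seq1.
have coefS : (Lp L b ^+ m.+1)`_i = L false b * (Lp L b ^+ m)`_i +
    (if i is j.+1 then L true (~~ b) * (Lp L b ^+ m)`_j else 0).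
  rewrite exprS /Lp mulrDl coefD coefCM -mulrA coefCM; congr (_ + _).
  by rewrite -(commr_polyX (_ ^+ m)) coefMX; case: (i) => [|j] /=; rewrite ?mulr0.
have T0 : sat ('C(m, i)%:R *: wd (rcons u (false, b) ++ canon b i (m - i) ++ v)
             - 'C(m, i)%:R *: wd (u ++ canon b i (m.+1 - i) ++ v)).
  have [mi|im] := ltnP m i; first by rewrite bin_small // !scale0r subrr; exact: sat0.
  rewrite -scalerBr; apply: satZ; rewrite cat_rcons; apply: (sat_perm IH).
    by rewrite subSn //= /canon -!catA -cat1s perm_catCA.
  by move: szuv; rewrite !size_cat /= !size_cat !size_nseq; lia.
have S0 := sat_subT (IH1 i (false, b)) T0; rewrite wdr in S0.
rewrite coefS mulrDr mulrDl mulrA; case: i T0 S0 {coefS} => [|j] _ S0.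
  by rewrite mulr0 mul0r addr0; move: S0; rewrite !bin0.
have S1 := IH1 j (true, ~~ b); rewrite wdr cat_rcons in S1.
rewrite binS natrD scalerDl opprD addrACA; apply: satD => //.
by rewrite mulrA; move: S1; rewrite /canon /= subSS.
Qed.

Lemma perm_canon b u : {in u, forall l, chg l = b} ->
  perm_eq u (canon b (count (fun l => l.1) u) (size u - count (fun l => l.1) u)).
Proof.
move=> ub; set a := fun l => l.1.
have E1 : filter a u = nseq (count a u) (true, ~~ b).
  rewrite -size_filter; apply/all_pred1P/allP=> -[[] b'];
    by rewrite mem_filter //= => /ub <-; rewrite /chg /= ?negbK.
have E2 : filter (predC a) u = nseq (count (predC a) u) (false, b).
  rewrite -size_filter; apply/all_pred1P/allP=> -[[] b'];
    by rewrite mem_filter //= => /ub <-; rewrite /chg /= ?negbK.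
by rewrite perm_sym -[X in (X - _)%N](count_predC a) addKn /canon -E1 -E2 perm_filterC.
Qed.

Lemma canon_flip b i j : flip (s_ 0) (canon b i j) = canon (~~ b) i j.
Proof. by rewrite /flip /canon map_cat !map_nseq /= !addbT. Qed.

Lemma phw_s0 v : phw (s_ 0) v = 1.
Proof. by rewrite /phw big1 // => l _; rewrite /ph; case: ifP; rewrite expr0 ?invr1. Qed.

(* Letters may be permuted modulo shorter words; x y, X Y, and a pair of letters
   of opposite charges split off a central factor. A word with constant charge
   vanishes unless 6 divides its length, and then [ha] splits off. *)
Lemma sat_wd v : sat (wd v).
Proof.
have [n] := ubnP (size v); elim: n v => // n IHn v; rewrite ltnS => szn.
have [/IHn//|nsz] := ltnP (size v) n.
have szv : size v = n by apply/eqP; rewrite eqn_leq szn.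
have IH : forall v, (size v < n)%N -> sat (wd v) by exact: IHn.
case: v => [|l v0] in szv szn nsz *; first by rewrite /wd big_nil; exact: sat1.
set v := l :: v0 in szv szn nsz *; pose k := chg l.
have [|] := boolP (all (fun l' => chg l' == k) v); last first.
  case/allPn=> l' l'v kk; apply: (sat_mixed IH szv l'v (mem_head _ _)); exact: kk.
move/allP=> vk; have [d6|] := boolP (6 %| size v)%N; last first.
  by apply: (@sat_rot _ k) => l' /vk /eqP.
have v6 : (6 <= size v)%N by apply: dvdn_leq.
pose i := count (fun l' => l'.1) (take 6 v); pose v2 := drop 6 v.
have szt : size (take 6 v) = 6%N by rewrite size_takel.
have i6 : (i <= 6)%N by rewrite -szt; exact: count_size.
have vE : perm_eq v (canon k i (6 - i) ++ v2).
  rewrite -[X in perm_eq X _](cat_take_drop 6 v) perm_cat2r -{2}szt.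
  by apply: perm_canon => l' /mem_take /vk /eqP.
have szv2 : size ([::] ++ v2) = (n - 6)%N by rewrite size_drop szv.
have n6 : (6 <= n)%N by rewrite -szv.
have bin0 : 'C(6, i)%:R != 0 :> C by rewrite pnatr_eq0 -lt0n bin_gt0.
have Sa : sat (ha L i * wd v2).
  by apply: sat_centr; [exact: (ha_centr zp ax) | apply: IH; rewrite -[v2]/([::] ++ v2) szv2; lia].
have haE : ha L i = (Lp L k ^+ 6)`_i + (Lp L (~~ k) ^+ 6)`_i.
  by rewrite /ha /A6 coefD; case: (k); rewrite // addrC.
have wd0 h : wd [::] * h = h by rewrite /wd big_nil mul1r.
have S1 := @sat_binom n k 6 i [::] v2 IH szv2 n6.
have S2 := @sat_binom n (~~ k) 6 i [::] v2 IH szv2 n6.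
have {S1 S2} S12 := satD S1 S2; rewrite !wd0 addrACA -mulrDl -haE -opprD in S12.
have {S12 Sa} S12 := sat_sub (sat_subC S12) Sa.
rewrite -scalerDr in S12; have {S12} S12 := sat_unscale bin0 S12.
apply: (sat_perm0 IH szv vE).
(* At this point the sum of the words for the two charges is settled. If no letter is left over, s_0
   exchanges the two; otherwise the word of the other charge is followed by letters of charge [k]
   and falls under [sat_mixed]. *)
case: (eqVneq v2 [::]) S12 => [-> S12|v2nz S12].
  apply: (@sat_unscale 2%:R); first by rewrite pnatr_eq0.
  case: S12 => s sC; rewrite !cats0 -canon_flip mulrDr mulrDl => E.
  exists s => //; rewrite -E scaler_nat mulr2n mulrDr mulrDl; congr (_ + _).
  by rewrite (avg_flip (s_ 0)) phw_s0 scale1r.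
rewrite -[wd _](addrK (wd (canon (~~ k) i (6 - i) ++ v2))); apply: satB => //.
have szc : size (canon (~~ k) i (6 - i) ++ v2) = n.
  by rewrite size_cat size_canon size_drop szv; lia.
have [l2 l2v] : exists l2, l2 \in v2 by case: (v2) v2nz => // l2 ? _; exists l2; exact: mem_head.
have [l1 l1c] : exists l1, l1 \in canon (~~ k) i (6 - i).
  have : (0 < size (canon (~~ k) i (6 - i)))%N by rewrite size_canon; lia.
  by case: (canon _ _ _) => // l1 ? _; exists l1; exact: mem_head.
have c12 : chg l1 != chg l2.
  by rewrite (chg_canon l1c) (eqP (vk _ (mem_drop l2v))); case: (k).
by apply: (sat_mixed IH szc _ _ c12); rewrite mem_cat ?l1c ?l2v ?orbT.
Qed.

Lemma flipK w : involutive (flip w).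
Proof.
move=> v; rewrite /flip -map_comp -[RHS]map_id; apply: eq_map => -[a b] /=.
by rewrite addbK.
Qed.

(** The induction builds h by left multiplication, so the statement is strengthened by an arbitrary
    word on the left; a new letter joins the word and a new group element passes through it to the
    outer e. *)
Lemma satake h : exists2 s, centr s & e * h * e = s * e.
Proof.
suff : forall v, sat (wd v * h) by move/(_ [::]); rewrite /wd big_nil mul1r.
apply: (g2_ind ax (P := fun h => forall v, sat (wd v * h))) =>
  [v|a u u' Su Su' v|w u Su v|a b u Su v|b u Su v].
- by rewrite mulr1; exact: sat_wd.
- by rewrite mulrDr -scalerAr; apply: sat_lin.
- have := g_wd w (flip w v); rewrite flipK => E.
  apply: (sat_unscale (phw_neq0 w (flip w v))).
  by rewrite mulrA scalerAl -E -mulrA; apply: sat_gl.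
- have := Su (rcons v (a, b)); rewrite -cats1 wd_cat /wd big_seq1 -mulrA; exact.
- by rewrite mulrA -(g2_c ax) -mulrA; apply: sat_centr; [exact: (c_centr ax) |].
Qed.

End Satake.

(** * Representations on orbits *)

Section Chart.
Variables (C : numFieldType) (z : C) (zp : 6.-primitive_root z).

(* A vector of C^2 is a function on bool, false indexing the first coordinate. *)
Definition vact (w : dih6) (v : bool -> C) (b : bool) : C :=
  (if b then z ^- w.1 else z ^+ w.1) * v (b (+) w.2).

Definition alpha (i : 'Z_6) (v : bool -> C) : C := v false - z ^+ i * v true.

Lemma vactM v w p : vact (v * w)%g p =1 vact v (vact w p).
Proof.
case: v w => [k bk] [l bl] b; rewrite dih6_mulE /dih6_mul /vact /fst /snd (zetaD zp).
have -> : z ^+ (if bk then - l else l)%R = if bk then z ^- l else z ^+ l.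
  by case: (bk); rewrite ?(zetaN zp).
by case: bk; case: b; case: bl; rewrite /= ?invfM ?invrK mulrA.
Qed.

Lemma vact1 p : vact 1%g p =1 p.
Proof. by move=> b; rewrite /vact /= expr0 invr1 addbF; case: b; rewrite mul1r. Qed.

Lemma alpha_s (i k : 'Z_6) p : alpha i (vact (s_ k) p) = - z ^+ (i - k)%R * alpha (k *+ 2 - i) p.
Proof.
have zk := zetaX_neq0 zp k; have zi := zetaX_neq0 zp i.
rewrite /alpha mulr2n !(zetaD zp) !(zetaN zp) /vact /=.
by field; rewrite zk zi.
Qed.

Lemma alpha_rot (i k : 'Z_6) p : alpha i (vact (k, false) p) = z ^+ k * alpha (i - k *+ 2) p.
Proof.
have zk := zetaX_neq0 zp k.
rewrite /alpha mulr2n !(zetaD zp) !(zetaN zp) (zetaD zp) /vact /=.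
by field; rewrite zk.
Qed.

Lemma vact_s i p b : vact (s_ i) p b = p b - alpha i p * (if b then - z ^- i else 1).
Proof.
have zi := zetaX_neq0 zp i.
by rewrite /vact /alpha; case: b => /=; field; rewrite ?zi.
Qed.

Variables (K : comAlgType C) (cv : bool -> C) (P0 : bool -> C) (mom0 : bool -> K).
Hypothesis regP : P0 false ^+ 6 != P0 true ^+ 6.

Definition mom (u : bool -> C) : K := u false *: mom0 false + u true *: mom0 true.
Definition pr (U v : bool -> C) : C := U false * v false + U true * v true.

(** The product of all alpha_i is X^6 - Y^6, so [regP] says that [P0] lies on no mirror; the group
    preserves this. *)
Lemma alpha_neq0 i w : alpha i (vact w P0) != 0.
Proof.
have z6 k : (z ^+ k) ^+ 6 = 1 by rewrite -exprM mulnC exprM (prim_expr_order zp) expr1n.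
have z6' k : (z ^- k) ^+ 6 = 1 by rewrite exprVn z6 invr1.
apply/eqP=> /eqP; rewrite subr_eq0 /vact => /eqP /(congr1 (fun t => t ^+ 6)).
rewrite !exprMn !z6 !z6' !mul1r => /eqP; case: (w.2); apply/negP => //.
by rewrite eq_sym.
Qed.

Local Notation M := {ffun dih6 -> K}.
Implicit Types (phi : M) (u v U : bool -> C) (a : C).

Definition coef (i : 'Z_6) u (w : dih6) : C := cv (odd i) * alpha i u / alpha i (vact w P0).

(** The Dunkl operator at t = 0 on the orbit of [P0]: the derivative is replaced by multiplication
    by the momentum, carried along the orbit, and s_i brings in the value at [s_i * w] with weight
    c_i alpha_i(u) / alpha_i(w P0). *)
Definition op_vec u phi : M := [ffun w =>
  mom (vact w^-1%g u) * phi w + \sum_(i : 'Z_6) coef i u w *: phi (s_ i * w)%g].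
Definition op_cov U phi : M := [ffun w => pr U (vact w P0) *: phi w].
Definition op_grp (w' : dih6) phi : M := [ffun w => phi (w'^-1 * w)%g].
Definition op_par (b : bool) phi : M := [ffun w => cv b *: phi w].

Lemma alpha_lin a i u v : alpha i (fun b => a * u b + v b) = a * alpha i u + alpha i v.
Proof. by rewrite /alpha; ring. Qed.

Lemma vact_lin a w u v : vact w (fun b => a * u b + v b) =1
  (fun b => a * vact w u b + vact w v b).
Proof. by move=> b; rewrite /vact; ring. Qed.

Lemma op_vec_linu a u v phi :
  op_vec (fun b => a * u b + v b) phi = a *: op_vec u phi + op_vec v phi.
Proof.
apply/ffunP=> w; rewrite !ffunE scalerDr addrACA; congr (_ + _).
  rewrite /mom !vact_lin !scalerDl -!scalerA addrACA -scalerDr mulrDl.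
  by rewrite scalerAl.
rewrite scaler_sumr -big_split; apply: eq_bigr => i _ /=.
rewrite scalerA -scalerDl; congr (_ *: _).
by rewrite /coef alpha_lin mulrDr mulrDl mulrCA !mulrA.
Qed.

Lemma op_vec_lin u : linear (op_vec u).
Proof.
move=> a phi psi; apply/ffunP=> w; rewrite !ffunE scalerDr addrACA; congr (_ + _).
  by rewrite mulrDr scalerAr.
rewrite scaler_sumr -big_split; apply: eq_bigr => i _ /=.
by rewrite !ffunE scalerDr !scalerA mulrC.
Qed.

Lemma op_cov_lin U : linear (op_cov U).
Proof.
by move=> a phi psi; apply/ffunP=> w; rewrite !ffunE scalerDr !scalerA mulrC.
Qed.

Lemma op_grp_lin w : linear (op_grp w).
Proof. by move=> a phi psi; apply/ffunP=> v; rewrite !ffunE. Qed.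

Lemma op_par_lin b : linear (op_par b).
Proof. by move=> a phi psi; apply/ffunP=> v; rewrite !ffunE scalerDr !scalerA mulrC. Qed.

Definition wconj (w : dih6) (i : 'Z_6) : 'Z_6 := if w.2 then w.1 *+ 2 - i else i - w.1 *+ 2.

Lemma wconjE w i : (w^-1 * s_ i = s_ (wconj w i) * w^-1 :> dih6)%g.
Proof.
case: w => k []; rewrite !dih6_mulE /dih6_mul /wconj /=; congr (_, _).
  by rewrite mulr2n addrAC addrK.
by rewrite opprK mulr2n opprD addrA subrK addrC.
Qed.

Lemma wconj_bij w : injective (wconj w).
Proof. by case: w => k [] i j; rewrite /wconj /=; [move/addrI/oppr_inj | move/addIr]. Qed.

Lemma odd_Z6D (i j : 'Z_6) : odd (i + j)%R = odd i (+) odd j.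
Proof. by rewrite /= odd_mod // oddD. Qed.

Lemma odd_Z6N (i : 'Z_6) : odd (- i)%R = odd i.
Proof. by have := odd_Z6D (- i) i; rewrite addNr; case: (odd (- i)%R); case: (odd i). Qed.

Lemma odd_Z6_2 (i : 'Z_6) : odd (i *+ 2)%R = false.
Proof. by rewrite mulr2n odd_Z6D addbb. Qed.

Lemma odd_wconj w i : odd (wconj w i) = odd i.
Proof. by rewrite /wconj; case: ifP => _; rewrite odd_Z6D odd_Z6N odd_Z6_2 ?addbF. Qed.

Lemma alpha_wconj w i : exists2 k, k != 0 &
  forall p, alpha i (vact w p) = k * alpha (wconj w i) p.
Proof.
case: w => k []; rewrite /wconj /=.
  by exists (- z ^+ (i - k)%R) => [|q]; rewrite ?oppr_eq0 ?zetaX_neq0 // -alpha_s.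
by exists (z ^+ k) => [|q]; rewrite ?zetaX_neq0 // alpha_rot.
Qed.

Lemma op_grp_vec w u phi : op_grp w (op_vec u phi) = op_vec (vact w u) (op_grp w phi).
Proof.
apply/ffunP=> g; rewrite !ffunE; congr (_ + _).
  congr (_ * _); rewrite /mom; congr (_ *: _ + _ *: _);
    by rewrite -vactM invMg invgK.
rewrite (reindex_inj (@wconj_bij w)) /=; apply: eq_bigr => i _; rewrite !ffunE.
rewrite !mulgA -wconjE; congr (_ *: _); rewrite /coef odd_wconj.
have [k k0 kE] := alpha_wconj w i.
rewrite kE.
have -> : alpha i (vact g P0) = k * alpha (wconj w i) (vact (w^-1 * g)%g P0).
  by rewrite -kE /alpha -!vactM mulKVg.
by rewrite mulrCA -mulf_div divff // mul1r.
Qed.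

Definition uact (w : dih6) U b := pr U (vact w^-1%g (fun d => (d == b)%:R)).

Lemma pr_uact w U v : pr (uact w U) v = pr U (vact w^-1%g v).
Proof. by rewrite /uact /pr /vact; case: (w^-1)%g => k [] /=; ring. Qed.

Lemma op_grp_cov w U phi : op_grp w (op_cov U phi) = op_cov (uact w U) (op_grp w phi).
Proof.
apply/ffunP=> g; rewrite !ffunE; congr (_ *: _); rewrite pr_uact /pr.
by rewrite !vactM.
Qed.

(** The coroot alpha_i^vee divided by zeta^i, so that s_i v = v - alpha_i(v) gam_i. *)
Definition gam (i : 'Z_6) (b : bool) : C := if b then - z ^- i else 1.

Lemma mom_s i u g : mom (vact (s_ i * g)^-1%g u) =
  mom (vact g^-1%g u) - alpha i u *: mom (vact g^-1%g (gam i)).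
Proof.
have E b : vact (s_ i * g)^-1%g u b =
    vact g^-1%g u b - alpha i u * vact g^-1%g (gam i) b.
  have -> : ((s_ i * g)^-1 = g^-1 * s_ i)%g by rewrite invMg.
  rewrite vactM {1}/vact vact_s -/(gam i _) /vact; ring.
rewrite /mom !E; move: (alpha i u) => al.
by rewrite !scalerBl scalerDr !scalerA opprD addrACA.
Qed.

Lemma s_s (i k : 'Z_6) : (s_ (i + k) * s_ i = (k, false) :> dih6)%g.
Proof. by rewrite dih6_mulE /dih6_mul /=; congr (_, _); rewrite addrAC subrr add0r. Qed.

(** Replacing i by i + k exchanges the factors of the weight c_i c_(i+k), because c depends only on
    parity; the two sums are therefore equal. *)
Lemma alpha_inv_sum (k : 'Z_6) (f : 'Z_6 -> C) :
  \sum_(i : 'Z_6) cv (odd i) * cv (odd (i + k)%R) * (f (i - k) - f i) = 0.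
Proof.
under eq_bigr do rewrite mulrBr.
rewrite sumrB [X in X - _](reindex_inj (addIr k)) /=; apply/eqP; rewrite subr_eq0; apply/eqP.
apply: eq_bigr => i _; rewrite addrK.
have -> : odd (i + k + k)%R = odd i by rewrite -addrA -mulr2n odd_Z6D odd_Z6_2 addbF.
by congr (_ * _); exact: mulrC.
Qed.

(** This is the rotation part of the commutation of two Dunkl operators. The difference of the sides
    is a determinant in u and v times a sum [S]. Multiplied by either coordinate of the point w P0,
    [S] takes the form of [alpha_inv_sum], and the two coordinates are not both zero. *)
Lemma coef_swap (k : 'Z_6) u v w :
  \sum_(i : 'Z_6) coef i u w * coef (i + k) v (s_ i * w)%g =
  \sum_(i : 'Z_6) coef i v w * coef (i + k) u (s_ i * w)%g.
Proof.
apply/eqP; rewrite -subr_eq0 -sumrB.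
pose al i := alpha i (vact w P0); have al0 i : al i != 0 := alpha_neq0 i w.
have zk m := zetaX_neq0 zp m.
have alE i : alpha (i + k) (vact (s_ i * w)%g P0) = - z ^+ k * al (i - k).
  have -> : alpha (i + k) (vact (s_ i * w)%g P0) = alpha (i + k) (vact (s_ i) (vact w P0)).
    by rewrite /alpha -!vactM.
  rewrite alpha_s addrAC subrr add0r; congr (_ * alpha _ _).
  by rewrite mulr2n opprD addrA addrK.
pose S := \sum_(i : 'Z_6) cv (odd i) * cv (odd (i + k)%R) * (z ^+ i * (1 - z ^+ k) / (z ^+ k * al (i - k) * al i)).
have -> : \sum_(i : 'Z_6) (coef i u w * coef (i + k) v (s_ i * w)%g -
    coef i v w * coef (i + k) u (s_ i * w)%g) = - (u false * v true - u true * v false) * S.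
  rewrite /S mulr_sumr; apply: eq_bigr => i _.
  rewrite /coef alE /alpha (zetaD zp) -/(alpha i (vact w P0)) -/(al i).
  by field; rewrite ?al0 ?zk.
have key b : vact w P0 b * S = 0.
  rewrite /S mulr_sumr -[RHS](@alpha_inv_sum k (fun i => (if b then 1 else z ^+ i) / al i)).
  apply: eq_bigr => i _; rewrite mulrCA; congr (_ * _).
  have zik : z ^+ i = z ^+ (i - k)%R * z ^+ k by rewrite -(zetaD zp) subrK.
  have := al0 (i - k); have := al0 i; rewrite /al /alpha zik.
  move: (zk k) (zk (i - k)) => t0 s0 a0 b0.
  by case: b; field; rewrite ?a0 ?b0 ?t0 ?s0.
suff -> : S = 0 by rewrite mulr0.
have /eqP := key false; rewrite mulf_eq0 => /orP[/eqP v0|/eqP//].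
have /eqP := key true; rewrite mulf_eq0 => /orP[/eqP v1|/eqP//].
by have := al0 0; rewrite /al /alpha v1 v0 mulr0 subrr eqxx.
Qed.

(** A product of two Dunkl operators splits into a multiplication, reflection terms and rotation
    terms. The first two are symmetric in u and v by inspection, the third by [coef_swap]. *)
Lemma op_vecC u v phi : op_vec u (op_vec v phi) = op_vec v (op_vec u phi).
Proof.
have E u' v' g : op_vec u' (op_vec v' phi) g =
  mom (vact g^-1%g u') * mom (vact g^-1%g v') * phi g +
  \sum_(i : 'Z_6) (cv (odd i) / alpha i (vact g P0)) *:
     ((alpha i v' *: mom (vact g^-1%g u') + alpha i u' *: mom (vact g^-1%g v')
       - (alpha i u' * alpha i v') *: mom (vact g^-1%g (gam i))) * phi (s_ i * g)%g) +
  \sum_(k : 'Z_6) (\sum_(i : 'Z_6) coef i u' g * coef (i + k) v' (s_ i * g)%g) *: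
     phi (((k, false) : dih6) * g)%g.
  rewrite !ffunE mulrDr mulrA -!addrA; congr (_ + _).
  have -> : \sum_(k : 'Z_6) (\sum_(i : 'Z_6) coef i u' g * coef (i + k) v' (s_ i * g)%g) *:
     phi (((k, false) : dih6) * g)%g =
     \sum_(i : 'Z_6) coef i u' g *: \sum_(j : 'Z_6) coef j v' (s_ i * g)%g *: phi (s_ j * (s_ i * g))%g.
    under eq_bigr do rewrite scaler_suml.
    rewrite exchange_big; apply: eq_bigr => i _; rewrite scaler_sumr.
    rewrite [RHS](reindex_inj (addrI i)) /=; apply: eq_bigr => k _.
    by rewrite mulgA s_s scalerA.
  rewrite mulr_sumr -!big_split; apply: eq_bigr => i _ /=.
  rewrite !ffunE mom_s scalerDr addrA; congr (_ + _); rewrite /coef.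
  have cE p : cv (odd i) * alpha i p / alpha i (vact g P0) =
    cv (odd i) / alpha i (vact g P0) * alpha i p by rewrite mulrAC.
  rewrite !cE; move: (_ / _) (alpha i u') (alpha i v') => rho a b.
  have [f fE] : exists f : C -> K, forall k y, k *: y = f k * y.
    by exists (fun k => k%:A) => k y; rewrite mulr_algl.
  by rewrite -!scalerA !fE; ring.
apply/ffunP=> g; rewrite !E; congr (_ + _ + _).
- by rewrite [X in X * phi g]mulrC.
- apply: eq_bigr => i _; congr (_ *: (_ * _)).
  by rewrite [X in X - _]addrC [alpha i u * _]mulrC.
- by apply: eq_bigr => k _; rewrite coef_swap.
Qed.

Lemma op_vec_cov u U phi : op_vec u (op_cov U phi) = op_cov U (op_vec u phi) +
  \sum_(i : 'Z_6) - (alpha i u * pr U (gam i)) *: op_par (odd i) (op_grp (s_ i) phi).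
Proof.
apply/ffunP=> g; rewrite !ffunE sum_ffunE scalerDr scalerAr -addrA; congr (_ + _).
rewrite scaler_sumr -big_split; apply: eq_bigr => i _ /=; rewrite !ffunE.
have sV : ((s_ i : dih6)^-1 = s_ i)%g by [].
have -> : pr U (vact (s_ i * g)%g P0) =
    pr U (vact g P0) - alpha i (vact g P0) * pr U (gam i).
  by rewrite /pr !vactM !vact_s -/(gam i true) -/(gam i false); ring.
rewrite sV !scalerA -scalerDl; congr (_ *: _).
by rewrite /coef; move: (alpha_neq0 i g); move: (alpha i (vact g P0)) => al al0; field.
Qed.

Definition b2i (b : bool) : 'I_2 := if b then 1 else 0.

Local Notation W := (G2 zp).

Definition chart_gen (x : cher_gen W) : M -> M :=
  match x with
  | Par s => op_par (odd (val s : dih6).1)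
  | Vec u => op_vec (fun b => u (b2i b) 0)
  | Cov U => op_cov (fun b => U 0 (b2i b))
  | Grp w => op_grp w
  end.

Lemma dih6_mx_vact (w : dih6) (u : 'cV[C]_2) b :
  (dih6_mx z w *m u) (b2i b) 0 = vact w (fun d => u (b2i d) 0) b.
Proof.
have e1 : lift ord0 ord0 = 1 :> 'I_2 by apply: val_inj.
by case: w => k []; case: b; rewrite !mxE !big_ord_recl big_ord0 /vact /= !mxE /= e1
   ?mul0r ?addr0 ?add0r.
Qed.

Lemma dih6_mx_uact (w : dih6) (U : 'rV[C]_2) b :
  (U *m dih6_mx z w^-1%g) 0 (b2i b) = uact w (fun d => U 0 (b2i d)) b.
Proof.
have e1 : lift ord0 ord0 = 1 :> 'I_2 by apply: val_inj.
rewrite /uact; case: (w^-1)%g => k []; case: b; rewrite !mxE !big_ord_recl big_ord0 /pr /vact /= !mxE /= e1;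
  by rewrite ?mulr1n ?mulr0n ?mulr0 ?mulr1 ?addr0 ?add0r.
Qed.

Lemma chart_gen_lin x : linear (chart_gen x).
Proof.
by case: x => [s|u|U|w]; [exact: op_par_lin | exact: op_vec_lin | exact: op_cov_lin | exact: op_grp_lin].
Qed.

Lemma op_parE b phi : op_par b phi = cv b *: phi.
Proof. by apply/ffunP=> g; rewrite !ffunE. Qed.

Lemma odd_conj (s w : dih6) : odd (s ^ w)%g.1 = odd s.1.
Proof.
case: s w => i b [k d]; rewrite conjgE !dih6_mulE /dih6_mul /fst /snd !odd_Z6D.
have oN e (j : 'Z_6) : odd (if e then - j else j)%R = odd j.
  by case: e; rewrite ?odd_Z6N.
rewrite oN odd_Z6D oN /=.
have -> : odd (if d then k else - k)%R = odd k by case: (d); rewrite ?odd_Z6N.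
by case: (odd k); case: (odd i).
Qed.

Lemma comm_coef_alpha (u : 'cV[C]_2) (U : 'rV[C]_2) (i : 'Z_6) :
  Defs.comm_coef (W := W) u U (s_ i) =
  - (alpha i (fun b => u (b2i b) 0) * pr (fun b => U 0 (b2i b)) (gam i)).
Proof.
have zi := zetaX_neq0 zp i; have e1 : lift ord0 ord0 = 1 :> 'I_2 by apply: val_inj.
have z2 : 2%:R != 0 :> C by rewrite pnatr_eq0.
rewrite /Defs.comm_coef /pairing /=.
have -> : \det (dih6_mx z (s_ i)) = -1.
  rewrite (expand_det_row _ 0) !big_ord_recl big_ord0 /dih6_mx /= !mxE /= mul0r add0r addr0.
  by rewrite /cofactor det_mx11 !mxE /= expr1 mulN1r mulrN mulfV.
rewrite !mxE !big_ord_recl !big_ord0 !mxE /= e1 /alpha /pr /gam /=.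
move: (z ^+ i) zi => t t0; rewrite (_ : 1 * t + (- t * -1 + 0) = 2 * t); last by ring.
by field; rewrite t0.
Qed.

Lemma chart_gen_rel t t' : cher_rel (W := W) t t' ->
  expr_op chart_gen t =1 expr_op chart_gen t'.
Proof.
case=> [a x y|a x y||w w'|w x|w x|s s' w sw|s x|x y|x y|x y] phi.
- apply: (etrans _ (op_vec_linu a (fun b => x (b2i b) 0) (fun b => y (b2i b) 0) phi)).
  by rewrite [LHS]/=; congr (op_vec _ phi); apply/funext=> b; rewrite !mxE.
- rewrite [LHS]/= [RHS]/=; apply/ffunP=> g; rewrite !ffunE scalerA -scalerDl.
  by congr (_ *: _); rewrite /pr !mxE; ring.
- by apply/ffunP=> g; rewrite [RHS]/= scale1r ffunE invg1 mul1g.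
- by apply/ffunP=> g; rewrite !ffunE invMg mulgA.
- rewrite [LHS]/= [RHS]/= op_grp_vec; congr (op_vec _ _); apply/funext=> b.
  by rewrite -dih6_mx_vact.
- rewrite [LHS]/= [RHS]/= op_grp_cov; congr (op_cov _ _); apply/funext=> b.
  by rewrite -dih6_mx_uact.
- by rewrite [LHS]/= [RHS]/= sw odd_conj.
- rewrite [LHS]/= [RHS]/= !op_parE.
  have := chart_gen_lin x (cv (odd (val s : dih6).1)) phi 0.
  have := chart_gen_lin x 1 0 0.
  by rewrite scaler0 scale1r addr0 => /esym/eqP; rewrite -subr_eq0 addrK => /eqP->; rewrite !addr0.
- exact: op_vecC.
- by apply/ffunP=> g; rewrite /= !ffunE !scalerA mulrC.
- rewrite [LHS]/= op_vec_cov [RHS]/=; congr (_ + _).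
  rewrite (big_morph (fun t => expr_op chart_gen t phi) (id1 := 0) (op1 := +%R)) //=; last first.
    by rewrite scale0r.
  rewrite [RHS](reindex _ (onW_bij _ (refl_s_bij zp))) /=; apply: eq_bigr => i _.
  by rewrite comm_coef_alpha.
Qed.

End Chart.

Definition dl (C : nzRingType) (b d : bool) : C := (d == b)%:R.

(* X and Y act on functions on the free orbit of [P0] by multiplication by the
   coordinates, x and y by momenta corrected by reflection terms. *)
Record is_chart (C : numFieldType) (z : C) (H : algType C)
    (g : dih6 -> H) (L : bool -> bool -> H) (c : bool -> H)
    (K : comAlgType C) (cv P0 : bool -> C) (mom0 : bool -> K)
    (op : H -> {ffun dih6 -> K} -> {ffun dih6 -> K}) : Prop := IsChart {
  ch_lin : forall a h h' phi, op (a *: h + h') phi = a *: op h phi + op h' phi;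
  ch_1 : forall phi, op 1 phi = phi;
  ch_M : forall h h' phi, op (h * h') phi = op h (op h' phi);
  ch_add : forall h (phi psi : {ffun dih6 -> K}), op h (phi + psi) = op h phi + op h psi;
  ch_K : forall h (k : K) (phi : {ffun dih6 -> K}), op h [ffun w => k * phi w] = [ffun w => k * op h phi w];
  ch_g : forall w phi, op (g w) phi = op_grp w phi;
  ch_V : forall b phi, op (L false b) phi = op_vec z cv P0 mom0 (dl C b) phi;
  ch_U : forall b phi, op (L true b) phi = op_cov z P0 (dl C b) phi;
  ch_c : forall b phi, op (c b) phi = op_par cv b phi }.

Section ChartExists.
Variables (C : numFieldType) (z : C) (zp : 6.-primitive_root z).
Variables (K : comAlgType C) (cv P0 : bool -> C) (mom0 : bool -> K).
Hypothesis regP : P0 false ^+ 6 != P0 true ^+ 6.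

Lemma chart_exists : exists op,
  is_chart z (fun w => hgrp (W := G2 zp) w) (cher_L zp) (cher_c zp) cv P0 mom0 op.
Proof.
pose gen := @chart_gen C z zp K cv P0 mom0.
have gl x : linear (gen x) := chart_gen_lin cv P0 mom0 x.
have gr := chart_gen_rel (zp := zp) cv mom0 regP.
exists (fun h => pres_op gen (h : cher (G2 zp))); split.
- by move=> a h h' phi; rewrite (pres_opD gl gr) (pres_opZ gl gr).
- by move=> phi; exact: (pres_op1 gl gr).
- by move=> h h' phi; exact: (pres_opM gl gr).
- by move=> h phi psi; have := pres_op_lin gl h 1 phi psi; rewrite !scale1r.
- move=> h k phi.
  apply: (pres_op_comm (D := fun phi : {ffun dih6 -> K} => [ffun w => k * phi w])).
    move=> a p q; apply/ffunP=> w; rewrite !ffunE mulrDr scalerAr //.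
  case=> [s|u|U|w] p; apply/ffunP=> v; rewrite /gen /= !ffunE.
  + by rewrite scalerAr.
  + rewrite mulrDr mulrCA; congr (_ + _); rewrite mulr_sumr; apply: eq_bigr => i _.
    by rewrite ffunE scalerAr.
  + by rewrite scalerAr.
  + by [].
- by move=> w phi; rewrite (pres_op_gen gl gr).
- move=> b phi.
  have -> : cher_L zp false b =
      pgen (cher_rel (W := G2 zp)) (Vec (W := G2 zp) (delta_mx (b2i b) 0)) by case: b.
  rewrite (pres_op_gen gl gr) /gen /=; congr (op_vec _ _ _ _ _ _); apply/funext=> d.
  by rewrite mxE /dl; case: b; case: d.
- move=> b phi.
  have -> : cher_L zp true b =
      pgen (cher_rel (W := G2 zp)) (Cov (W := G2 zp) (delta_mx 0 (b2i b))) by case: b.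
  rewrite (pres_op_gen gl gr) /gen /=; congr (op_cov _ _ _ _); apply/funext=> d.
  by rewrite mxE /dl; case: b; case: d.
- by move=> b phi; rewrite (pres_op_gen gl gr) /gen /=; case: b.
Qed.

End ChartExists.

(** * Ordered monomials: spanning, action on orbits, linear independence *)

Lemma big_msupp (R : nzRingType) n (V : lmodType R) (f : 'X_{1..n} -> V) (p : {mpoly R[n]}) k :
  (msize p <= k)%N ->
  \sum_(m <- msupp p) p@_m *: f m = \sum_(m : 'X_{1..n < k}) p@_m *: f m.
Proof.
move=> lt_pk; rewrite (ssrcomplements.big_mksub ('X_{1..n < k} : subFinType _)) ?msupp_uniq //=; last first.
  by move=> x /msize_mdeg_lt /leq_trans; apply.
by rewrite big_rmcond //= => i; move/memN_msupp_eq0 ->; rewrite scale0r.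
Qed.

Section PBW.
Variables (C : numFieldType) (z : C) (zp : 6.-primitive_root z) (H : algType C).
Variables (g : dih6 -> H) (L : bool -> bool -> H) (c : bool -> H).
Hypothesis ax : is_g2 z g L c.

Definition mono i j a b w d f : H :=
  c false ^+ i * c true ^+ j * L true false ^+ a * L true true ^+ b
  * g w * L false false ^+ d * L false true ^+ f.

Definition mon (m : 'X_{1..6}) w : H :=
  mono (m (inord 0)) (m (inord 1)) (m (inord 2)) (m (inord 3)) w (m (inord 4)) (m (inord 5)).

Definition pbwv (F : dih6 -> {mpoly C[6]}) : H :=
  \sum_(w : dih6) \sum_(m <- msupp (F w)) (F w)@_m *: mon m w.

Lemma pbwv_lin a F G : pbwv (fun w => a *: F w + G w) = a *: pbwv F + pbwv G.
Proof.
rewrite /pbwv scaler_sumr -big_split; apply: eq_bigr => w _ /=.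
pose k := maxn (msize (a *: F w + G w)) (maxn (msize (F w)) (msize (G w))).
rewrite !(big_msupp (fun m => mon m w) (k := k)) ?leq_max ?leqnn ?orbT //.
rewrite scaler_sumr -big_split; apply: eq_bigr => m _ /=.
by rewrite mcoeffD mcoeffZ scalerDl scalerA.
Qed.

Definition pspan h := exists F, pbwv F = h.

Lemma pspan_lin a u v : pspan u -> pspan v -> pspan (a *: u + v).
Proof.
by move=> [F <-] [G <-]; exists (fun w => a *: F w + G w); rewrite pbwv_lin.
Qed.

Lemma pspan0 : pspan 0.
Proof.
by exists (fun=> 0); rewrite /pbwv big1 // => w _; rewrite msupp0 big_nil.
Qed.

Lemma pspanZ a u : pspan u -> pspan (a *: u).
Proof. by move=> Su; rewrite -[_ *: _]addr0; apply: pspan_lin Su pspan0. Qed.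

Lemma pspanD u v : pspan u -> pspan v -> pspan (u + v).
Proof. by move=> Su Sv; rewrite -[u]scale1r; apply: pspan_lin. Qed.

Lemma pspan_mono i j a b w d f : pspan (mono i j a b w d f).
Proof.
pose m : 'X_{1..6} := [multinom nth 0%N [:: i; j; a; b; d; f] k | k < 6].
exists (fun v => if v == w then 'X_[m] else 0); rewrite /pbwv (bigD1 w) //= eqxx msuppX.
rewrite big_seq1 mcoeffX eqxx scale1r big1 ?addr0 => [|v /negPf->].
  by rewrite /mon !mnmE !inordK.
by rewrite msupp0 big_nil.
Qed.

Lemma pspan_ind (Q : H -> Prop) : (forall a u v, Q u -> Q v -> Q (a *: u + v)) -> Q 0 ->
  (forall i j a b w d f, Q (mono i j a b w d f)) -> forall h, pspan h -> Q h.
Proof.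
move=> Qlin Q0 Qm _ [F <-]; rewrite /pbwv.
elim/big_ind: _ => // [u v Qu Qv|w _]; first by rewrite -[u]scale1r; apply: (Qlin).
elim/big_rec: _ => // m h _ Qh; apply: (Qlin) => //; exact: Qm.
Qed.

Lemma pspan_lmul y : (forall i j a b w d f, pspan (y * mono i j a b w d f)) ->
  forall h, pspan h -> pspan (y * h).
Proof.
move=> ym; apply: pspan_ind => // [a u v Su Sv|]; last by rewrite mulr0; exact: pspan0.
by rewrite mulrDr -scalerAr; apply: pspan_lin.
Qed.

Lemma cX_comm b n h : c b ^+ n * h = h * c b ^+ n.
Proof. by apply/esym/commrX/esym/(g2_c ax). Qed.

Lemma pspan_c b h : pspan h -> pspan (c b * h).
Proof.
apply: pspan_lmul => i j a b' w d f; case: b.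
  have -> : c true * mono i j a b' w d f = mono i j.+1 a b' w d f.
    by rewrite /mono exprS !mulrA (g2_c ax).
  exact: pspan_mono.
have -> : c false * mono i j a b' w d f = mono i.+1 j a b' w d f.
  by rewrite /mono exprS !mulrA.
exact: pspan_mono.
Qed.

Lemma pspan_cX b n h : pspan h -> pspan (c b ^+ n * h).
Proof.
move=> Sh; elim: n => [|n IHn]; first by rewrite mul1r.
by rewrite exprS -mulrA; apply: pspan_c.
Qed.

Definition nmono a b w d f := L true false ^+ a * L true true ^+ b * g w
  * L false false ^+ d * L false true ^+ f.

Lemma monoE i j a b w d f : mono i j a b w d f = c false ^+ i * (c true ^+ j * nmono a b w d f).
Proof. by rewrite /mono /nmono !mulrA. Qed.

Lemma nmonoE a b w d f : nmono a b w d f = mono 0 0 a b w d f.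
Proof. by rewrite /mono /nmono !mul1r. Qed.

Lemma pspan_nmono a b w d f : pspan (nmono a b w d f).
Proof. by rewrite nmonoE; exact: pspan_mono. Qed.

Lemma pspan_lmul_n y : (forall b h, y * (c b * h) = c b * (y * h)) ->
  (forall a b w d f, pspan (y * nmono a b w d f)) -> forall h, pspan h -> pspan (y * h).
Proof.
move=> yc yn; apply: pspan_lmul => i j a b w d f; rewrite monoE.
have ycX b' n h : y * (c b' ^+ n * h) = c b' ^+ n * (y * h).
  by rewrite !mulrA -cX_comm.
by rewrite !ycX; do 2!apply: pspan_cX.
Qed.

Lemma c_mid y b h : y * (c b * h) = c b * (y * h).
Proof. by rewrite mulrA -(g2_c ax) mulrA. Qed.

Lemma pspan_U b h : pspan h -> pspan (L true b * h).
Proof.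
apply: pspan_lmul_n => [b' h'|a b' w d f]; first exact: c_mid.
case: b.
  have -> : L true true * nmono a b' w d f = nmono a b'.+1 w d f; last exact: pspan_nmono.
  rewrite /nmono exprS !mulrA; congr (_ * _ * _ * _ * _).
  by apply/commrX; exact: (g2_LC ax).
have -> : L true false * nmono a b' w d f = nmono a.+1 b' w d f; last exact: pspan_nmono.
by rewrite /nmono exprS !mulrA.
Qed.

Lemma g_X w a b n : g w * L a b ^+ n = ph z w a b ^+ n *: (L a (b (+) w.2) ^+ n * g w).
Proof.
elim: n => [|n IHn]; first by rewrite !expr0 mul1r mulr1 scale1r.
rewrite exprSr mulrA IHn -scalerAl -mulrA (g2_gL ax) -scalerAr scalerA mulrA.
by rewrite -exprSr -exprSr.
Qed.

Lemma pspan_g w h : pspan h -> pspan (g w * h).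
Proof.
apply: pspan_lmul_n => [b' h'|a b v d f]; first exact: c_mid.
have -> : g w * nmono a b v d f = (ph z w true false ^+ a * ph z w true true ^+ b) *:
   (L true w.2 ^+ a * L true (~~ w.2) ^+ b * g (w * v)%g * L false false ^+ d * L false true ^+ f).
  rewrite /nmono !mulrA g_X -!scalerAl -scalerA; congr (_ *: _).
  rewrite -[_ * g w * _]mulrA g_X -scalerAr -!scalerAl; congr (_ *: _).
  by rewrite !mulrA (g2_M ax) !mulrA addTb addFb.
apply: pspanZ; case: (w.2); last exact: pspan_nmono.
rewrite (_ : L true true ^+ a * _ = L true false ^+ b * L true true ^+ a).
  exact: pspan_nmono.
by apply/commrX/commr_sym/commrX; exact: (g2_LC ax).
Qed.

(** The letter moves to the right, past X and Y at the cost of terms c s_i, which the previous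
    closure lemmas absorb, and past the group element up to a scalar. *)
Lemma pspan_V b h : pspan h -> pspan (L false b * h).
Proof.
apply: pspan_lmul_n => [b' h'|a b' w d f]; first exact: c_mid.
have TTs b1 h' : pspan h' -> pspan (TT z g c b b1 * h').
  move=> Sh; rewrite /TT mulr_suml; elim/big_ind: _ => [|u v|i _]; [exact: pspan0 | exact: pspanD |].
  by rewrite -scalerAl /cs -mulrA; apply/pspanZ/pspan_c/pspan_g.
have step b1 h' : pspan h' -> pspan (L false b * h') -> pspan (L false b * (L true b1 * h')).
  move=> Sh SLh; rewrite mulrA (L_comm ax) mulrDl -mulrA.
  by apply: pspanD; [apply: pspan_U | apply: TTs].
rewrite /nmono -!mulrA; elim: a => [|a IHa]; last first.
  rewrite exprS -!mulrA; apply: step => //.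
  by have := pspan_nmono a b' w d f; rewrite /nmono -!mulrA.
rewrite mul1r; elim: b' => [|b' IHb]; last first.
  rewrite exprS -!mulrA; apply: step => //.
  by have := pspan_nmono 0 b' w d f; rewrite /nmono -!mulrA mul1r.
rewrite mul1r mulrA; set u := L false b.
have -> : u * g w = ph z w^-1%g false b *: (g w * L false (b (+) w.2)).
  have -> : u = g w * (g w^-1%g * u) by rewrite mulrA -(g2_M ax) mulgV (g2_1 ax) mul1r.
  rewrite (g2_gL ax) -scalerAr -scalerAl; congr (_ *: _).
  by rewrite -!mulrA -(g2_M ax) mulVg (g2_1 ax) mulr1.
rewrite -scalerAl -mulrA; apply/pspanZ/pspan_g.
case: (b (+) w.2).
  have := pspan_nmono 0 0 1%g d f.+1; rewrite /nmono !mul1r (g2_1 ax) mul1r exprS.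
  rewrite !mulrA; congr (pspan (_ * _)).
  by apply/commr_sym/commrX; exact: (g2_LC ax).
have := pspan_nmono 0 0 1%g d.+1 f; rewrite /nmono !mul1r (g2_1 ax) mul1r exprS.
by rewrite -!mulrA.
Qed.

Lemma pspan_all h : pspan h.
Proof.
apply: (g2_ind ax) => [|a u v|w u|a b u|b u].
- have := pspan_nmono 0 0 1%g 0 0; rewrite /nmono !mul1r (g2_1 ax) !mulr1; exact.
- exact: pspan_lin.
- exact: pspan_g.
- by case: a; [exact: pspan_U | exact: pspan_V].
- exact: pspan_c.
Qed.

End PBW.

Section ChartAct.
Variables (C : numFieldType) (z : C) (zp : 6.-primitive_root z) (H : algType C).
Variables (g : dih6 -> H) (L : bool -> bool -> H) (c : bool -> H).
Hypothesis ax : is_g2 z g L c.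
Variables (K : comAlgType C) (cv P0 : bool -> C) (mom0 : bool -> K).
Hypothesis regP : P0 false ^+ 6 != P0 true ^+ 6.
Variable op : H -> {ffun dih6 -> K} -> {ffun dih6 -> K}.
Hypothesis ch : is_chart z g L c cv P0 mom0 op.
Local Notation M := {ffun dih6 -> K}.

Definition delta (w : dih6) : M := [ffun v => (v == w)%:R].

Lemma chZ h a phi : op h (a *: phi) = a *: op h phi.
Proof.
have -> : a *: phi = [ffun w => a%:A * phi w] by apply/ffunP=> w; rewrite !ffunE mulr_algl.
by rewrite (ch_K ch); apply/ffunP=> w; rewrite !ffunE mulr_algl.
Qed.

Lemma ch_phi0 h : op h 0 = 0.
Proof. by rewrite -[X in op h X](scale0r (0 : M)) chZ scale0r. Qed.

Lemma ch_0 phi : op 0 phi = 0.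
Proof.
have E : op 0 phi = op 0 phi + op 0 phi.
  by rewrite -{2}[op 0 phi]scale1r -(ch_lin ch) scaler0 addr0.
by apply: (addIr (op 0 phi)); rewrite add0r -E.
Qed.

Lemma ch_scale a h phi : op (a *: h) phi = a *: op h phi.
Proof. by have := ch_lin ch a h 0 phi; rewrite addr0 ch_0 addr0. Qed.

Lemma ch_hD h h' phi : op (h + h') phi = op h phi + op h' phi.
Proof. by have := ch_lin ch 1 h h' phi; rewrite !scale1r. Qed.

Lemma ch_sum I (r : seq I) (P : pred I) (F : I -> H) phi :
  op (\sum_(i <- r | P i) F i) phi = \sum_(i <- r | P i) op (F i) phi.
Proof. by elim/big_rec2: _ => [|i y1 y2 _ <-]; [exact: ch_0 | rewrite ch_hD]. Qed.

Lemma op_covE b (phi : M) : op_cov z P0 (dl C b) phi = [ffun w => vact z w P0 b *: phi w].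
Proof.
apply/ffunP=> w; rewrite !ffunE; congr (_ *: _); rewrite /pr /dl.
by case: b; rewrite /= ?mulr1n ?mulr0n ?mul1r ?mul0r ?addr0 ?add0r.
Qed.

Lemma grp_delta w v : op_grp w (delta v) = delta (w * v)%g.
Proof.
apply/ffunP=> u; rewrite !ffunE -(inj_eq (mulgI w)) mulgA mulgV mul1g //.
Qed.

Lemma P0_neq0 : P0 false != 0 \/ P0 true != 0.
Proof.
have [P0f|] := eqVneq (P0 false) 0; last by left.
have [P0t|] := eqVneq (P0 true) 0; last by right.
by case/eqP: regP; rewrite P0f P0t.
Qed.

Lemma vact_free w : (forall b, vact z w P0 b = P0 b) -> w = 1%g.
Proof.
have z6 k : (z ^+ k) ^+ 6 = 1 by rewrite -exprM mulnC exprM (prim_expr_order zp) expr1n.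
case: w => k [] E.
  case/eqP: regP; rewrite -[LHS](congr1 (fun t => t ^+ 6) (E false)) /vact /=.
  by rewrite exprMn z6 mul1r.
have [P0f|P0t] := P0_neq0.
  have /eqP := E false; rewrite /vact /= -{2}[P0 false]mul1r -subr_eq0 -mulrBl.
  by rewrite mulf_eq0 (negPf P0f) orbF subr_eq0 => /eqP /(zeta_eq1 zp) ->.
have /eqP := E true; rewrite /vact /= -{2}[P0 true]mul1r -subr_eq0 -mulrBl.
rewrite mulf_eq0 (negPf P0t) orbF subr_eq0 invr_eq1 => /eqP /(zeta_eq1 zp) -> //.
Qed.

Section Central.
Variable h : H.
Hypothesis hC : centr h.
Definition theta : K := op h (delta 1%g) 1%g.

(** Commutation with X and Y confines the image of a delta function to the points of the orbit with
    the same coordinates, and the orbit is free. *)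
Lemma ch_central_delta : op h (delta 1%g) = [ffun w => theta * delta 1%g w].
Proof.
apply/ffunP=> w; rewrite !ffunE.
have [->|w1] := eqVneq w 1%g; first by rewrite mulr1.
rewrite mulr0.
have key b : (vact z w P0 b - P0 b) *: op h (delta 1%g) w = 0.
  have E : op (L true b) (op h (delta 1%g)) w = op h (op (L true b) (delta 1%g)) w.
    by rewrite -!(ch_M ch) hC.
  move: E; rewrite !(ch_U ch) !op_covE ffunE.
  have -> : [ffun w0 => vact z w0 P0 b *: delta 1%g w0] = P0 b *: delta 1%g.
    apply/ffunP=> v; rewrite !ffunE; case: eqP => [->|_]; last by rewrite !scaler0.
    by rewrite (vact1 z).
  by rewrite chZ ffunE scalerBl => ->; rewrite subrr.
have [/forallP vP|] := boolP [forall b, vact z w P0 b == P0 b].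
  by case/eqP: w1; apply: vact_free => b; apply/eqP/vP.
case/forallPn=> b; rewrite -subr_eq0 => nz.
by have := congr1 (fun x => (vact z w P0 b - P0 b)^-1 *: x) (key b); rewrite scalerA mulVf // scale1r scaler0.
Qed.

(** The group carries the delta function at 1 to all others, so one scalar serves for the whole
    orbit. *)
Lemma ch_central phi : op h phi = [ffun w => theta * phi w].
Proof.
have E w : op h (delta w) = [ffun v => theta * delta w v].
  rewrite -[w]mulg1 -grp_delta -(ch_g ch) -(ch_M ch) hC (ch_M ch) ch_central_delta.
  by rewrite (ch_K ch).
have -> : phi = \sum_w [ffun v => phi w * delta w v].
  apply/ffunP=> v; rewrite sum_ffunE (bigD1 v) //= !ffunE eqxx mulr1.
  by rewrite big1 ?addr0 // => w /negPf wv; rewrite !ffunE eq_sym wv mulr0.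
elim/big_rec: _ => [|w psi _ IH].
  by rewrite ch_phi0; apply/ffunP=> v; rewrite !ffunE mulr0.
rewrite (ch_add ch) IH (ch_K ch) E; apply/ffunP=> v; rewrite !ffunE; ring.
Qed.
End Central.

Lemma theta1 : theta 1 = 1.
Proof. by rewrite /theta (ch_1 ch) ffunE eqxx. Qed.

Lemma thetaM h h' : centr h -> centr h' -> theta (h * h') = theta h * theta h'.
Proof. by move=> hC hC'; rewrite {1}/theta (ch_M ch) (ch_central hC) !ffunE. Qed.

Lemma theta_lin a h h' : theta (a *: h + h') = a *: theta h + theta h'.
Proof. by rewrite /theta (ch_lin ch) !ffunE. Qed.

(** The diagonal coefficient of e at the identity is 1/12, so h e = 0 forces the scalar of h to
    vanish. *)
Lemma theta_avg0 h : centr h -> h * avg g = 0 -> theta h = 0.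
Proof.
move=> hC he0; have := congr1 (fun h => op h (delta 1%g) 1%g) he0.
rewrite /= ch_0 (ch_M ch) (ch_central hC) !ffunE avgE ch_scale ffunE ch_sum sum_ffunE.
rewrite (bigD1 1%g) //= (ch_g ch) grp_delta ffunE mulg1 eqxx big1 => [|w w1]; last first.
  by rewrite (ch_g ch) grp_delta ffunE mulg1 eq_sym (negPf w1).
rewrite addr0 -scalerAr mulr1 => /(congr1 (fun x => (12%:R : C) *: x)).
by rewrite scalerA mulfV ?pnatr_eq0 // scale1r scaler0.
Qed.

End ChartAct.

Section Symbol.
Variables (C : numFieldType) (z : C) (zp : 6.-primitive_root z) (H : algType C).
Variables (g : dih6 -> H) (L : bool -> bool -> H) (c : bool -> H).
Hypothesis ax : is_g2 z g L c.

Section Point.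
Variables (cv P0 l : bool -> C).
Hypothesis regP : P0 false ^+ 6 != P0 true ^+ 6.
Let mom0 b : {poly C} := l b *: 'X.
Variable op : H -> {ffun dih6 -> {poly C}} -> {ffun dih6 -> {poly C}}.
Hypothesis ch : is_chart z g L c cv P0 mom0 op.

Definition leading n k (phi : {ffun dih6 -> {poly C}}) :=
  forall v, (size (phi v) <= n.+1)%N /\ (phi v)`_n = (v == 1%g)%:R * k.

(** The momentum raises the degree in T by one and the reflection terms do not raise it, so the
    leading coefficient remains concentrated at the identity. *)
Lemma leading_V n k b phi : leading n k phi -> leading n.+1 (k * l b) (op (L false b) phi).
Proof.
move=> lphi v; rewrite (ch_V ch) ffunE.
set m := mom _ _; set S := \sum_i _.
have [a mE] : exists a, m = a *: 'X.
  exists (vact z v^-1%g (dl C b) false * l false + vact z v^-1%g (dl C b) true * l true).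
  by rewrite /m /mom /mom0 !scalerA -scalerDl.
have szS : (size S <= n.+1)%N.
  rewrite /S; elim/big_ind: _ => [|p q sp sq|i _]; first by rewrite size_poly0.
    by rewrite (leq_trans (size_polyD _ _)) // geq_max sp sq.
  by rewrite (leq_trans (size_scale_leq _ _)) //; case: (lphi (s_ i * v)%g).
have [szv cv_] := lphi v; split.
  rewrite (leq_trans (size_polyD _ _)) // geq_max (leq_trans szS) ?leqnSn // andbT.
  rewrite mE -scalerAl (leq_trans (size_scale_leq _ _)) //.
  by rewrite mulrC (leq_trans (size_polyMleq _ _)) // size_polyX addn2.
rewrite coefD [S`_ _]nth_default // addr0 mE -scalerAl coefZ coefXM /= cv_ mulrC.
case: eqP => [v1|_]; last by rewrite !mul0r.
rewrite !mul1r; congr (_ * _).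
have : m = l b *: 'X.
  rewrite /m v1 /mom /mom0 invg1 !(vact1 z) /dl.
  by case: (b) => /=; rewrite ?scale0r ?scale1r ?addr0 ?add0r.
by rewrite mE => /(congr1 (fun p : {poly C} => p`_1)); rewrite !coefZ coefX /= !mulr1 => ->.
Qed.

Lemma leading_delta : leading 0 1 (delta {poly C} 1%g).
Proof.
move=> v; rewrite ffunE mulr1; case: eqP => _; rewrite ?mulr1n ?mulr0n.
  by rewrite size_poly1 coef1.
by rewrite size_poly0 coef0.
Qed.

Lemma leading_word d f : leading (d + f) (l false ^+ d * l true ^+ f)
  (op (L false false ^+ d * L false true ^+ f) (delta {poly C} 1%g)).
Proof.
elim: d => [|d IHd].
  rewrite add0n !expr0 !mul1r; elim: f => [|f IHf].
    by rewrite !expr0 (ch_1 ch); exact: leading_delta.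
  by rewrite !exprS (ch_M ch) mulrC; exact: leading_V.
rewrite addSn !exprS -!mulrA (ch_M ch) [l false * _]mulrC; exact: leading_V.
Qed.

Definition ptv w : 'I_6 -> C := fun k =>
  nth 0 [:: cv false; cv true; vact z w P0 false; vact z w P0 true; l false; l true] k.

Definition topn n (p : {mpoly C[6]}) : {mpoly C[6]} :=
  \sum_(m <- msupp p | (m (inord 4) + m (inord 5) == n)%N) p@_m *: 'X_[m].

Lemma op_covX b a phi : op (L true b ^+ a) phi = [ffun w => vact z w P0 b ^+ a *: phi w].
Proof.
elim: a => [|a IHa]; apply/ffunP=> w; first by rewrite (ch_1 ch) ffunE scale1r.
by rewrite exprS (ch_M ch) (ch_U ch) op_covE IHa !ffunE scalerA exprS.
Qed.

Lemma op_cX b a phi : op (c b ^+ a) phi = cv b ^+ a *: phi.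
Proof.
elim: a => [|a IHa]; first by rewrite (ch_1 ch) scale1r.
by rewrite exprS (ch_M ch) (ch_c ch) op_parE IHa scalerA exprS.
Qed.

Lemma op_mon m w v : op (mon g L c m w) (delta {poly C} 1%g) v =
  (cv false ^+ m (inord 0) * cv true ^+ m (inord 1) * vact z v P0 false ^+ m (inord 2)
    * vact z v P0 true ^+ m (inord 3)) *:
  op (L false false ^+ m (inord 4) * L false true ^+ m (inord 5)) (delta {poly C} 1%g) (w^-1 * v)%g.
Proof.
rewrite /mon /mono -!mulrA !(ch_M ch) !op_cX !op_covX !(ch_g ch) ffunE ffunE.
by rewrite -!(ch_M ch) !ffunE !scalerA !mulrA.
Qed.

(** In top degree the letters x, y only multiply by the momenta, so starting from the delta function
    at 1 only the component [F v] reaches [v]; there X and Y evaluate at the coordinates of v P0. *)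
Lemma symbol F n v :
  (forall w m, m \in msupp (F w) -> (m (inord 4) + m (inord 5) <= n)%N) ->
  (op (pbwv g L c F) (delta {poly C} 1%g) v)`_n = (topn n (F v)).@[ptv v].
Proof.
move=> Fn; rewrite /pbwv (ch_sum ch) sum_ffunE coef_sum.
have prodE m : \prod_(k < 6) ptv v k ^+ m k =
    cv false ^+ m (inord 0) * cv true ^+ m (inord 1) * vact z v P0 false ^+ m (inord 2)
    * vact z v P0 true ^+ m (inord 3) * (l false ^+ m (inord 4) * l true ^+ m (inord 5)).
  have ordE k (k6 : (k < 6)%N) (i : 'I_6) : i = k :> nat -> i = inord k.
    by move=> ik; apply: val_inj; rewrite /= inordK.
  rewrite !big_ord_recl big_ord0 mulr1 /ptv /= !mulrA.
  by congr (_ ^+ m _ * _ ^+ m _ * _ ^+ m _ * _ ^+ m _ * _ ^+ m _ * _ ^+ m _); apply: ordE.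
transitivity (\sum_(w : dih6) \sum_(m <- msupp (F w))
   if (m (inord 4) + m (inord 5) == n)%N then
     (w == v)%:R * ((F w)@_m * \prod_(k < 6) ptv v k ^+ m k) else 0).
  apply: eq_bigr => w _; rewrite (ch_sum ch) sum_ffunE coef_sum.
  rewrite [LHS]big_seq [RHS]big_seq; apply: eq_bigr => m mF.
  rewrite (ch_scale ch) ffunE op_mon scalerA coefZ.
  have [sz lc] := leading_word (m (inord 4)) (m (inord 5)) (w^-1 * v)%g.
  case: eqP => [E|/eqP E]; last first.
    rewrite nth_default ?mulr0 //; apply: leq_trans sz _.
    by rewrite ltn_neqAle E (Fn w).
  rewrite -E lc -(inj_eq (mulgI w)) mulKVg mulg1 eq_sym prodE; ring.
rewrite (bigD1 v) //= [X in _ + X]big1 ?addr0 => [|w /negPf wv]; last first.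
  by rewrite big1 // => m _; rewrite wv mul0r if_same.
rewrite eqxx /topn raddf_sum /= [RHS]big_mkcond /=; apply: eq_bigr => m _.
by case: ifP => // _; rewrite mul1r mevalZ mevalX.
Qed.
End Point.

Definition has_charts := forall (K : comAlgType C) cv P0 (mom0 : bool -> K),
  P0 false ^+ 6 != P0 true ^+ 6 -> exists op, is_chart z g L c cv P0 mom0 op.
Hypothesis charts : has_charts.

Lemma reg_vact (P0 : bool -> C) w :
  P0 false ^+ 6 != P0 true ^+ 6 -> vact z w P0 false ^+ 6 != vact z w P0 true ^+ 6.
Proof.
have z6 k : (z ^+ k) ^+ 6 = 1 by rewrite -exprM mulnC exprM (prim_expr_order zp) expr1n.
have z6' k : (z ^- k) ^+ 6 = 1 by rewrite exprVn z6 invr1.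
by case: w => k []; rewrite /vact /= !exprMn z6 z6' !mul1r // eq_sym.
Qed.

Lemma mpoly_vanish_regular (p : {mpoly C[6]}) :
  (forall v, v (inord 2) ^+ 6 != v (inord 3) ^+ 6 -> p.@[v] = 0) -> p = 0.
Proof.
move=> pv; pose d : {mpoly C[6]} := 'X_(inord 2) ^+ 6 - 'X_(inord 3) ^+ 6.
have dE v : d.@[v] = v (inord 2) ^+ 6 - v (inord 3) ^+ 6.
  by rewrite /d mevalB (rmorphXn (meval v)) (rmorphXn (meval v)) /= !mevalXU.
have d0 : d != 0.
  apply/eqP=> /(congr1 (meval (fun k => (k == inord 2)%:R))); rewrite dE meval0 eqxx expr1n.
  have /negPf-> : inord 3 != inord 2 :> 'I_6 by apply/eqP=> /(congr1 val); rewrite /= !inordK.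
  by rewrite expr0n subr0 => /eqP; rewrite oner_eq0.
apply: (mulIf d0); rewrite mul0r; apply: mpoly_vanish => v; rewrite mevalM dE.
have [->|nz] := eqVneq (v (inord 2) ^+ 6) (v (inord 3) ^+ 6); first by rewrite subrr mulr0.
by rewrite pv // mul0r.
Qed.

(* On the chart at [P0] with momentum [l * 'X], the leading coefficient in ['X]
   of the action of [pbwv F] is the part of [F] of highest degree in x, y. *)
Lemma pbw_vanish F : (forall v, F v = 0 \/ (forall cv P0 l op,
    P0 false ^+ 6 != P0 true ^+ 6 ->
    is_chart z g L c cv P0 (fun b => l b *: ('X : {poly C})) op ->
    op (pbwv g L c F) (delta {poly C} 1%g) v = 0)) ->
  forall v, F v = 0.
Proof.
move=> F0; suff bound n : (forall w m, m \in msupp (F w) -> (m (inord 4) + m (inord 5) < n)%N) ->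
    forall v, F v = 0.
  pose N := (\max_(w : dih6) \max_(m <- msupp (F w)) (m (inord 4) + m (inord 5))).+1%N.
  apply: (bound N) => w m mF; rewrite ltnS.
  apply: leq_trans (leq_bigmax w).
  by rewrite (big_rem m mF) /= leq_maxl.
elim: n => [|n IHn] Fn.
  move=> v; apply/mpolyP=> m; rewrite mcoeff0; case: (boolP (m \in msupp (F v))) => [/Fn//|].
  exact: memN_msupp_eq0.
have top0 v : topn n (F v) = 0.
  case: (F0 v) => [->|Fv]; first by rewrite /topn msupp0 big_nil.
  apply: mpoly_vanish_regular => x regx.
  pose P b := if b then x (inord 3) else x (inord 2).
  (* The base point is chosen so that its translate by [v] has the prescribed coordinates [P]. *)
  pose P0 := vact z v^-1%g P.
  have regP0 : P0 false ^+ 6 != P0 true ^+ 6 by apply: reg_vact.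
  pose cv b := if b then x (inord 1) else x (inord 0).
  pose l b := if b then x (inord 5) else x (inord 4).
  have [op ch] := charts cv (fun b => l b *: ('X : {poly C})) regP0.
  have nF w m : m \in msupp (F w) -> (m (inord 4) + m (inord 5) <= n)%N by move/Fn.
  have := symbol ch v nF; rewrite (Fv _ _ _ _ regP0 ch) coef0 => E; rewrite [RHS]E.
  apply: meval_eq => k.
  have PE b : vact z v P0 b = P b by rewrite /P0 -(vactM zp) mulgV (vact1 z).
  rewrite /ptv !PE -[k in LHS]inord_val.
  by case: k => [[|[|[|[|[|[|]]]]]]].
apply: IHn => w m mF; rewrite ltn_neqAle -ltnS (Fn _ _ mF) andbT; apply/eqP=> E.
have := congr1 (mcoeff m) (top0 w); rewrite mcoeff0 /topn raddf_sum /= big_mkcond /=.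
rewrite (bigD1_seq m) ?msupp_uniq //= E eqxx mcoeffZ mcoeffX eqxx mulr1.
rewrite big1 ?addr0 => [Fm0|m' /negPf m'm]; first by move: mF; rewrite mcoeff_msupp Fm0 eqxx.
by case: ifP => // _; rewrite mcoeffZ mcoeffX m'm mulr0.
Qed.

(** Uniqueness in the Satake isomorphism: such an h acts by zero on every orbit, and the orbits
    detect all coefficients of ordered monomials. *)
Lemma centr_avg_inj h : centr h -> h * avg g = 0 -> h = 0.
Proof.
move=> hC he0; have [F hF] := pspan_all ax h.
suff F0 v : F v = 0.
  by rewrite -hF /pbwv big1 // => w _; rewrite F0 msupp0 big_nil.
apply: pbw_vanish => {}v; right=> cv P0 l op regP ch.
by rewrite hF (ch_central zp regP ch hC) ffunE (theta_avg0 zp regP ch hC he0) mul0r.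
Qed.

(** A central element acts by scalars, hence has no effect from the identity to any other [v];
    together with [F 1%g = 0] this is the hypothesis of [pbw_vanish], in which each component is
    treated by one of the two alternatives. *)
Lemma centr_trunc_inj F : centr (pbwv g L c F) -> F 1%g = 0 -> pbwv g L c F = 0.
Proof.
move=> hC F1; suff F0 v : F v = 0.
  by rewrite /pbwv big1 // => w _; rewrite F0 msupp0 big_nil.
apply: pbw_vanish => {}v; have [->|v1] := eqVneq v 1%g; [by left | right].
move=> cv P0 l op regP ch.
by rewrite (ch_central zp regP ch hC) !ffunE (negPf v1) mulr0.
Qed.

End Symbol.

(** * The values of a fixed point *)

Section Psi.
Variables (C : numFieldType) (z : C) (zp : 6.-primitive_root z) (H : algType C).
Variables (g : dih6 -> H) (L : bool -> bool -> H) (c : bool -> H).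
Hypothesis ax : is_g2 z g L c.
Hypothesis charts : has_charts z g L c.
Local Notation e := (avg g).
Local Notation centr := (@centr C H).
Local Notation wd := (wd L).

(** The inverse Satake map, extended to all of H by h -> e h e; the choice is justified by
    [sk_uniq]. *)
Definition sk (h : H) : H := s2val (cid2 (satake zp ax h)).

Lemma sk_centr h : centr (sk h).
Proof. exact: (s2valP (cid2 (satake zp ax h))). Qed.

Lemma skE h : e * h * e = sk h * e.
Proof. exact: (s2valP' (cid2 (satake zp ax h))). Qed.

Lemma sk_uniq h s : centr s -> e * h * e = s * e -> sk h = s.
Proof.
move=> sC E; apply/eqP; rewrite -subr_eq0; apply/eqP.
apply: (centr_avg_inj zp ax charts); last by rewrite mulrBl -skE E subrr.
rewrite -scaleN1r addrC; apply: centr_lin => //; exact: sk_centr.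
Qed.

Lemma sk_lin (a : C) (h h' : H) : sk (a *: h + h') = a *: sk h + sk h'.
Proof.
apply: sk_uniq; first by apply: centr_lin; exact: sk_centr.
rewrite mulrDr !mulrDl -!scalerAl -skE -(skE h) -!scalerAr -!scalerAl //.
Qed.

Lemma sk_central s h : centr s -> sk (s * h) = s * sk h.
Proof.
move=> sC; apply: sk_uniq; first by apply: centrM => //; exact: sk_centr.
by rewrite mulrA -sC -!mulrA [e * (h * e)]mulrA skE mulrA.
Qed.

Lemma sk1 : sk 1 = 1.
Proof. by apply: sk_uniq; [exact: centr1 | rewrite mulr1 (avg_idem ax) mul1r]. Qed.

Lemma sk_gl w h : sk (g w * h) = sk h.
Proof. by apply: sk_uniq; [exact: sk_centr | rewrite mulrA (avg_g ax) skE]. Qed.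

Lemma sk_gr w h : sk (h * g w) = sk h.
Proof. by apply: sk_uniq; [exact: sk_centr | rewrite -!mulrA (g_avg ax) mulrA skE]. Qed.

(** On e H e the Satake map is multiplicative; this is the source of the quadratic relations between
    values on words. *)
Lemma sk_avg h h' : sk (h * e * h') = sk h * sk h'.
Proof.
apply: sk_uniq; first by apply: centrM; exact: sk_centr.
rewrite !mulrA skE.
by rewrite -!mulrA [e * (h' * e)]mulrA skE !mulrA.
Qed.

Variable act : C -> H -> H.
Record rot_action : Prop := RotAction {
  act_lin : forall xi, xi ^+ 6 = 1 -> forall a h h', act xi (a *: h + h') = a *: act xi h + act xi h';
  act_1 : forall xi, xi ^+ 6 = 1 -> act xi 1 = 1;
  act_M : forall xi, xi ^+ 6 = 1 -> {morph act xi : h h' / h * h'};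
  act_g : forall xi, xi ^+ 6 = 1 -> forall w, act xi (g w) = g w;
  act_V : forall xi, xi ^+ 6 = 1 -> forall b, act xi (L false b) = xi^-1 *: L false b;
  act_U : forall xi, xi ^+ 6 = 1 -> forall b, act xi (L true b) = xi *: L true b;
  act_c : forall xi, xi ^+ 6 = 1 -> forall b, act xi (c b) = c b }.
Hypothesis acts : rot_action.

(** The function is defined on all of H but constrained only on central elements, which avoids
    carrying membership in the centre through computations with words. *)
Record fixed_char (chi : H -> C) : Prop := FixedChar {
  fc_lin : forall a s t, centr s -> centr t -> chi (a *: s + t) = a * chi s + chi t;
  fc_1 : chi 1 = 1;
  fc_M : forall s t, centr s -> centr t -> chi (s * t) = chi s * chi t;
  fc_fix : forall xi, xi ^+ 6 = 1 -> forall s, centr s -> centr (act xi s) -> chi (act xi s) = chi s }.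

Section Action.
Variable xi : C.
Hypothesis xi6 : xi ^+ 6 = 1.

Lemma xi_neq0 : xi != 0.
Proof. by apply/eqP=> x0; move: xi6; rewrite x0 expr0n => /eqP; rewrite eq_sym oner_eq0. Qed.

Lemma act_0 : act xi 0 = 0.
Proof.
have := act_lin acts xi6 1 0 0; rewrite scaler0 scale1r addr0 => E.
by apply: (addIr (act xi 0)); rewrite add0r -E.
Qed.

Lemma act_Z (a : C) (h : H) : act xi (a *: h) = a *: act xi h.
Proof. by rewrite -[a *: h]addr0 (act_lin acts xi6) act_0 addr0. Qed.

Lemma act_D (h h' : H) : act xi (h + h') = act xi h + act xi h'.
Proof. by rewrite -[h]scale1r (act_lin acts xi6) !scale1r. Qed.

Lemma act_avg : act xi e = e.
Proof.
rewrite avgE act_Z (big_morph _ act_D act_0); congr (_ *: _).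
by apply: eq_bigr => w _; rewrite (act_g acts).
Qed.

Definition dg (v : seq (bool * bool)) : C := \prod_(l <- v) (if l.1 then xi else xi^-1).

Lemma act_wd v : act xi (wd v) = dg v *: wd v.
Proof.
rewrite /wd /dg; elim: v => [|[a b] v IHv]; first by rewrite !big_nil (act_1 acts) // scale1r.
rewrite !big_cons (act_M acts) // IHv; case: a => /=.
  by rewrite (act_U acts) // -scalerAl -scalerAr scalerA.
by rewrite (act_V acts) // -scalerAl -scalerAr scalerA.
Qed.
End Action.

Lemma actK xi h : xi ^+ 6 = 1 -> act xi (act xi^-1 h) = h.
Proof.
move=> x6; have xV6 : xi^-1 ^+ 6 = 1 by rewrite exprVn x6 invr1.
have x0 := xi_neq0 x6.
apply: (g2_ind ax (P := fun h => act xi (act xi^-1 h) = h)) => [|a u v Eu Ev|w u E|[] b u E|b u E].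
- by rewrite !(act_1 acts).
- by rewrite !(act_lin acts) // Eu Ev.
- by rewrite !(act_M acts) // !(act_g acts) // E.
- by rewrite !(act_M acts) // (act_U acts) // act_Z // (act_U acts) // scalerA mulVf // scale1r E.
- by rewrite !(act_M acts) // (act_V acts) // act_Z // (act_V acts) // scalerA mulVf ?invr_eq0 // scale1r E.
- by rewrite !(act_M acts) // !(act_c acts) // E.
Qed.

Lemma act_centr xi s : xi ^+ 6 = 1 -> centr s -> centr (act xi s).
Proof.
move=> x6 sC h; rewrite -[h](actK _ x6) -!(act_M acts) // sC //.
Qed.

Lemma act_sk xi h : xi ^+ 6 = 1 -> act xi (sk h) = sk (act xi h).
Proof.
move=> x6; apply/esym/sk_uniq; first by apply: act_centr => //; exact: sk_centr.
by rewrite -{1 2}(act_avg x6) -!(act_M acts) // skE (act_M acts) // act_avg.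
Qed.

Section Fixed.
Variable chi : H -> C.
Hypothesis fc : fixed_char chi.

Definition psi h := chi (sk h).

Lemma psi_lin a h h' : psi (a *: h + h') = a * psi h + psi h'.
Proof. by rewrite /psi sk_lin (fc_lin fc) //; exact: sk_centr. Qed.

Lemma psi0 : psi 0 = 0.
Proof. by have := psi_lin (-1) 0 0; rewrite scaler0 addr0 mulN1r addNr. Qed.

Lemma psiZ a h : psi (a *: h) = a * psi h.
Proof. by rewrite -[_ *: _]addr0 psi_lin psi0 addr0. Qed.

Lemma psiD h h' : psi (h + h') = psi h + psi h'.
Proof. by rewrite -[h]scale1r psi_lin mul1r scale1r. Qed.

Lemma psi_sum I (r : seq I) (F : I -> H) : psi (\sum_(i <- r) F i) = \sum_(i <- r) psi (F i).
Proof. exact: (big_morph psi psiD psi0). Qed.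

Lemma psi_central s h : centr s -> psi (s * h) = chi s * psi h.
Proof. by move=> sC; rewrite /psi sk_central // (fc_M fc) //; exact: sk_centr. Qed.

Lemma psi1 : psi 1 = 1.
Proof. by rewrite /psi sk1 (fc_1 fc). Qed.

Lemma psi_centr s : centr s -> psi s = chi s.
Proof. by move=> sC; rewrite -[s]mulr1 psi_central // psi1 !mulr1. Qed.

Lemma psi_gl w h : psi (g w * h) = psi h. Proof. by rewrite /psi sk_gl. Qed.
Lemma psi_gr w h : psi (h * g w) = psi h. Proof. by rewrite /psi sk_gr. Qed.

Lemma psi_avg h h' : psi (h * e * h') = psi h * psi h'.
Proof. by rewrite /psi sk_avg (fc_M fc) //; exact: sk_centr. Qed.

Definition pw v := psi (wd v).

Lemma psi_act xi h : xi ^+ 6 = 1 -> psi (act xi h) = psi h.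
Proof.
move=> x6; rewrite /psi -act_sk //; apply: (fc_fix fc) => //; first exact: sk_centr.
by apply: act_centr => //; exact: sk_centr.
Qed.

Lemma pw_degree v : dg z v != 1 -> pw v = 0.
Proof.
move=> v1; have z6 := prim_expr_order zp.
have /eqP := psi_act (wd v) z6; rewrite act_wd // psiZ -subr_eq0 -{2}[psi _]mul1r -mulrBl.
by rewrite mulf_eq0 subr_eq0 (negPf v1) => /eqP.
Qed.

Lemma pw_rot v : phw z (1, false) v != 1 -> pw v = 0.
Proof.
move=> v1; have fl : flip (1, false) v = v.
  by rewrite /flip -[RHS]map_id; apply: eq_map => -[a b] /=; rewrite addbF.
have := psi_gl (1, false) (wd v); rewrite (g_wd ax) fl psiZ psi_gr => /eqP.
by rewrite -subr_eq0 -{2}[psi _]mul1r -mulrBl mulf_eq0 subr_eq0 (negPf v1) => /eqP.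
Qed.

Lemma pw_flip v : pw v = pw (flip (s_ 0) v).
Proof. by rewrite /pw -(psi_gl (s_ 0)) (g_wd ax) psiZ psi_gr phw_s0 mul1r. Qed.

(** Total charge modulo 6, with 5 in the role of -1 so that exponents of zeta stay natural
    numbers. *)
Definition nv (v : seq (bool * bool)) : nat := \sum_(l <- v) (if chg l then 1 else 5)%N.

Lemma nv_cons l v : nv (l :: v) = ((if chg l then 1 else 5) + nv v)%N.
Proof. by rewrite /nv big_cons. Qed.

Lemma nv_nil : nv [::] = 0%N. Proof. by rewrite /nv big_nil. Qed.

Lemma z5 (i : nat) : z ^+ (i * 5) = z ^- i.
Proof.
apply: (mulfI (_ : z ^+ i != 0)); first exact: (zetaX_neq0 zp).
by rewrite -exprD divff ?(zetaX_neq0 zp) // -mulnS mulnC exprM (prim_expr_order zp) expr1n.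
Qed.

Lemma phw_refl (i : 'Z_6) v : phw z (s_ i) v = z ^+ (i * nv v).
Proof.
rewrite /phw /nv; elim: v => [|[a b] v IHv]; first by rewrite !big_nil muln0.
rewrite !big_cons mulnDr exprD IHv; congr (_ * _).
by rewrite /ph /chg /= addbC; case: a; case: b => /=; rewrite ?z5 ?muln1.
Qed.

Lemma phw_rot (k : 'Z_6) v : phw z (k, false) v = z ^- (k * nv v).
Proof.
rewrite /phw /nv; elim: v => [|[a b] v IHv]; first by rewrite !big_nil muln0 invr1.
rewrite !big_cons mulnDr exprD invfM IHv; congr (_ * _).
by rewrite /ph /chg /=; case: a; case: b => /=; rewrite ?z5 ?invrK ?muln1.
Qed.

Lemma phw_trivial w v : (6 %| nv v)%N -> phw z w v = 1.
Proof.
case/dvdnP=> m E; have z1 (k : nat) : z ^+ (k * nv v) = 1.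
  by rewrite E mulnA mulnC exprM (prim_expr_order zp) expr1n.
by case: w => k []; rewrite ?phw_refl ?phw_rot z1 ?invr1.
Qed.

Local Notation A := (chi (c false)).
Local Notation B := (chi (c true)).
Local Notation S := (3 * (A + B)).
Local Notation D := (3 * (A - B)).
Local Notation E := (chi (heu L)).

Definition sig (n : nat) : C := \sum_(i : 'Z_6) z ^+ (i * n) * chi (c (odd i)).

(** The discrete Fourier transform of the parameters. Even and odd i contribute multiples of 1 + w^2
    + w^4 with w = zeta^n, which vanishes unless 3 divides n; what survives is 3(A+B) and 3(A-B). *)
Lemma sig_mod n : sig n = if (n %% 6)%N == 0%N then S else if (n %% 6)%N == 3%N then D else 0.
Proof.
have -> : sig n = (1 + (z ^+ n) ^+ 2 + (z ^+ n) ^+ 4) * A +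
   z ^+ n * (1 + (z ^+ n) ^+ 2 + (z ^+ n) ^+ 4) * B.
  rewrite /sig !big_ord_recl big_ord0 /= /bump /= !mul0n expr0 !mul1r !(mulnC _ n) !exprM.
  ring.
have -> : z ^+ n = z ^+ (n %% 6)%N by apply: (zeta_mod zp); rewrite modn_mod.
have z6 : z ^+ 6 = 1 := prim_expr_order zp.
have z31 : z ^+ 3 != 1.
  by rewrite -(prim_order_dvd zp).
have z3 : z ^+ 3 = -1.
  have : (z ^+ 3 - 1) * (z ^+ 3 + 1) = 0 by rewrite -subr_sqr -exprM z6 expr1n subrr.
  by move/eqP; rewrite mulf_eq0 subr_eq0 (negPf z31) /= addr_eq0 => /eqP.
have z2 : z ^+ 2 = z - 1.
  have : (z + 1) * (z ^+ 2 - z + 1) = 0.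
    have -> : (z + 1) * (z ^+ 2 - z + 1) = z ^+ 3 + 1 by ring.
    by rewrite z3 addNr.
  move/eqP; rewrite mulf_eq0 => /orP[/eqP z1|/eqP z1].
    have := prim_order_dvd zp 2; rewrite (_ : z = -1) ?sqrrN ?expr1n ?eqxx //.
    by apply/eqP; rewrite -addr_eq0 z1.
  have -> : z ^+ 2 = (z ^+ 2 - z + 1) + z - 1 by ring.
  by rewrite z1 add0r.
have : (n %% 6 < 6)%N by rewrite ltn_mod.
case: (n %% 6)%N => [|[|[|[|[|[|]]]]]] //= _.
- by rewrite expr0; ring.
- suff -> : 1 + (z ^+ 1) ^+ 2 + (z ^+ 1) ^+ 4 = 0 by rewrite mulr0 !mul0r addr0.
  have -> : 1 + (z ^+ 1) ^+ 2 + (z ^+ 1) ^+ 4 = 1 + z ^+ 2 + z ^+ 3 * z by ring.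
  by rewrite z3 z2; ring.
- suff -> : 1 + (z ^+ 2) ^+ 2 + (z ^+ 2) ^+ 4 = 0 by rewrite mulr0 !mul0r addr0.
  have -> : 1 + (z ^+ 2) ^+ 2 + (z ^+ 2) ^+ 4 = 1 + z ^+ 3 * z + z ^+ 6 * z ^+ 2 by ring.
  by rewrite z3 z6 z2; ring.
- have -> : 1 + (z ^+ 3) ^+ 2 + (z ^+ 3) ^+ 4 = 3 by rewrite z3; ring.
  by rewrite z3; ring.
- suff -> : 1 + (z ^+ 4) ^+ 2 + (z ^+ 4) ^+ 4 = 0 by rewrite mulr0 !mul0r addr0.
  have -> : 1 + (z ^+ 4) ^+ 2 + (z ^+ 4) ^+ 4 = 1 + z ^+ 6 * z ^+ 2 + z ^+ 6 * z ^+ 6 * z ^+ 3 * z by ring.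
  by rewrite z3 z6 z2; ring.
- suff -> : 1 + (z ^+ 5) ^+ 2 + (z ^+ 5) ^+ 4 = 0 by rewrite mulr0 !mul0r addr0.
  have -> : 1 + (z ^+ 5) ^+ 2 + (z ^+ 5) ^+ 4 = 1 + z ^+ 6 * z ^+ 3 * z + z ^+ 6 * z ^+ 6 * z ^+ 6 * z ^+ 2 by ring.
  by rewrite z3 z6 z2; ring.
Qed.

Definition swap_coef b b' v : C :=
  if b == b' then - sig (nv v) else sig ((if b then 1 else 5) + nv v).

(** The reflection s_i of the commutator slides through [v], flips it, contributes zeta to the power
    i times the charge of [v], and is absorbed at the end. The sum over i is then a value of
    [sig]. *)
Lemma pw_swap u b b' v : pw (u ++ (false, b) :: (true, b') :: v) =
  pw (u ++ (true, b') :: (false, b) :: v) + swap_coef b b' v * pw (u ++ flip (s_ 0) v).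
Proof.
rewrite /pw !wd_cat !wd_cons /= [L false b * _]mulrA (g2_LL ax) mulrDl mulrDr psiD -mulrA.
congr (_ + _); rewrite mulr_suml mulr_sumr psi_sum.
have T (i : 'Z_6) : psi (wd u * (kap z i b b' *: (c (odd i) * g (s_ i)) * wd v)) =
    kap z i b b' * z ^+ (i * nv v) * chi (c (odd i)) * psi (wd u * wd (flip (s_ 0) v)).
  rewrite -scalerAl -scalerAr psiZ -[c _ * g _ * _]mulrA (g_wd ax) phw_refl -!scalerAr psiZ.
  rewrite [wd u * (c _ * _)]mulrA -(g2_c ax) -[c _ * _ * _]mulrA psi_central; last exact: (c_centr ax).
  by rewrite [wd u * (_ * g _)]mulrA psi_gr !mulrA.
under eq_bigr => i _ do rewrite T.
rewrite -mulr_suml; congr (_ * _); rewrite /swap_coef /sig; case: eqP => bb.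
  by rewrite -sumrN; apply: eq_bigr => i _; rewrite /kap bb eqxx mulN1r mulNr.
apply: eq_bigr => i _; rewrite /kap; case: eqP => // _; congr (_ * _).
by case: (b); rewrite mulnDr exprD ?muln1 ?z5.
Qed.

Lemma pw_gap u v h : centr h -> psi (wd u * h * wd v) = chi h * pw (u ++ v).
Proof. by move=> hC; rewrite -hC -mulrA psi_central // /pw wd_cat. Qed.

Lemma chi_degree h n : centr h -> act z h = z ^+ n *: h -> ~~ (6 %| n)%N -> chi h = 0.
Proof.
move=> hC ah n6; have z6 := prim_expr_order zp.
have /eqP := psi_act h z6; rewrite ah psiZ psi_centr // -subr_eq0 -{2}[chi h]mul1r -mulrBl.
by rewrite mulf_eq0 subr_eq0 -(prim_order_dvd zp) (negPf n6) => /eqP.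
Qed.

(** The products x y and X Y are central of degree -2 and 2, so a character fixed by the sixth roots
    of unity kills them. *)
Lemma pw_zero u a b v : pw (u ++ (a, b) :: (a, ~~ b) :: v) = 0.
Proof.
have E : L a b * L a (~~ b) = if a then hQ L else hq L.
  by rewrite /hQ /hq; case: a; case: b => //=; rewrite (g2_LC ax).
have hC : centr (if a then hQ L else hq L) by case: (a); [exact: (hQ_centr zp ax) | exact: (hq_centr zp ax)].
have z6 := prim_expr_order zp.
rewrite /pw wd_cat !wd_cons /= [L a b * _]mulrA E mulrA pw_gap //.
(* The degree -2 of x y is written 10 = 5 + 5, as zeta^-1 = zeta^5. *)
rewrite (@chi_degree _ (if a then 2 else 10)) ?mul0r //; last by case: (a).
case: (a); rewrite /hQ /hq (act_M acts) ?(act_U acts) ?(act_V acts) // -scalerAl -scalerAr scalerA //.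
by rewrite -(z5 1) -exprD.
Qed.

(** Being central, eu can be inserted at any gap of a word and in either of its two forms; choosing
    both well produces the recurrences. *)
Lemma eu_xX u v : E * pw (u ++ v) =
  pw (u ++ (false, false) :: (true, false) :: v) + pw (u ++ (true, true) :: (false, true) :: v).
Proof.
rewrite -pw_gap; last exact: (heu_centr zp ax).
by rewrite /heu mulrDr mulrDl psiD /pw !wd_cat !wd_cons /= !mulrA.
Qed.

Lemma eu_Xx u v : E * pw (u ++ v) =
  pw (u ++ (true, false) :: (false, false) :: v) + pw (u ++ (false, true) :: (true, true) :: v).
Proof.
rewrite -pw_gap; last exact: (heu_centr zp ax).
by rewrite (heuE ax) mulrDr mulrDl psiD /pw !wd_cat !wd_cons /= !mulrA.
Qed.

(** The product is psi(u e v). Rotations act trivially on [v] by the hypothesis on its charge, so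
    the average over 12 elements reduces to the average of [v] and its image under s_0. *)
Lemma pw_mul u v : (6 %| nv v)%N ->
  pw u * pw v = 2^-1 * (pw (u ++ v) + pw (u ++ flip (s_ 0) v)).
Proof.
move=> v6; rewrite /pw -psi_avg avgE -scalerAr -scalerAl psiZ.
rewrite mulr_sumr mulr_suml psi_sum.
have T (w : dih6) : psi (wd u * g w * wd v) = pw (u ++ flip (0, w.2) v).
  rewrite -mulrA (g_wd ax) phw_trivial // scale1r mulrA psi_gr /pw wd_cat.
  by congr (psi (_ * wd _)).
under eq_bigr => w _ do rewrite T.
rewrite (eq_bigr (fun w : 'Z_6 * bool => (fun b => pw (u ++ flip (0, b) v)) w.2)) //.
rewrite -(pair_bigA _ (fun (k : 'Z_6) b => pw (u ++ flip (0, b) v))) /= sumr_const card_ord.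
rewrite big_bool /= addrC -[flip (0, false) v](_ : v = _); last first.
  by rewrite /flip -[LHS]map_id; apply: eq_map => -[a b] /=; rewrite addbF.
set t := _ + _; rewrite -[t *+ _]mulr_natl mulrA; congr (_ * _).
by rewrite -[(Zp_trunc 6).+2]/6%N; field.
Qed.
End Fixed.
End Psi.

(** * Recurrences, the relation, and polynomial dependence on five values *)

Lemma coef_lin_exp (K : nzRingType) (a b : K) n :
  [/\ ((a%:P + b%:P * 'X) ^+ n)`_0 = a ^+ n,
      ((a%:P + b%:P * 'X) ^+ n)`_n = b ^+ n
    & forall k, (n < k)%N -> ((a%:P + b%:P * 'X) ^+ n)`_k = 0].
Proof.
elim: n => [|n [IH0 IHn IHk]].
  by split; rewrite ?expr0 ?coef1 // => -[|k] //; rewrite coef1.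
have E k : ((a%:P + b%:P * 'X) ^+ n.+1)`_k.+1 =
    ((a%:P + b%:P * 'X) ^+ n)`_k.+1 * a + ((a%:P + b%:P * 'X) ^+ n)`_k * b.
  by rewrite exprSr mulrDr coefD coefMC mulrA coefMX /= coefMC.
split=> [||[|k] // lt_nk].
- by rewrite exprSr mulrDr coefD coefMC mulrA coefMX /= addr0 IH0 exprSr.
- by rewrite E IHk // mul0r add0r IHn exprSr.
- by rewrite E !IHk ?mul0r ?addr0 // ltnW.
Qed.

Section Relation.
Variables (C : numFieldType) (z : C) (zp : 6.-primitive_root z) (H : algType C).
Variables (g : dih6 -> H) (L : bool -> bool -> H) (c : bool -> H).
Hypothesis ax : is_g2 z g L c.
Hypothesis charts : has_charts z g L c.
Variable act : C -> H -> H.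
Hypothesis acts : rot_action g L c act.
Local Notation centr := (@centr C H).
Local Notation wd := (wd L).

Lemma haE0 : ha L 0 = L false false ^+ 6 + L false true ^+ 6.
Proof.
rewrite /ha /A6 coefD /Lp.
by congr (_ + _); [case: (coef_lin_exp (L false false) (L true true) 6)
                  |case: (coef_lin_exp (L false true) (L true false) 6)].
Qed.

Lemma haE6 : ha L 6 = L true false ^+ 6 + L true true ^+ 6.
Proof.
rewrite /ha /A6 coefD /Lp addrC.
by congr (_ + _); [case: (coef_lin_exp (L false true) (L true false) 6)
                  |case: (coef_lin_exp (L false false) (L true true) 6)].
Qed.

Lemma wd_nseq n a b : wd (nseq n (a, b)) = L a b ^+ n.
Proof.
elim: n => [|n IHn]; first by rewrite /wd big_nil.
by rewrite /= wd_cons IHn exprS.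
Qed.

Section Fixed.
Variable chi : H -> C.
Hypothesis fc : fixed_char act chi.
Local Notation pw := (pw zp ax chi).
Local Notation psi := (psi zp ax chi).
Local Notation A := (chi (c false)).
Local Notation B := (chi (c true)).
Local Notation S := (3 * (A + B)).
Local Notation D := (3 * (A - B)).
Local Notation E := (chi (heu L)).
Local Notation r := (chi (ha L 0)).
Local Notation R := (chi (ha L 6)).
Local Notation x := (false, false).
Local Notation y := (false, true).
Local Notation X := (true, false).
Local Notation Y := (true, true).
Local Notation zero := (pw_zero zp ax charts acts fc).
Local Notation swap := (pw_swap zp ax charts fc).

Definition bw a := pw (nseq a X ++ nseq a x).
Definition cw a := pw (nseq a X ++ nseq a y).

Lemma nseqSr (T : Type) n (l : T) v : nseq n.+1 l ++ v = nseq n l ++ l :: v.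
Proof. by elim: n => //= n ->. Qed.

Lemma nv_nseq n l : nv (nseq n l) = (n * (if chg l then 1 else 5))%N.
Proof. by elim: n => [|n IHn]; rewrite ?nv_nil //= nv_cons IHn mulSn. Qed.

Lemma flip_nseq n a b : flip (s_ 0) (nseq n (a, b)) = nseq n (a, ~~ b).
Proof. by rewrite /flip map_nseq /= addbT. Qed.

Lemma pw_zeroS n v : pw (nseq n.+1 X ++ Y :: v) = 0.
Proof. by rewrite nseqSr zero. Qed.

(** The form X x + y Y of eu is inserted between the powers of X and of x. Swapping y Y creates X
    next to Y, so only the commutator term remains. *)
Lemma bw_step a : bw a.+2 = E * bw a.+1 + sig z c chi (5 * a.+1) * cw a.+1.
Proof.
rewrite /bw (eu_Xx zp ax charts fc) swap pw_zeroS add0r nseqSr.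
by rewrite /swap_coef eqxx nv_nseq flip_nseq mulnC /cw mulNr subrK.
Qed.

(** The form x X + Y y is inserted instead; both ordered words vanish. Only the product of [cw] with
    eu is obtained in this way. *)
Lemma cw_step a : E * cw a.+1 = - (sig z c chi a.+1 * bw a.+1).
Proof.
rewrite /cw (eu_xX zp ax charts fc) pw_zeroS addr0 swap.
rewrite -[nseq a.+1 X ++ X :: _]nseqSr (zero (nseq a.+2 X) false false) add0r.
by rewrite /swap_coef eqxx nv_nseq flip_nseq muln1 /bw mulNr.
Qed.

Definition charges (v : seq (bool * bool)) : nat := sumn [seq (if chg l then 1 else 5)%N | l <- v].
Definition degrees (v : seq (bool * bool)) : nat := sumn [seq (if l.1 then 1 else 5)%N | l <- v].

Lemma nvE v : nv v = charges v.
Proof. by elim: v => [|l v IHv]; rewrite ?nv_nil // nv_cons IHv. Qed.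

Lemma dgE v : dg z v = z ^+ degrees v.
Proof.
elim: v => [|[a b] v IHv]; first by rewrite /dg big_nil.
rewrite /dg big_cons -/(dg z v) IHv /degrees /= exprD; congr (_ * _).
by case: a; rewrite ?expr1 // -(z5 zp 1).
Qed.

Lemma pw_charge v : ~~ (6 %| charges v)%N -> pw v = 0.
Proof.
move=> v6; apply: (pw_rot zp ax charts fc); rewrite (phw_rot zp) mul1n nvE.
by rewrite -invr1 (inj_eq invr_inj) -(prim_order_dvd zp).
Qed.

Lemma pw_degrees v : ~~ (6 %| degrees v)%N -> pw v = 0.
Proof.
by move=> v6; apply: (pw_degree zp ax charts acts fc); rewrite dgE -(prim_order_dvd zp).
Qed.

(** The coefficient [swap_coef] with [sig] already evaluated: on explicit words it computes to
    3(A+B), 3(A-B) or 0 up to sign, so that the rewriting steps below hold by conversion. *)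
Definition swc b b' v : C :=
  let t n : C := if (n %% 6 == 0)%N then S else if (n %% 6 == 3)%N then D else 0 in
  if b == b' then - t (charges v) else t ((if b then 1 else 5) + charges v)%N.

Lemma swapE u b b' v : pw (u ++ (false, b) :: (true, b') :: v) =
  pw (u ++ (true, b') :: (false, b) :: v) + swc b b' v * pw (u ++ flip (s_ 0) v).
Proof.
rewrite swap /swc /swap_coef nvE; congr (_ + _ * _).
by case: eqP => _; rewrite (sig_mod zp).
Qed.

Lemma mulE u v : (6 %| charges v)%N ->
  pw u * pw v = 2^-1 * (pw (u ++ v) + pw (u ++ flip (s_ 0) v)).
Proof. by rewrite -nvE; exact: (pw_mul zp ax charts fc). Qed.

(** The recurrence gives this identity only after multiplication by eu. To remove the factor, [mulE]
    is applied to words of degrees 4 and -4, whose values are zero. *)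
Lemma cw6 : cw 6 = - S * bw 5.
Proof.
have := mulE [:: X; X; X; X; X; y] (v := [:: X; y; y; y; y; y]) isT.
rewrite (pw_degrees (v := [:: X; X; X; X; X; y])) // mul0r => /esym/eqP.
rewrite mulf_eq0 invr_eq0 pnatr_eq0 /= => /eqP.
have -> : pw [:: X; X; X; X; X; y; X; y; y; y; y; y] = cw 6 + S * bw 5
  := swapE [:: X; X; X; X; X] true false [:: y; y; y; y; y].
have -> : pw [:: X; X; X; X; X; y; Y; x; x; x; x; x] =
    pw [:: X; X; X; X; X; Y; y; x; x; x; x; x] + - 0 * _
  := swapE [:: X; X; X; X; X] true true [:: x; x; x; x; x].
rewrite (zero [:: X; X; X; X] true false) oppr0 mul0r !addr0 => /eqP.
by rewrite addr_eq0 -mulNr => /eqP.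
Qed.

Lemma pw_nil : pw [::] = 1.
Proof. by rewrite /pw /wd big_nil (psi1 zp ax charts fc). Qed.

Lemma bw1 : bw 1 = (E + S) / 2.
Proof.
have := eu_Xx zp ax charts fc [::] [::]; rewrite pw_nil mulr1 => ->.
have -> : pw ([::] ++ [:: y; Y]) = pw [:: Y; y] + - S * pw [::] := swapE [::] true true [::].
have -> : pw [:: Y; y] = bw 1 := pw_flip zp ax charts fc [:: Y; y].
have -> : pw ([::] ++ [:: X; x]) = bw 1 := erefl.
by rewrite pw_nil; field.
Qed.

Lemma cw1 : cw 1 = 0. Proof. exact: pw_charge. Qed.
Lemma cw2 : cw 2 = 0. Proof. exact: pw_charge. Qed.
Lemma cw4 : cw 4 = 0. Proof. exact: pw_charge. Qed.
Lemma cw5 : cw 5 = 0. Proof. exact: pw_charge. Qed.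

Lemma bw2 : bw 2 = E * bw 1.
Proof. by rewrite bw_step cw1 mulr0 addr0. Qed.
Lemma bw3 : bw 3 = E * bw 2.
Proof. by rewrite bw_step cw2 mulr0 addr0. Qed.
Lemma bw4 : bw 4 = E * bw 3 + D * cw 3.
Proof. by rewrite bw_step (sig_mod zp). Qed.
Lemma bw5 : bw 5 = E * bw 4.
Proof. by rewrite bw_step cw4 mulr0 addr0. Qed.
Lemma bw6 : bw 6 = E * bw 5.
Proof. by rewrite bw_step cw5 mulr0 addr0. Qed.
Lemma Ecw3 : E * cw 3 = - (D * bw 3).
Proof. by rewrite cw_step (sig_mod zp). Qed.

(** This word and the next are the two that occur in the square of [cw 3]. The letters x, y are
    moved to the right, and any word in which x meets y or X meets Y is dropped. *)
Lemma pw_XyXy : pw [:: X; X; X; y; y; y; X; X; X; y; y; y] = S * D ^+ 2 * bw 3.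
Proof.
have -> : pw [:: X; X; X; y; y; y; X; X; X; y; y; y] =
    pw [:: X; X; X; y; y; X; y; X; X; y; y; y] + S * pw [:: X; X; X; y; y; Y; Y; x; x; x]
  := swapE [:: X; X; X; y; y] true false [:: X; X; y; y; y].
have -> : pw [:: X; X; X; y; y; X; y; X; X; y; y; y] =
    pw [:: X; X; X; y; X; y; y; X; X; y; y; y] + 0 * _
  := swapE [:: X; X; X; y] true false [:: y; X; X; y; y; y].
have -> : pw [:: X; X; X; y; X; y; y; X; X; y; y; y] =
    pw [:: X; X; X; X; y; y; y; X; X; y; y; y] + 0 * _
  := swapE [:: X; X; X] true false [:: y; y; X; X; y; y; y].
have -> : pw [:: X; X; X; X; y; y; y; X; X; y; y; y] =
    pw [:: X; X; X; X; y; y; X; y; X; y; y; y] + 0 * _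
  := swapE [:: X; X; X; X; y; y] true false [:: X; y; y; y].
have -> : pw [:: X; X; X; X; y; y; X; y; X; y; y; y] =
    pw [:: X; X; X; X; y; X; y; y; X; y; y; y] + S * pw [:: X; X; X; X; y; x; Y; x; x; x]
  := swapE [:: X; X; X; X; y] true false [:: y; X; y; y; y].
have -> : pw [:: X; X; X; X; y; X; y; y; X; y; y; y] =
    pw [:: X; X; X; X; X; y; y; y; X; y; y; y] + 0 * _
  := swapE [:: X; X; X; X] true false [:: y; y; X; y; y; y].
have -> : pw [:: X; X; X; X; X; y; y; y; X; y; y; y] =
    pw [:: X; X; X; X; X; y; y; X; y; y; y; y] + 0 * _
  := swapE [:: X; X; X; X; X; y; y] true false [:: y; y; y].
have -> : pw [:: X; X; X; X; X; y; y; X; y; y; y; y] =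
    pw [:: X; X; X; X; X; y; X; y; y; y; y; y] + 0 * _
  := swapE [:: X; X; X; X; X; y] true false [:: y; y; y; y].
have -> : pw [:: X; X; X; X; X; y; X; y; y; y; y; y] = cw 6 + S * bw 5
  := swapE [:: X; X; X; X; X] true false [:: y; y; y; y; y].
have -> : pw [:: X; X; X; X; y; x; Y; x; x; x] = 0 := zero [:: X; X; X; X] false true _.
have -> : pw [:: X; X; X; y; y; Y; Y; x; x; x] =
    pw [:: X; X; X; y; Y; y; Y; x; x; x] + - 0 * _
  := swapE [:: X; X; X; y] true true [:: Y; x; x; x].
have -> : pw [:: X; X; X; y; Y; y; Y; x; x; x] =
    pw [:: X; X; X; Y; y; y; Y; x; x; x] + - D * pw [:: X; X; X; x; X; y; y; y]
  := swapE [:: X; X; X] true true [:: y; Y; x; x; x].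
have -> : pw [:: X; X; X; Y; y; y; Y; x; x; x] = 0 := zero [:: X; X] true false _.
have -> : pw [:: X; X; X; x; X; y; y; y] =
    pw [:: X; X; X; X; x; y; y; y] + - D * bw 3
  := swapE [:: X; X; X] false false [:: y; y; y].
have -> : pw [:: X; X; X; X; x; y; y; y] = 0 := zero [:: X; X; X; X] false false _.
by rewrite cw6; ring.
Qed.

Lemma pw_XyYx : pw [:: X; X; X; y; y; y; Y; Y; Y; x; x; x] = D ^+ 2 * E * bw 3.
Proof.
have -> : pw [:: X; X; X; y; y; y; Y; Y; Y; x; x; x] =
    pw [:: X; X; X; y; y; Y; y; Y; Y; x; x; x] + - 0 * _
  := swapE [:: X; X; X; y; y] true true [:: Y; Y; x; x; x].
have -> : pw [:: X; X; X; y; y; Y; y; Y; Y; x; x; x] =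
    pw [:: X; X; X; y; Y; y; y; Y; Y; x; x; x] + - 0 * _
  := swapE [:: X; X; X; y] true true [:: y; Y; Y; x; x; x].
have -> : pw [:: X; X; X; y; Y; y; y; Y; Y; x; x; x] =
    pw [:: X; X; X; Y; y; y; y; Y; Y; x; x; x] + - D * pw [:: X; X; X; x; x; X; X; y; y; y]
  := swapE [:: X; X; X] true true [:: y; y; Y; Y; x; x; x].
have -> : pw [:: X; X; X; Y; y; y; y; Y; Y; x; x; x] = 0 := zero [:: X; X] true false _.
have -> : pw [:: X; X; X; x; x; X; X; y; y; y] =
    pw [:: X; X; X; x; X; x; X; y; y; y] + - 0 * _
  := swapE [:: X; X; X; x] false false [:: X; y; y; y].
have -> : pw [:: X; X; X; x; X; x; X; y; y; y] =
    pw [:: X; X; X; X; x; x; X; y; y; y] + - D * pw [:: X; X; X; y; Y; x; x; x]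
  := swapE [:: X; X; X] false false [:: x; X; y; y; y].
have -> : pw [:: X; X; X; y; Y; x; x; x] =
    pw [:: X; X; X; Y; y; x; x; x] + - D * cw 3
  := swapE [:: X; X; X] true true [:: x; x; x].
have -> : pw [:: X; X; X; Y; y; x; x; x] = 0 := zero [:: X; X] true false _.
have -> : pw [:: X; X; X; X; x; x; X; y; y; y] =
    pw [:: X; X; X; X; x; X; x; y; y; y] + - D * bw 4
  := swapE [:: X; X; X; X; x] false false [:: y; y; y].
have -> : pw [:: X; X; X; X; x; X; x; y; y; y] = 0 := zero [:: X; X; X; X; x; X] false false _.
by rewrite bw4; ring.
Qed.

(* [Ecw3] does not determine [cw 3] where E = 0; its square does. *)
Lemma cw3_sqr : cw 3 ^+ 2 = (D * bw 2) ^+ 2.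
Proof.
rewrite expr2 {2}/cw mulE //= -[pw [:: X, X, X & _]]/(pw [:: X; X; X; y; y; y; X; X; X; y; y; y]).
rewrite pw_XyXy -[pw [:: X, X, X & _]]/(pw [:: X; X; X; y; y; y; Y; Y; Y; x; x; x]) pw_XyYx.
by rewrite bw3 bw2 bw1; field.
Qed.

Lemma cw3 : cw 3 = - (D * bw 2).
Proof.
have [E0|E0] := eqVneq E 0.
  have b2 : bw 2 = 0 by rewrite bw2 E0 mul0r.
  by apply/eqP; rewrite b2 mulr0 oppr0 -sqrf_eq0 cw3_sqr b2 mulr0 expr0n.
by apply: (mulfI E0); rewrite Ecw3 bw3; ring.
Qed.

(** Between two e's the product R r has four words, two equal to [bw 6] and two to [cw 6]. Since
    [bw 6] = E [bw 5] and [cw 6] = -S [bw 5], this gives the factor E - S; the recurrence down to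
    [bw 1] = (E + S)/2 gives the others. *)
Lemma chi_relation : (E ^+ 2 - S ^+ 2) * (E ^+ 2 - D ^+ 2) * E ^+ 2 = r * R.
Proof.
have rC : centr (ha L 0) := ha_centr zp ax 0.
have RC : centr (ha L 6) := ha_centr zp ax 6.
have -> : r * R = psi (ha L 6 * ha L 0).
  by rewrite (psi_central zp ax charts fc) // (psi_centr zp ax charts fc) // mulrC.
have -> : psi (ha L 6 * ha L 0) = 2 * bw 6 + 2 * cw 6.
  rewrite haE0 haE6 mulrDl !mulrDr !(psiD zp ax charts fc) -!wd_nseq -!wd_cat.
  have -> : psi (wd (nseq 6 Y ++ nseq 6 x)) = cw 6 := pw_flip zp ax charts fc (nseq 6 Y ++ nseq 6 x).
  have -> : psi (wd (nseq 6 Y ++ nseq 6 y)) = bw 6 := pw_flip zp ax charts fc (nseq 6 Y ++ nseq 6 y).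
  have -> : psi (wd (nseq 6 X ++ nseq 6 x)) = bw 6 := erefl.
  have -> : psi (wd (nseq 6 X ++ nseq 6 y)) = cw 6 := erefl.
  by ring.
by rewrite cw6 bw6 bw5 bw4 cw3 bw3 bw2 bw1; field.
Qed.
End Fixed.

Definition pt5 (chi : H -> C) : 'I_5 -> C := fun j =>
  nth 0 [:: chi (c false); chi (c true); chi (ha L 0); chi (ha L 6); chi (heu L)] j.

(** One polynomial has to serve for all fixed characters: this uniformity is what makes the five
    elements generate the algebra of functions. *)
Definition chipoly (F : (H -> C) -> C) :=
  exists p : {mpoly C[5]}, forall chi, fixed_char act chi -> F chi = p.@[pt5 chi].

Lemma chipoly_ext F G : (forall chi, fixed_char act chi -> F chi = G chi) -> chipoly G -> chipoly F.
Proof. by move=> FG [p Hp]; exists p => chi fc; rewrite FG // Hp. Qed.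

Lemma chipolyC a : chipoly (fun=> a).
Proof. by exists a%:MP => chi _; rewrite mevalC. Qed.

Lemma chipolyD F G : chipoly F -> chipoly G -> chipoly (fun chi => F chi + G chi).
Proof. by move=> [p Hp] [q Hq]; exists (p + q) => chi fc; rewrite mevalD Hp ?Hq. Qed.

Lemma chipolyM F G : chipoly F -> chipoly G -> chipoly (fun chi => F chi * G chi).
Proof. by move=> [p Hp] [q Hq]; exists (p * q) => chi fc; rewrite mevalM Hp ?Hq. Qed.

Lemma chipolyN F : chipoly F -> chipoly (fun chi => - F chi).
Proof. by move=> [p Hp]; exists (- p) => chi fc; rewrite mevalN Hp. Qed.

Lemma chipolyX k (j : 'I_5) : val j = k -> chipoly (fun chi => pt5 chi j).
Proof. by move=> _; exists 'X_j => chi _; rewrite mevalXU. Qed.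

Lemma chipoly_c b : chipoly (fun chi => chi (c b)).
Proof. by case: b; [exact: (@chipolyX 1 (@Ordinal 5 1 isT))|exact: (@chipolyX 0 (@Ordinal 5 0 isT))]. Qed.
Lemma chipoly_r : chipoly (fun chi => chi (ha L 0)).
Proof. exact: (@chipolyX 2 (@Ordinal 5 2 isT)). Qed.
Lemma chipoly_R : chipoly (fun chi => chi (ha L 6)).
Proof. exact: (@chipolyX 3 (@Ordinal 5 3 isT)). Qed.
Lemma chipoly_E : chipoly (fun chi => chi (heu L)).
Proof. exact: (@chipolyX 4 (@Ordinal 5 4 isT)). Qed.

Lemma chipoly_S : chipoly (fun chi => 3 * (chi (c false) + chi (c true))).
Proof. by apply: chipolyM; [exact: chipolyC|apply: chipolyD; exact: chipoly_c]. Qed.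
Lemma chipoly_D : chipoly (fun chi => 3 * (chi (c false) - chi (c true))).
Proof. by apply: chipolyM; [exact: chipolyC|apply: chipolyD; [|apply: chipolyN]; exact: chipoly_c]. Qed.

Local Notation pwc chi := (pw zp ax chi).
Local Notation X := (true, false).

Lemma chipoly_bw a : (0 < a < 7)%N -> chipoly (fun chi => bw chi a).
Proof.
have p1 : chipoly (fun chi => bw chi 1).
  apply: (chipoly_ext (fun chi fc => bw1 fc)); apply: chipolyM (chipolyC _).
  by apply: chipolyD; [exact: chipoly_E|exact: chipoly_S].
have p2 : chipoly (fun chi => bw chi 2).
  by apply: (chipoly_ext (fun chi fc => bw2 fc)); apply: chipolyM p1; exact: chipoly_E.
have p3 : chipoly (fun chi => bw chi 3).
  by apply: (chipoly_ext (fun chi fc => bw3 fc)); apply: chipolyM p2; exact: chipoly_E.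
have p4 : chipoly (fun chi => bw chi 4).
  apply: (chipoly_ext (fun chi fc => bw4 fc)); apply: chipolyD (chipolyM chipoly_E p3) _.
  apply: chipolyM chipoly_D _; apply: (chipoly_ext (fun chi fc => cw3 fc)).
  exact: chipolyN (chipolyM chipoly_D p2).
have p5 : chipoly (fun chi => bw chi 5).
  by apply: (chipoly_ext (fun chi fc => bw5 fc)); apply: chipolyM p4; exact: chipoly_E.
have p6 : chipoly (fun chi => bw chi 6).
  by apply: (chipoly_ext (fun chi fc => bw6 fc)); apply: chipolyM p5; exact: chipoly_E.
by case: a => [|[|[|[|[|[|[|]]]]]]].
Qed.

Lemma chipoly_cw a : (0 < a < 7)%N -> chipoly (fun chi => cw chi a).
Proof.
case: a => [|[|[|[|[|[|[|]]]]]]] // _.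
- by apply: (chipoly_ext (fun chi fc => cw1 fc)); exact: chipolyC.
- by apply: (chipoly_ext (fun chi fc => cw2 fc)); exact: chipolyC.
- apply: (chipoly_ext (fun chi fc => cw3 fc)).
  by apply: chipolyN (chipolyM chipoly_D _); exact: chipoly_bw.
- by apply: (chipoly_ext (fun chi fc => cw4 fc)); exact: chipolyC.
- by apply: (chipoly_ext (fun chi fc => cw5 fc)); exact: chipolyC.
- apply: (chipoly_ext (fun chi fc => cw6 fc)).
  by apply: chipolyM (chipolyN chipoly_S) _; exact: chipoly_bw.
Qed.

Lemma pw_two_zero chi (fc : fixed_char act chi) u k t m n v :
  pwc chi (u ++ nseq m.+1 (k, t) ++ nseq n.+1 (k, ~~ t) ++ v) = 0.
Proof. by rewrite nseqSr catA (pw_zero zp ax charts acts fc). Qed.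

(** Of the two summands of R, the power of Y meets a letter X and vanishes. The remaining exponent
    has to be positive for this: the word X^6 alone takes half the value of R. *)
Lemma pw_big_X chi (fc : fixed_char act chi) a v :
  pwc chi (nseq (6 + a.+1) X ++ v) = chi (ha L 6) * pwc chi (nseq a.+1 X ++ v).
Proof.
rewrite /pw -(psi_central zp ax charts fc); last exact: (ha_centr zp ax 6).
rewrite haE6 mulrDl (psiD zp ax charts fc) -!wd_nseq -!wd_cat.
have -> : psi zp ax chi (wd (nseq 6 (true, true) ++ nseq a.+1 X ++ v)) = 0.
  exact: (pw_zero zp ax charts acts fc (nseq 5 (true, true)) true true).
by rewrite addr0 catA -nseqD.
Qed.

Lemma pw_big_x chi (fc : fixed_char act chi) u d s :
  pwc chi (u ++ nseq (6 + d.+1) (false, s)) = chi (ha L 0) * pwc chi (u ++ nseq d.+1 (false, s)).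
Proof.
rewrite -(pw_gap zp ax charts fc); last exact: (ha_centr zp ax 0).
rewrite haE0 mulrDr mulrDl (psiD zp ax charts fc) -!wd_nseq -!wd_cat -!catA.
have zero t : psi zp ax chi (wd (u ++ nseq 6 (false, ~~ t) ++ nseq d.+1 (false, t))) = 0.
  by case: t; rewrite -[nseq d.+1 _]cats0; exact: (pw_two_zero fc).
by rewrite /pw nseqD; case: (s) zero => zero; [have := zero true|have := zero false] => /= ->; rewrite ?add0r ?addr0.
Qed.

(** Splitting off R and r leaves both exponents at most 6. The degree condition then allows only a =
    d, where [bw], [cw] or the empty word apply, and the two pure words of length 6. *)
Lemma chipoly_Xl a d s : chipoly (fun chi => pwc chi (nseq a X ++ nseq d (false, s))).
Proof.
have [n] := ubnP (a + d); elim: n a d => // n IHn a d /ltnSE le_n.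
have [a7|a6] := leqP 7 a.
  have [a' Ea] : exists a', a = (6 + a'.+1)%N by exists (a - 7)%N; lia.
  apply: (chipoly_ext (G := fun chi => chi (ha L 6) * pwc chi (nseq a'.+1 X ++ nseq d (false, s)))).
    by move=> chi fc; rewrite Ea pw_big_X.
  by apply: chipolyM chipoly_R _; apply: IHn; lia.
have [d7|d6] := leqP 7 d.
  have [d' Ed] : exists d', d = (6 + d'.+1)%N by exists (d - 7)%N; lia.
  apply: (chipoly_ext (G := fun chi => chi (ha L 0) * pwc chi (nseq a X ++ nseq d'.+1 (false, s)))).
    by move=> chi fc; rewrite Ed pw_big_x.
  by apply: chipolyM chipoly_r _; apply: IHn; lia.
have [ad6|n6] := boolP (6 %| a + d * 5)%N; last first.
  apply: (chipoly_ext _ (chipolyC 0)) => chi fc; apply: (pw_degrees fc).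
  rewrite /degrees map_cat sumn_cat !map_nseq /= !sumn_nseq.
  by rewrite mul1n [(5 * _)%N]mulnC.
have [Ea|a0] := posnP a; last first.
  have [Ed|d0] := posnP d; last first.
    have Ead : a = d by lia.
    by rewrite -Ead; case: (s); [apply: chipoly_cw|apply: chipoly_bw]; rewrite a0.
  have Ea : a = 6%N by lia.
  rewrite Ea Ed.
  apply: (chipoly_ext (G := fun chi => 2^-1 * chi (ha L 6))); last by apply: chipolyM chipoly_R; exact: chipolyC.
  move=> chi fc; rewrite -(psi_centr zp ax charts fc (ha_centr zp ax 6)).
  rewrite haE6 (psiD zp ax charts fc) -!wd_nseq.
  have -> : psi zp ax chi (wd (nseq 6 (true, true))) = pwc chi (nseq 6 X) := pw_flip zp ax charts fc _.
  by rewrite cats0 /pw; field.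
have [Ed|d0] := posnP d.
  by rewrite Ea Ed; apply: (chipoly_ext (fun chi fc => pw_nil fc)); exact: chipolyC.
have Ed : d = 6%N by lia.
rewrite Ea Ed.
apply: (chipoly_ext (G := fun chi => 2^-1 * chi (ha L 0))); last by apply: chipolyM chipoly_r; exact: chipolyC.
move=> chi fc; rewrite -(psi_centr zp ax charts fc (ha_centr zp ax 0)).
rewrite haE0 (psiD zp ax charts fc) -!wd_nseq.
have fl : psi zp ax chi (wd (nseq 6 (false, true))) = psi zp ax chi (wd (nseq 6 (false, false))).
  exact: (pw_flip zp ax charts fc).
by rewrite cat0s /pw; case: (s); rewrite fl; field.
Qed.

Lemma chipoly_Ll a t d s : chipoly (fun chi => pwc chi (nseq a (true, t) ++ nseq d (false, s))).
Proof.
case: t; last exact: chipoly_Xl.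
apply: (chipoly_ext _ (chipoly_Xl a d (~~ s))) => chi fc.
by rewrite (pw_flip zp ax charts fc) /flip map_cat !map_nseq /= addbT.
Qed.

Lemma chipoly_word a b w d f : chipoly (fun chi => pwc chi
  ((nseq a X ++ nseq b (true, true)) ++ flip w (nseq d (false, false) ++ nseq f (false, true)))).
Proof.
rewrite /flip map_cat !map_nseq /= -!catA.
case: a => [|a]; case: b => [|b].
- case: d => [|d]; case: f => [|f].
  + exact: (chipoly_Ll 0 false 0 false).
  + exact: (chipoly_Ll 0 false f.+1).
  + by rewrite cats0; exact: (chipoly_Ll 0 false d.+1).
  + by apply: (chipoly_ext _ (chipolyC 0)) => chi fc; rewrite -[nseq f.+1 _]cats0 (pw_two_zero fc [::]).
- case: d => [|d]; case: f => [|f].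
  + exact: (chipoly_Ll b.+1 true 0 false).
  + exact: (chipoly_Ll b.+1 true f.+1).
  + by rewrite cats0; exact: (chipoly_Ll b.+1 true d.+1).
  + by apply: (chipoly_ext _ (chipolyC 0)) => chi fc; rewrite -[nseq f.+1 _]cats0 /= -cat_cons (pw_two_zero fc (nseq b.+1 _)).
- case: d => [|d]; case: f => [|f].
  + exact: (chipoly_Ll a.+1 false 0 false).
  + exact: (chipoly_Ll a.+1 false f.+1).
  + by rewrite cats0; exact: (chipoly_Ll a.+1 false d.+1).
  + by apply: (chipoly_ext _ (chipolyC 0)) => chi fc; rewrite -[nseq f.+1 _]cats0 /= -cat_cons (pw_two_zero fc (nseq a.+1 _)).
- by apply: (chipoly_ext _ (chipolyC 0)) => chi fc; exact: (pw_two_zero fc [::] true false).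
Qed.

Lemma chipoly_exp F n : chipoly F -> chipoly (fun chi => F chi ^+ n).
Proof.
move=> Fp; elim: n => [|n IHn]; first exact: (chipolyC 1).
by apply: (chipoly_ext _ (chipolyM Fp IHn)) => chi _; rewrite exprS.
Qed.

Lemma chi_exp chi (fc : fixed_char act chi) s n : centr s ->
  centr (s ^+ n) /\ chi (s ^+ n) = chi s ^+ n.
Proof.
move=> sC; elim: n => [|n [nC E]]; first by split; [exact: centr1 | exact: (fc_1 fc)].
by rewrite !exprS; split; [exact: centrM | rewrite (fc_M fc) // E].
Qed.

Lemma chipoly_mono i j a b w d f : chipoly (fun chi => psi zp ax chi (mono g L c i j a b w d f)).
Proof.
apply: (chipoly_ext (G := fun chi => chi (c false) ^+ i * (chi (c true) ^+ j * (phw z w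
   (nseq d (false, false) ++ nseq f (false, true)) * pwc chi
  ((nseq a X ++ nseq b (true, true)) ++ flip w (nseq d (false, false) ++ nseq f (false, true))))))).
  move=> chi fc; rewrite monoE.
  have [C0 E0] := chi_exp fc i (c_centr ax false).
  have [C1 E1] := chi_exp fc j (c_centr ax true).
  rewrite (psi_central zp ax charts fc) // (psi_central zp ax charts fc) // E0 E1; do 2!congr (_ * _).
  set v := nseq d _ ++ _; set u := nseq a X ++ _.
  have -> : nmono g L a b w d f = phw z w v *: (wd (u ++ flip w v) * g w).
    rewrite wd_cat -[wd u * _ * _]mulrA scalerAr -(g_wd ax).
    by rewrite /nmono /u /v !wd_cat !wd_nseq !mulrA.
  by rewrite (psiZ zp ax charts fc) (psi_gr zp ax charts).
by do 2?[apply: chipolyM (chipoly_exp _ (chipoly_c _)) _]; apply: chipolyM (chipolyC _) _; exact: chipoly_word.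
Qed.

(** Ordered monomials span H, and group elements and parameters leave psi up to scalars and values
    of chi; on central h the function psi is chi itself. *)
Lemma chipoly_psi h : chipoly (fun chi => psi zp ax chi h).
Proof.
case: (pspan_all ax h) => F <-.
have psiL chi (fc : fixed_char act chi) := psi_lin zp ax charts fc.
rewrite /pbwv.
have sumP (I : Type) (s : seq I) (G : I -> H) : (forall i, chipoly (fun chi => psi zp ax chi (G i))) ->
    chipoly (fun chi => psi zp ax chi (\sum_(i <- s) G i)).
  move=> Gp; elim: s => [|i s IHs].
    by apply: (chipoly_ext _ (chipolyC 0)) => chi fc; rewrite big_nil (psi0 zp ax charts fc).
  apply: (chipoly_ext _ (chipolyD (Gp i) IHs)) => chi fc.
  by rewrite big_cons (psiD zp ax charts fc).
apply: (sumP) => w; apply: (sumP) => m.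
apply: (chipoly_ext _ (chipolyM (chipolyC _) (chipoly_mono _ _ _ _ _ _ _))) => chi fc.
by rewrite (psiZ zp ax charts fc).
Qed.
End Relation.

(** * Fixed points from the orbit of (p, 0) *)

Lemma pr_scale (C : numFieldType) (a : C) U v v' :
  (forall b, a * v b = v' b) -> a * pr U v = pr U v'.
Proof. by move=> E; rewrite /pr -!E; ring. Qed.

Lemma alpha_scale (C : numFieldType) (z a : C) i v v' :
  (forall b, a * v b = v' b) -> a * alpha z i v = alpha z i v'.
Proof. by move=> E; rewrite /alpha -!E; ring. Qed.

Section Points.
Variables (C : numClosedFieldType) (z : C) (zp : 6.-primitive_root z) (H : algType C).
Variables (g : dih6 -> H) (L : bool -> bool -> H) (c : bool -> H).
Hypothesis ax : is_g2 z g L c.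
Hypothesis charts : has_charts z g L c.
Variable act : C -> H -> H.
Hypothesis acts : rot_action g L c act.
Local Notation centr := (@centr C H).

Section ChartPoint.
Variables (cv : bool -> C) (p s : C).
Hypothesis p0 : p != 0.
Definition base_pt (b : bool) : C := if b then 0 else p.
Definition base_mom (b : bool) : C^o := if b then 0 else s.

Fact base_reg : base_pt false ^+ 6 != base_pt true ^+ 6.
Proof. by rewrite /base_pt expr0n expf_eq0 /= (negPf p0). Qed.

Variable op : H -> {ffun dih6 -> C^o} -> {ffun dih6 -> C^o}.
Hypothesis ch : is_chart z g L c cv base_pt base_mom op.
Local Notation M := {ffun dih6 -> C^o}.
Local Notation theta := (theta op).

Definition rk (k : 'Z_6) : dih6 := (k, false).

Definition rtr (k : 'Z_6) (phi : M) : M := [ffun w => phi (w * rk k)%g].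

(** Scaling the point (p, 0) by a power of zeta is a rotation, so the twist of the representation by
    [act xi] is undone by a right translation of the orbit. This is what makes its central character
    fixed. *)
Lemma rtr_act (k : 'Z_6) xi h phi : xi ^+ 6 = 1 -> xi * z ^+ k = 1 ->
  rtr k (op (act xi h) phi) = op h (rtr k phi).
Proof.
move=> x6 xk; have x0 := xi_neq0 x6.
have xV : xi^-1 = z ^+ k by apply: (mulfI x0); rewrite mulfV // xk.
have zk (w : dih6) v b : vact z (w * rk k)%g v b = vact z w (vact z (rk k) v) b := vactM zp _ _ _ _.
have bp (w : dih6) b : xi * vact z (w * rk k)%g base_pt b = vact z w base_pt b.
  rewrite zk /vact /= addbF mulrCA; congr (_ * _).
  by rewrite /base_pt; case: (_ (+) _); rewrite ?mulr0 // mulrA xk mul1r.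
move: phi; pose P h := forall phi, rtr k (op (act xi h) phi) = op h (rtr k phi).
apply: (g2_ind ax (P := P)) => [phi|a u v Eu Ev phi|w u Eu phi|[] b u Eu phi|b u Eu phi] {h}.
- by rewrite (act_1 acts) // !(ch_1 ch).
- rewrite (act_lin acts) // !(ch_lin ch) -Eu -Ev.
  by apply/ffunP=> w; rewrite !ffunE.
- rewrite (act_M acts) // (act_g acts) // !(ch_M ch) -Eu !(ch_g ch).
  by apply/ffunP=> v; rewrite !ffunE mulgA.
- rewrite (act_M acts) // (act_U acts) // !(ch_M ch) -Eu (ch_scale ch) !(ch_U ch).
  apply/ffunP=> w; rewrite !ffunE scalerA; congr (_ *: _).
  by apply: pr_scale.
- rewrite (act_M acts) // (act_V acts) // !(ch_M ch) -Eu (ch_scale ch) !(ch_V ch).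
  apply/ffunP=> w; rewrite !ffunE scalerDr; congr (_ + _).
    rewrite scalerAl; congr (_ * _); rewrite /mom /base_mom !scaler0 !addr0 scalerA; congr (_ *: _).
    rewrite invMg (vactM zp) {1}/vact addbF mulrA [rk k](_ : _ = (k, false)) //.
    by rewrite xV /= (zetaN zp) mulfV ?mul1r // (zetaX_neq0 zp).
  rewrite scaler_sumr; apply: eq_bigr => i _; rewrite scalerA ffunE mulgA; congr (_ *: _).
  rewrite /coef mulrCA; congr (_ * _).
  have -> : alpha z i (vact z w base_pt) = xi * alpha z i (vact z (w * rk k)%g base_pt).
    by apply/esym/alpha_scale.
  by rewrite invfM.
- rewrite (act_M acts) // (act_c acts) // !(ch_M ch) -Eu !(ch_c ch).
  by apply/ffunP=> w; rewrite !ffunE.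
Qed.

Lemma theta_act xi h : xi ^+ 6 = 1 -> centr h -> centr (act xi h) -> theta (act xi h) = theta h.
Proof.
move=> x6 hC ahC.
have [k xk] : exists k : 'Z_6, xi * z ^+ k = 1.
  have xV6 : xi^-1 ^+ 6 = 1 by rewrite exprVn x6 invr1.
  have [k Ek] := prim_rootP zp xV6.
  by exists k; rewrite -Ek mulfV // (xi_neq0 x6).
have /ffunP/(_ (rk k)^-1%g) := rtr_act h (delta C^o 1%g) x6 xk.
have regP := base_reg.
rewrite (ch_central zp regP ch ahC) (ch_central zp regP ch hC) !ffunE mulVg eqxx !mulr1.
by [].
Qed.

Lemma theta_fixed : fixed_char act theta.
Proof.
have regP := base_reg.
split=> [a u v _ _||u v uC vC|xi x6 u uC auC].
- exact: (theta_lin ch).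
- exact: (theta1 ch).
- exact: (thetaM zp regP ch).
- exact: theta_act.
Qed.

Lemma theta_c b : theta (c b) = cv b.
Proof. by rewrite /theta (ch_c ch) !ffunE eqxx; exact: mulr1. Qed.

Lemma theta_R : theta (ha L 6) = p ^+ 6.
Proof.
rewrite haE6 /theta (ch_hD ch) ffunE.
have E b n : op (L true b ^+ n) (delta C^o 1%g) = [ffun w => base_pt b ^+ n *: delta C^o 1%g w].
  elim: n => [|n IHn]; first by rewrite (ch_1 ch); apply/ffunP=> w; rewrite !ffunE scale1r.
  rewrite exprS (ch_M ch) IHn (ch_U ch) op_covE; apply/ffunP=> w; rewrite !ffunE scalerA.
  by case: eqP => [->|]; rewrite ?scaler0 // (vact1 z) exprS.
by rewrite !E !ffunE eqxx /base_pt [0 ^+ 6]expr0n scale0r addr0; exact: mulr1.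
Qed.

(** In the form X x + y Y, the letter Y kills the delta function at (p, 0) and the reflection terms
    of x have no diagonal part; only the position p times the momentum s is left. *)
Lemma theta_eu : theta (heu L) = p * s.
Proof.
rewrite (heuE ax) /theta (ch_hD ch) ffunE !(ch_M ch).
have -> : op (L true true) (delta C^o 1%g) = 0.
  rewrite (ch_U ch) op_covE; apply/ffunP=> w; rewrite !ffunE.
  by case: eqP => [->|]; rewrite ?scaler0 // (vact1 z) scale0r.
rewrite (ch_phi0 ch) ffunE addr0 (ch_U ch) op_covE ffunE (vact1 z) (ch_V ch) ffunE.
rewrite big1 ?addr0 => [|i _]; last first.
  have s1 : (s_ i == 1%g) = false by apply/negbTE/eqP=> /(congr1 snd).
  by rewrite ffunE mulg1 s1 scaler0.
rewrite /mom !ffunE eqxx mulr1 invg1 !(vact1 z) /dl /= scale1r scale0r addr0.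
by [].
Qed.
End ChartPoint.

(** Position a sixth root p of R, momentum e / p. The value of r is left open: as R is nonzero, the
    relation determines it. *)
Lemma fixed_chart cv R e : R != 0 -> exists2 chi, fixed_char act chi &
  [/\ forall b, chi (c b) = cv b, chi (ha L 6) = R & chi (heu L) = e].
Proof.
move=> R0; pose p := 6.-root R; have p6 : p ^+ 6 = R by rewrite rootCK.
have p0 : p != 0 by apply: contra_neq R0 => p0; rewrite -p6 p0 expr0n.
have [op ch] := charts cv (base_mom (e / p)) (base_reg p0).
exists (theta op); first exact: (theta_fixed p0 ch).
split; [exact: (theta_c ch)|by rewrite (theta_R ch)|].
by rewrite (theta_eu ch) mulrC divfK.
Qed.
End Points.

(** * The fixed point variety *)

Section Nest.
Variables (C : numFieldType) (K : idomainType) (B : Type) (at_ : B -> {rmorphism K -> C}).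

Definition ptn5 (a b r R e : C) : 'I_5 -> C := fun j => nth 0 [:: a; b; r; R; e] j.

(** Regroups a polynomial in A, B, r, R, eu as one in r, R, eu with coefficients in the ring of
    parameters. *)
Lemma nest (iota : C -> K) (a0 a1 : K) (p : {mpoly C[5]}) :
  (forall b a, at_ b (iota a) = a) ->
  exists q : {mpoly K[3]}, forall b v, ev2 at_ b v q =
    p.@[ptn5 (at_ b a0) (at_ b a1) (v (inord 0)) (v (inord 1)) (v (inord 2))].
Proof.
move=> iotaK; elim/mpoly_gen_ind: p => [a|i|p q [p' Ep] [q' Eq]|p q [p' Ep] [q' Eq]].
- by exists (iota a)%:MP => b v; rewrite ev2C iotaK mevalC.
- case: i => [[|[|[|[|[|]]]]] //= lt_i].
  + by exists a0%:MP => b v; rewrite ev2C mevalXU.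
  + by exists a1%:MP => b v; rewrite ev2C mevalXU.
  + by exists 'X_(inord 0) => b v; rewrite ev2X mevalXU.
  + by exists 'X_(inord 1) => b v; rewrite ev2X mevalXU.
  + by exists 'X_(inord 2) => b v; rewrite ev2X mevalXU.
- by exists (p' + q') => b v; rewrite rmorphD mevalD /= Ep Eq.
- by exists (p' * q') => b v; rewrite rmorphM mevalM /= Ep Eq.
Qed.

Definition csG2 (a b : K) : seq K :=
  [:: 3 * (a + b); - (3 * (a + b)); 3 * (a - b); - (3 * (a - b)); 0; 0].

Lemma ev2_relG2 (a0 a1 : K) b v (S := 3 * (at_ b a0 + at_ b a1)) (D := 3 * (at_ b a0 - at_ b a1)) :
  ev2 at_ b v (hyp_rel (csG2 a0 a1)) =
  (v (inord 2) ^+ 2 - S ^+ 2) * (v (inord 2) ^+ 2 - D ^+ 2) * v (inord 2) ^+ 2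
    - v (inord 0) * v (inord 1).
Proof.
rewrite ev2_hyp_rel /csG2 !big_cons big_nil !rmorphN rmorph0 /= !rmorphM /= rmorph_nat.
by rewrite rmorphB rmorphD /S /D /=; ring.
Qed.
End Nest.

(** * Sets of characters in bijection with the zeros of the relation *)

Section CharacterVariety.
Variable C : numClosedFieldType.

Definition mev m (b : 'I_m -> C) : {rmorphism {mpoly C[m]} -> C} := meval b.

Lemma mev_sep m (p : {mpoly C[m]}) : (forall b, mev b p = 0) -> p = 0.
Proof. exact: mpoly_vanish. Qed.

Lemma mevX m (b : 'I_m -> C) i : mev b 'X_i = b i.
Proof. exact: mevalXU. Qed.

Lemma ord2P (i : 'I_2) : i = inord 0 \/ i = inord 1.
Proof. by case: i => [[|[|]]] // lt_i; [left|right]; apply: val_inj; rewrite /= inordK. Qed.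

Definition relG2 : {mpoly {mpoly C[2]}[3]} := hyp_rel (csG2 'X_(inord 0) 'X_(inord 1)).
Local Notation ev := (ev2 (@mev 2)).
Local Notation chart := (on_chart (@mev 2) (csG2 'X_(inord 0) 'X_(inord 1))).

Variables (Z : algType C) (pts : (Z -> C) -> Prop) (a0 a1 r R e : Z).

(** This section is used twice, for the fixed characters in type G2 and for the characters of the
    cyclic algebra over the corresponding parameters. Both sets are identified with the zeros of
    [relG2], which makes them comparable. *)
Definition chi_params (chi : Z -> C) (i : 'I_2) : C := chi (tnth [tuple a0; a1] i).
Definition chi_gens (chi : Z -> C) (j : 'I_3) : C := chi (tnth [tuple r; R; e] j).

Lemma prm0 chi : chi_params chi (inord 0) = chi a0.
Proof. by rewrite /chi_params (tnth_nth 0) inordK. Qed.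
Lemma prm1 chi : chi_params chi (inord 1) = chi a1.
Proof. by rewrite /chi_params (tnth_nth 0) inordK. Qed.
Lemma gn0 chi : chi_gens chi (inord 0) = chi r.
Proof. by rewrite /chi_gens (tnth_nth 0) inordK. Qed.
Lemma gn1 chi : chi_gens chi (inord 1) = chi R.
Proof. by rewrite /chi_gens (tnth_nth 0) inordK. Qed.
Lemma gn2 chi : chi_gens chi (inord 2) = chi e.
Proof. by rewrite /chi_gens (tnth_nth 0) inordK. Qed.

Lemma prmP chi b : chi a0 = b (inord 0) -> chi a1 = b (inord 1) -> chi_params chi = b.
Proof. by move=> E0 E1; apply/funext=> i; case: (ord2P i) => ->; rewrite ?prm0 ?prm1. Qed.

Lemma gnP chi v : chi r = v (inord 0) -> chi R = v (inord 1) -> chi e = v (inord 2) -> chi_gens chi = v.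
Proof. by move=> E0 E1 E2; rewrite [LHS]pt3E [RHS]pt3E gn0 gn1 gn2 E0 E1 E2. Qed.

Hypothesis pts_char : forall chi, pts chi -> scalar chi /\ GRing.monoid_morphism chi.

Lemma rel_of_chi chi (S := 3 * (chi a0 + chi a1)) (D := 3 * (chi a0 - chi a1)) :
  (chi e ^+ 2 - S ^+ 2) * (chi e ^+ 2 - D ^+ 2) * chi e ^+ 2 = chi r * chi R ->
  ev (chi_params chi) (chi_gens chi) relG2 = 0.
Proof. by rewrite /relG2 ev2_relG2 !mevX prm0 prm1 gn0 gn1 gn2 => ->; exact: subrr. Qed.

Lemma chart_r b v v' : chart b v -> ev b v' relG2 = 0 -> v' (inord 1) = v (inord 1) ->
  v' (inord 2) = v (inord 2) -> v' (inord 0) = v (inord 0).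
Proof.
move=> [R0 rel0] rel0' E1 E2; apply: (mulIf R0); rewrite -{1}E1.
move: rel0 rel0'; rewrite /relG2 !ev2_relG2 E2.
by move=> /eqP; rewrite subr_eq0 => /eqP -> /eqP; rewrite subr_eq0 => /eqP ->.
Qed.

Hypothesis pts_closed : forall chi, scalar chi -> GRing.monoid_morphism chi ->
  (forall s s', (forall chi', pts chi' -> chi' s = chi' s') -> chi s = chi s') -> pts chi.
Hypothesis pts_rel : forall chi, pts chi -> ev (chi_params chi) (chi_gens chi) relG2 = 0.
Hypothesis pts_poly : forall s : Z, exists p, forall chi, pts chi -> chi s = ev (chi_params chi) (chi_gens chi) p.
Hypothesis pts_chart : forall b v, chart b v -> exists2 chi, pts chi & chi_params chi = b /\ chi_gens chi = v.

Lemma pts_vanish p : (forall chi, pts chi -> ev (chi_params chi) (chi_gens chi) p = 0) <->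
  exists q, p = q * relG2.
Proof.
split=> [p0|[q ->] chi hchi]; last by rewrite rmorphM /= pts_rel ?mulr0.
apply: (chart_vanish (@mev_sep 2)) => b v /pts_chart[chi hchi [<- <-]].
exact: p0.
Qed.

Lemma pts_eval (p q : {mpoly {mpoly C[2]}[3]}) b v :
  (forall chi, pts chi -> ev (chi_params chi) (chi_gens chi) p = ev (chi_params chi) (chi_gens chi) q) ->
  ev b v relG2 = 0 -> ev b v p = ev b v q.
Proof.
move=> pq rel0; have [|t E] := (pts_vanish (p - q)).1.
  by move=> chi hchi; rewrite rmorphB /= pq // subrr.
by apply/eqP; rewrite -subr_eq0 -rmorphB E rmorphM /= rel0 mulr0.
Qed.

(* The polynomials of [pts_poly] respect sums and products on the chart, hence
   modulo [relG2], so they define a character at every solution. *)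
Lemma pts_at b v : ev b v relG2 = 0 -> exists2 chi, pts chi & chi_params chi = b /\ chi_gens chi = v.
Proof.
move=> rel0; have P s := cid (pts_poly s).
pose chi s := ev b v (sval (P s)).
have chiE s p : (forall chi, pts chi -> chi s = ev (chi_params chi) (chi_gens chi) p) -> chi s = ev b v p.
  by move=> sp; apply: pts_eval rel0 => chi' hchi; rewrite -sp // (svalP (P s)).
have PE s chi' : pts chi' -> chi' s = ev (chi_params chi') (chi_gens chi') (sval (P s)) := svalP (P s) chi'.
exists chi; last first.
  split; apply/funext=> i.
    rewrite /chi_params (chiE _ ('X_i)%:MP) => [|chi' _]; rewrite ev2C; [exact: mevX|exact/esym/mevX].
  by rewrite /chi_gens (chiE _ 'X_i) => [|chi' _]; rewrite ev2X.
apply: pts_closed => [c s t||s s' E]; last by apply: chiE => chi' hchi; rewrite E // PE.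
  rewrite (chiE _ (c%:MP%:MP * sval (P s) + sval (P t))).
    by rewrite rmorphD rmorphM /= ev2C /mev /= mevalC.
  move=> chi' hchi; rewrite rmorphD rmorphM /= ev2C /= mevalC -!PE //.
  by case: (pts_char hchi) => chiL _; rewrite chiL.
split=> [|s t].
  by rewrite (chiE _ 1) ?rmorph1 // => chi' /pts_char[_ [c1 _]]; rewrite rmorph1.
rewrite (chiE _ (sval (P s) * sval (P t))) ?rmorphM // => chi' hchi.
by rewrite rmorphM /= -!PE //; case: (pts_char hchi) => _ [_ cM].
Qed.

Lemma poly_pts (p : {mpoly {mpoly C[2]}[3]}) :
  exists s : Z, forall chi, pts chi -> chi s = ev (chi_params chi) (chi_gens chi) p.
Proof.
have sD (q q' : {mpoly {mpoly C[2]}[3]}) :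
    (exists s : Z, forall chi, pts chi -> chi s = ev (chi_params chi) (chi_gens chi) q) ->
    (exists s : Z, forall chi, pts chi -> chi s = ev (chi_params chi) (chi_gens chi) q') ->
    (exists s : Z, forall chi, pts chi -> chi s = ev (chi_params chi) (chi_gens chi) (q + q')) /\
    (exists s : Z, forall chi, pts chi -> chi s = ev (chi_params chi) (chi_gens chi) (q * q')).
  move=> [s Es] [t Et]; split.
    exists (s + t) => chi hchi; rewrite rmorphD /= -Es // -Et //.
    by case: (pts_char hchi) => chiL _; rewrite -[s]scale1r chiL mul1r scale1r.
  exists (s * t) => chi hchi; rewrite rmorphM /= -Es // -Et //.
  by case: (pts_char hchi) => _ [_ cM].
have cst (a : {mpoly C[2]}) : exists s : Z, forall chi, pts chi -> chi s = ev (chi_params chi) (chi_gens chi) a%:MP.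
  elim/mpoly_gen_ind: a => [a|i|a a' Ea Ea'|a a' Ea Ea'].
  - exists (a *: 1) => chi hchi; rewrite ev2C [RHS]mevalC.
    case: (pts_char hchi) => chiL [c1 _]; rewrite -[a *: 1]addr0 chiL [chi 1]c1.
    by have := chiL (-1) 0 0; rewrite scaler0 addr0 mulN1r addNr => ->; rewrite mulr1 addr0.
  - exists (tnth [tuple a0; a1] i) => chi _; rewrite ev2C; exact/esym/mevX.
  - by rewrite mpolyCD; case: (sD _ _ Ea Ea').
  - by rewrite mpolyCM; case: (sD _ _ Ea Ea').
elim/mpoly_gen_ind: p => [//|i|q q' Eq Eq'|q q' Eq Eq'].
- by exists (tnth [tuple r; R; e] i) => chi _; rewrite ev2X.
- by case: (sD _ _ Eq Eq').
- by case: (sD _ _ Eq Eq').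
Qed.

End CharacterVariety.

(** * Points of the fixed point variety in type G2 *)

Section Centre.
Variables (C : numFieldType) (W : refl_group C).
Local Notation H := (cher W).
Local Notation centr := (@centr C H).

Lemma mem_centre h : centr h -> h \in central (W := W).
Proof. by move=> hC; apply/centralP. Qed.

Lemma val_centr (s : centre W) : centr (val s).
Proof. exact/centralP/(valP s). Qed.

(** Outside the centre the value is [chi 0], a default that [fixed_char] does not constrain. *)
Definition ext (chi : centre W -> C) (h : H) : C := chi (insubd 0 h).

Lemma insubd_val (s : centre W) : insubd 0 (val s) = s.
Proof. exact: valKd. Qed.

Lemma val_1 : val (1 : centre W) = 1.
Proof. by rewrite rmorph1. Qed.

Lemma val_M (s t : centre W) : val (s * t) = val s * val t.
Proof. by rewrite rmorphM. Qed.

Lemma val_linP a (s t : centre W) : val (a *: s + t) = a *: val s + val t.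
Proof. by rewrite linearP. Qed.

Lemma ext_val chi s : ext chi (val s) = chi s.
Proof. by rewrite /ext insubd_val. Qed.

Lemma centr_val h : centr h -> exists s : centre W, val s = h.
Proof. by move=> hC; exists (Sub h (mem_centre hC)); rewrite SubK. Qed.

End Centre.

Section G2Points.
Variables (C : numClosedFieldType) (z : C) (zp : 6.-primitive_root z).
Local Notation W := (G2 zp).
Local Notation H := (cher W).
Local Notation centr := (@centr C H).
Local Notation L := (cher_L zp).
Local Notation c := (cher_c zp).

Lemma cher_charts : has_charts z (fun w => hgrp (W := W) w) L c.
Proof. by move=> K cv P0 mom0 regP; exact: chart_exists. Qed.

Lemma cher_rot : rot_action (fun w => hgrp (W := W) w) L c (@cher_act C W).
Proof.
have n0 xi : xi ^+ 6 = 1 -> xi != 0 := @xi_neq0 C xi.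
split=> xi /n0 x0 => [a h h'||h h'|w|[]|[]|b].
- by rewrite cher_actD // cher_actZ.
- exact: cher_act1.
- exact: cher_actM.
- exact: cher_act_gen.
- exact: cher_act_gen.
- exact: cher_act_gen.
- exact: cher_act_gen.
- exact: cher_act_gen.
- exact: cher_act_gen.
Qed.

Local Notation fchar := (fixed_char (@cher_act C W)).

Local Notation pts := (vpts (v := cm_fixed W 6)).

Lemma fixed_ext chi : pts chi -> fchar (ext chi).
Proof.
case=> -[chiL [chi1 chiM]] chiF; split=> [a s t /centr_val[s' <-] /centr_val[t' <-]||
  s t /centr_val[s' <-] /centr_val[t' <-]|xi x6 s /centr_val[s' <-] /centr_val[t' Et]].
- by rewrite -val_linP !ext_val chiL.
- by rewrite -val_1 ext_val chi1.
- by rewrite -val_M !ext_val chiM.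
- by rewrite -Et !ext_val; exact: (chiF xi x6).
Qed.

Lemma fixed_res chi : fchar chi -> pts (chi \o val).
Proof.
move=> fc; split=> [|xi x6 s s' E]; last first.
  by rewrite /= E (fc_fix fc) //; [exact: val_centr | rewrite -E; exact: val_centr].
split=> [a s t|].
  have E : val (a *: (s : centre W) + t) = a *: val s + val t by rewrite linearP.
  exact: etrans (congr1 chi E) (fc_lin fc a (val_centr s) (val_centr t)).
split=> [|s t]; first exact: etrans (congr1 chi (val_1 W)) (fc_1 fc).
exact: etrans (congr1 chi (val_M s t)) (fc_M fc (val_centr s) (val_centr t)).
Qed.

Definition zr : centre W := Sub (ha L 0) (mem_centre (ha_centr zp (cher_g2 zp) 0)).
Definition zR : centre W := Sub (ha L 6) (mem_centre (ha_centr zp (cher_g2 zp) 6)).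
Definition zE : centre W := Sub (heu L) (mem_centre (heu_centr zp (cher_g2 zp))).

Local Notation prm := (chi_params (zA zp) (zB zp)).
Local Notation gn := (chi_gens zr zR zE).
Local Notation ev := (ev2 (@mev C 2)).

Lemma fixed_char_pts chi : pts chi -> scalar chi /\ GRing.monoid_morphism chi.
Proof. by case. Qed.

Lemma fixed_closed chi : scalar chi -> GRing.monoid_morphism chi ->
  (forall s s', (forall chi', pts chi' -> chi' s = chi' s') -> chi s = chi s') -> pts chi.
Proof.
move=> chiL chiM chiE; split=> // xi x6 s s' E; apply: chiE => chi' [_ cF].
exact: (cF xi x6).
Qed.

Lemma fixed_rel chi : pts chi -> ev (prm chi) (gn chi) (relG2 C) = 0.
Proof.
move=> /fixed_ext fc; have := chi_relation zp (cher_g2 zp) cher_charts cher_rot fc.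
by move=> E; apply: rel_of_chi; rewrite -!ext_val.
Qed.

Lemma fixed_poly (s : centre W) : exists p, forall chi, pts chi -> chi s = ev (prm chi) (gn chi) p.
Proof.
have [p Ep] := chipoly_psi zp (cher_g2 zp) cher_charts cher_rot (val s).
have [q Eq] := nest 'X_(inord 0) 'X_(inord 1) p (at_ := @mev C 2) (iota := fun a => a%:MP) (fun b a => mevalC b a).
exists q => chi hchi; rewrite Eq !mevX prm0 prm1 gn0 gn1 gn2 -!ext_val.
have fc := fixed_ext hchi.
by rewrite -(psi_centr zp (cher_g2 zp) cher_charts fc (val_centr s)) Ep.
Qed.

Lemma fixed_gen_chart b v : on_chart (@mev C 2) (csG2 'X_(inord 0) 'X_(inord 1)) b v ->
  exists2 chi, pts chi & prm chi = b /\ gn chi = v.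
Proof.
move=> bv; have [R0 rel0] := bv; have [chi fc [Ec ER EE]] := fixed_chart zp (cher_g2 zp) cher_charts cher_rot
  (fun t => b (inord (t : nat))) (v (inord 2)) R0.
have hchi := fixed_res fc; exists (chi \o val) => //.
have Eb : prm (chi \o val) = b by apply: prmP; [exact: (Ec false)|exact: (Ec true)].
have rel' := fixed_rel hchi; rewrite Eb in rel'.
split=> //; apply: gnP => //; rewrite -[LHS](gn0 _ zR zE).
by apply: chart_r bv rel' _ _; rewrite ?gn1 ?gn2.
Qed.

End G2Points.

(** * Truncation of eu and the presentation *)

Section Trunc.
Variables (C : numFieldType) (z : C) (zp : 6.-primitive_root z) (H : algType C).
Variables (g : dih6 -> H) (L : bool -> bool -> H) (c : bool -> H).
Hypothesis ax : is_g2 z g L c.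
Hypothesis charts : has_charts z g L c.

Definition trunc_rel h f := exists2 F, pbwv g L c F = h & F 1%g = f.

Lemma trunc_lin a u v f f' : trunc_rel u f -> trunc_rel v f' -> trunc_rel (a *: u + v) (a *: f + f').
Proof.
by move=> [F <- F1] [G <- G1]; exists (fun w => a *: F w + G w); rewrite ?pbwv_lin // F1 G1.
Qed.

Lemma trunc_mono i j a b w d f : trunc_rel (mono g L c i j a b w d f)
  (if w == 1%g then 'X_[[multinom nth 0%N [:: i; j; a; b; d; f] k | k < 6]] else 0).
Proof.
pose m : 'X_{1..6} := [multinom nth 0%N [:: i; j; a; b; d; f] k | k < 6].
exists (fun v => if w == v then 'X_[m] else 0) => //.
rewrite /pbwv (bigD1 w) //= eqxx msuppX.
rewrite big_seq1 mcoeffX eqxx scale1r big1 ?addr0 => [|v vw].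
  by rewrite /mon !mnmE !inordK.
by rewrite eq_sym (negPf vw) msupp0 big_nil.
Qed.

Lemma trunc_uniq h h' f : centr h -> centr h' -> trunc_rel h f -> trunc_rel h' f -> h = h'.
Proof.
move=> hC hC' hf hf'; have := trunc_lin (-1) hf' hf.
rewrite (scaleN1r f) addNr => -[F EF F1].
have FC : centr (pbwv g L c F) by rewrite EF; exact: centr_lin.
have := centr_trunc_inj zp charts FC F1.
by rewrite EF scaleN1r addrC => /eqP; rewrite subr_eq0 => /eqP.
Qed.

Lemma mnm_pair (s t : nat) (l : seq nat) : (s < 6)%N -> (t < 6)%N ->
  (forall k, (k < 6)%N -> nth 0%N l k = ((s == k) + (t == k))%N) ->
  'X_[[multinom nth 0%N l k | k < 6]] = 'X_(inord s) * 'X_(inord t) :> {mpoly C[6]}.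
Proof.
move=> s6 t6 E; rewrite -mpolyXD; congr 'X_[_]; apply/mnmP=> k.
by rewrite mnmDE !mnm1E mnmE E // -!val_eqE /= !inordK.
Qed.

(** Reordering eu as X x + Y y leaves multiples of c s_i, which have no component at the
    identity. *)
Lemma trunc_eu : trunc_rel (heu L) (var_x * var_X + var_y * var_Y).
Proof.
have EX : mono g L c 0 0 1 0 1%g 1 0 = L true false * L false false.
  by rewrite /mono !expr0 !expr1 (g2_1 ax) !mul1r !mulr1.
have EY : mono g L c 0 0 0 1 1%g 0 1 = L true true * L false true.
  by rewrite /mono !expr0 !expr1 (g2_1 ax) !mul1r !mulr1.
have EC i : trunc_rel (cs g c i) 0.
  have := trunc_mono (if odd i then 0 else 1) (if odd i then 1 else 0) 0 0 (s_ i) 0 0.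
  have -> : (s_ i == 1%g) = false by apply/negbTE/eqP=> /(congr1 snd).
  by rewrite /mono /cs !expr0; case: (odd i); rewrite !expr0 !expr1 ?mul1r !mulr1.
have -> : heu L = (L true false * L false false + L true true * L false true)
    + \sum_(i : 'Z_6) (-1) *: cs g c i.
  by rewrite /heu (L_comm ax) addrAC.
have TS (s : seq 'Z_6) : trunc_rel (\sum_(i <- s) (-1) *: cs g c i) 0.
  elim: s => [|i s IHs].
    by exists (fun=> 0) => //; rewrite big_nil /pbwv big1 // => w _; rewrite msupp0 big_nil.
  have := trunc_lin (-1) (EC i) IHs; rewrite scaler0 addr0.
  by rewrite big_cons.
have := trunc_lin 1 (trunc_lin 1 (trunc_mono 0 0 1 0 1%g 1 0) (trunc_mono 0 0 0 1 1%g 0 1)) (TS (index_enum _)).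
rewrite EX EY !scale1r addr0.
by rewrite (@mnm_pair 4 2) // ?(@mnm_pair 5 3) // => -[|[|[|[|[|[|]]]]]].
Qed.
End Trunc.

Section Presentation.
Variables (C : numClosedFieldType) (z : C) (zp : 6.-primitive_root z).

Lemma eu_trunc_inv : is_trunc_inv (var_x * var_X + var_y * var_Y) (zE zp).
Proof.
have T := trunc_eu (cher_g2 zp).
move=> s; split=> [[F EF F1]|->].
  have T' : trunc_rel (fun w => hgrp (W := G2 zp) w) (cher_L zp) (cher_c zp) (val s) (var_x * var_X + var_y * var_Y).
    by exists F.
  exact/val_inj/(trunc_uniq zp (cher_charts zp) (val_centr s) (val_centr (zE zp)) T' T).
by have [F EF F1] := T; exists F.
Qed.

Lemma presented_byE (X : variety C) (m n : nat)
    (base : 'I_m -> vtype X -> C) (gen : 'I_n -> vtype X -> C) (rel : {mpoly {mpoly C[m]}[n]}) :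
  (forall f : vtype X -> C, regular f <->
    exists p, forall x, vpts x -> f x = ev2 (@mev C m) (base^~ x) (gen^~ x) p) ->
  (forall p, (forall x, vpts x -> ev2 (@mev C m) (base^~ x) (gen^~ x) p = 0) <->
    exists q, p = q * rel) ->
  presented_by base gen rel.
Proof. by []. Qed.

Lemma relE (K : idomainType) (a b : K) :
  (let A := a%:MP in let B := b%:MP in
   let r := 'X_(inord 0) in let R' := 'X_(inord 1) in
   let eu := 'X_(inord 2) : {mpoly K[3]} in
   (eu - 3 * (A + B)) * (eu + 3 * (A + B))
   * (eu - 3 * (A - B)) * (eu + 3 * (A - B)) * eu ^+ 2 - r * R') = hyp_rel (csG2 a b).
Proof.
rewrite /hyp_rel /hypG /csG2 /= !big_cons big_nil.
have m3 (c : K) : (3 * c)%:MP_[3] = 3 * c%:MP by rewrite mpolyCM rmorph_nat.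
rewrite !mpolyCN mpolyC0 !m3 mpolyCB mpolyCD; ring.
Qed.

Local Notation prm := (chi_params (zA zp) (zB zp)).
Local Notation gn := (chi_gens (zr zp) (zR zp) (zE zp)).

Lemma regularE (f : vtype (cm_fixed (G2 zp) 6) -> C) : regular f <->
  exists p, forall chi, vpts chi -> f chi = ev2 (@mev C 2) (prm chi) (gn chi) p.
Proof.
split=> [[f' [s Es] ff']|[p fp]].
  by have [p Ep] := fixed_poly s; exists p => chi hchi; rewrite ff' // Es Ep.
have [s Es] := poly_pts (zA zp) (zB zp) (zr zp) (zR zp) (zE zp) (@fixed_char_pts C z zp) p.
by exists (fun chi => chi s) => [|chi hchi]; [exists s|rewrite fp // Es].
Qed.

Lemma G2_presented : presented_by (X := cm_fixed (G2 zp) 6)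
  (fun (i : 'I_2) chi => chi (tnth [tuple zA zp; zB zp] i))
  (fun (j : 'I_3) chi => chi (tnth [tuple zr zp; zR zp; zE zp] j))
  (let A := ('X_(inord 0) : {mpoly C[2]})%:MP in
   let B := ('X_(inord 1) : {mpoly C[2]})%:MP in
   let r := 'X_(inord 0) in
   let R' := 'X_(inord 1) in
   let eu := 'X_(inord 2) in
   (eu - 3 * (A + B)) * (eu + 3 * (A + B))
   * (eu - 3 * (A - B)) * (eu + 3 * (A - B)) * eu ^+ 2 - r * R').
Proof.
rewrite (_ : (let A := _ in _) = relG2 C); last exact: relE.
apply: presented_byE => [f|p]; first exact: regularE.
exact: (pts_vanish (@fixed_rel C z zp) (@fixed_gen_chart C z zp)).
Qed.
End Presentation.

(** * The Cherednik algebra of the cyclic group of order 6 *)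

Section Cyclic.
Variables (C : numFieldType) (z : C) (zp : 6.-primitive_root z) (H : algType C).
Variables (t x X : H) (c : 'Z_6 -> H).

Record is_cyc : Prop := IsCyc {
  cy_t6 : t ^+ 6 = 1;
  cy_tx : t * x = z *: (x * t);
  cy_tX : t * X = z^-1 *: (X * t);
  cy_c : forall k h, c k * h = h * c k;
  cy_xX : x * X = X * x + \sum_(k : 'Z_6) (z ^+ k - 1) *: (c k * t ^+ k);
  cy_ind : forall P : H -> Prop, P 1 -> (forall a u v, P u -> P v -> P (a *: u + v)) ->
    (forall u, P u -> P (t * u)) -> (forall u, P u -> P (x * u)) ->
    (forall u, P u -> P (X * u)) -> (forall k u, P u -> P (c k * u)) -> forall h, P h }.
Hypothesis ax : is_cyc.
Local Notation centr := (@centr C H).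

Lemma sum_pow6 (w : C) : w ^+ 6 = 1 -> \sum_(k < 6) w ^+ k = if w == 1 then 6%:R else 0.
Proof.
move=> w6; case: eqP => [->|/eqP w1].
  by under eq_bigr => k _ do rewrite expr1n; rewrite sumr_const card_ord.
apply: (mulfI (_ : w - 1 != 0)); first by rewrite subr_eq0.
by rewrite -subrX1 w6 subrr mulr0.
Qed.

Lemma z6X n : (z ^+ n) ^+ 6 = 1.
Proof. by rewrite -exprM mulnC exprM (prim_expr_order zp) expr1n. Qed.

Lemma zn0 n : z ^+ n != 0. Proof. exact: (zetaX_neq0 zp). Qed.

(** The idempotent of the group algebra on which t acts as zeta^j. *)
Definition cidem (j : 'Z_6) : H := (6%:R^-1 : C) *: \sum_(k < 6) (z ^- j *: t) ^+ k.

Lemma tXe n j : t ^+ n * cidem j = (z ^+ j) ^+ n *: cidem j.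
Proof.
have w6 : (z ^- j *: t) ^+ 6 = 1 by rewrite exprZn (cy_t6 ax) exprVn z6X invr1 scale1r.
have te : t * cidem j = z ^+ j *: cidem j.
  have tE : t = z ^+ j *: (z ^- j *: t) by rewrite scalerA mulfV ?zn0 // scale1r.
  rewrite {1}tE -scalerAl; congr (_ *: _); rewrite /cidem -scalerAr; congr (_ *: _).
  rewrite mulr_sumr big_ord_recr [RHS]big_ord_recl /= -exprS w6 expr0 addrC; congr (_ + _).
  by apply: eq_bigr => i _; rewrite -exprS.
elim: n => [|n IHn]; first by rewrite !expr0 mul1r scale1r.
by rewrite exprSr -mulrA te -scalerAr IHn scalerA exprS.
Qed.

Lemma ce_ce i j : cidem i * cidem j = if i == j then cidem j else 0.
Proof.
rewrite {1}/cidem -scalerAl mulr_suml.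
under eq_bigr => k _ do rewrite exprZn -scalerAl tXe scalerA -exprMn.
rewrite -scaler_suml sum_pow6; last by rewrite exprMn exprVn !z6X invr1 mulr1.
rewrite -(zetaN zp) -(zetaD zp) addrC.
have -> : (z ^+ (j - i)%R == 1) = (i == j).
  apply/eqP/eqP=> [/(zeta_eq1 zp)/eqP|->]; last by rewrite subrr.
  by rewrite subr_eq0 => /eqP ->.
by case: eqP => _; rewrite ?scale0r ?scaler0 // scalerA mulVf ?scale1r // pnatr_eq0.
Qed.

Lemma ce_sum : \sum_j cidem j = 1.
Proof.
rewrite /cidem -scaler_sumr exchange_big /=.
have T (k : 'I_6) : \sum_(j : 'Z_6) (z ^- j *: t) ^+ k = (if k == 0 :> 'Z_6 then 6%:R else 0) *: t ^+ k.
  under eq_bigr => j _ do rewrite exprZn.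
  rewrite -scaler_suml; congr (_ *: _).
  transitivity (\sum_(j < 6) (z ^- k) ^+ j).
    by apply: eq_bigr => j _; rewrite -!exprVn -!exprM mulnC.
  rewrite sum_pow6 ?exprVn ?z6X ?invr1 // invr_eq1.
  by congr (if _ then _ else _); apply/eqP/eqP=> [/(zeta_eq1 zp)|->].
rewrite (eq_bigr _ (fun k _ => T k)) (bigD1 (0 : 'Z_6)) //= big1 ?addr0 => [|k /negPf ->]; last by rewrite scale0r.
by rewrite scalerA mulVf ?pnatr_eq0 // scale1r.
Qed.

Lemma skew_ce (y : H) (w : C) (j k : 'Z_6) : w != 0 -> t * y = w *: (y * t) -> z ^+ k = z ^+ j * w ->
  y * cidem j = cidem k * y.
Proof.
move=> w0 ty E; rewrite /cidem -scalerAr -scalerAl; congr (_ *: _).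
rewrite mulr_sumr mulr_suml; apply: eq_bigr => i _.
have S : y * (z ^- j *: t) = (z ^- k *: t) * y.
  by rewrite -scalerAl ty -scalerAr scalerA E invfM divfK.
elim: (nat_of_ord i) => [|n IHn]; first by rewrite !expr0 mulr1 mul1r.
by rewrite exprSr mulrA IHn -mulrA S mulrA -exprSr.
Qed.

Lemma x_ce j : x * cidem j = cidem (j + 1) * x.
Proof.
apply: (skew_ce _ (cy_tx ax)); first by rewrite -[z]expr1 zn0.
by rewrite (zetaD zp).
Qed.

Lemma X_ce j : X * cidem j = cidem (j - 1) * X.
Proof.
apply: (skew_ce _ (cy_tX ax)); first by rewrite invr_eq0 -[z]expr1 zn0.
by rewrite (zetaD zp) (zetaN zp).
Qed.

Lemma xn_ce n j : x ^+ n * cidem j = cidem (j + n%:R) * x ^+ n.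
Proof.
elim: n j => [|n IHn] j; first by rewrite !expr0 mul1r mulr1 addr0.
by rewrite exprSr -mulrA x_ce mulrA IHn -mulrA -exprSr -addrA -natr1 [1 + _]addrC.
Qed.

Lemma Xn_ce n j : X ^+ n * cidem j = cidem (j - n%:R) * X ^+ n.
Proof.
elim: n j => [|n IHn] j; first by rewrite !expr0 mul1r mulr1 subr0.
by rewrite exprSr -mulrA X_ce mulrA IHn -mulrA -exprSr -addrA -opprD -natr1 [1 + _]addrC.
Qed.

Definition cgam (a : 'Z_6) : H := \sum_(k : 'Z_6) (z ^+ a) ^+ k *: c k.
(** The analogue of eu. The power t^k acts on [cidem j] as zeta^(jk), so there [ceul] is x X plus
    the Fourier coefficient [cgam j], and equally X x plus [cgam (j + 1)]. *)
Definition ceul : H := x * X + \sum_(k : 'Z_6) c k * t ^+ k.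

Lemma cyc_c_centr k : centr (c k). Proof. exact: (cy_c ax). Qed.

Lemma centr_sum (I : Type) (r : seq I) (F : I -> H) : (forall i, centr (F i)) -> centr (\sum_(i <- r) F i).
Proof.
move=> FC; elim: r => [|i r IHr]; first by rewrite big_nil; exact: centr0.
by rewrite big_cons -[F i]scale1r; exact: centr_lin.
Qed.

Lemma centrZ a (h : H) : centr h -> centr (a *: h).
Proof. by move=> hC; rewrite -[_ *: _]addr0; apply: centr_lin => //; exact: centr0. Qed.

Lemma centrD (h h' : H) : centr h -> centr h' -> centr (h + h').
Proof. by move=> hC hC'; rewrite -[h]scale1r; apply: centr_lin. Qed.

Lemma centrB (h h' : H) : centr h -> centr h' -> centr (h - h').
Proof. by move=> hC hC'; rewrite -scaleN1r addrC; apply: centr_lin. Qed.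

Lemma gam_centr a : centr (cgam a).
Proof. by apply: centr_sum => k; apply: centrZ; exact: cyc_c_centr. Qed.

Lemma ct_ce j : (\sum_(k : 'Z_6) c k * t ^+ k) * cidem j = cgam j * cidem j.
Proof.
rewrite /cgam !mulr_suml; apply: eq_bigr => k _.
by rewrite -mulrA tXe -scalerAr scalerAl.
Qed.

Lemma xX_ce j : x * X * cidem j = (ceul - cgam j) * cidem j.
Proof. by rewrite mulrBl /ceul mulrDl ct_ce addrK. Qed.

Lemma Xx_ce j : X * x * cidem j = (ceul - cgam (j + 1)) * cidem j.
Proof.
have D : (\sum_(k : 'Z_6) (z ^+ k - 1) *: (c k * t ^+ k)) * cidem j = (cgam (j + 1) - cgam j) * cidem j.
  rewrite /cgam -sumrB !mulr_suml; apply: eq_bigr => k _.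
  rewrite -scalerAl -mulrA tXe -scalerAr scalerA -scalerBl -scalerAl; congr (_ *: _).
  by rewrite (zetaD zp) exprMn mulrBl mul1r mulrC.
by have := xX_ce j; rewrite {1}(cy_xX ax) mulrDl D !mulrBl addrA => /addIr <-; rewrite addrK.
Qed.

Lemma cE_ce j : ceul * cidem j = x * X * cidem j + cgam j * cidem j.
Proof. by rewrite {1}/ceul mulrDl ct_ce. Qed.

Lemma cE_ce' j : ceul * cidem j = X * x * cidem j + cgam (j + 1) * cidem j.
Proof. by rewrite Xx_ce mulrBl subrK. Qed.

Lemma eq_ce (u v : H) : (forall j, u * cidem j = v * cidem j) -> u = v.
Proof.
move=> E; rewrite -[u]mulr1 -[v]mulr1 -ce_sum !mulr_sumr.
by apply: eq_bigr => j _.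
Qed.

Lemma centr_cyc h : h * t = t * h -> h * x = x * h -> h * X = X * h -> centr h.
Proof.
move=> ht hx hX; apply: (cy_ind ax (P := fun u => h * u = u * h)) => [|a u v Eu Ev|u E|u E|u E|k u E].
- by rewrite mulr1 mul1r.
- by rewrite mulrDr mulrDl -scalerAr -scalerAl Eu Ev.
- by rewrite mulrA ht -mulrA E mulrA.
- by rewrite mulrA hx -mulrA E mulrA.
- by rewrite mulrA hX -mulrA E mulrA.
- by rewrite mulrA -(cy_c ax) -mulrA E mulrA.
Qed.

Lemma z0 : z != 0. Proof. by rewrite -[z]expr1 zn0. Qed.

(** Checked on each idempotent: x sends [cidem j] to [cidem (j + 1)], where the form with x X
    involves the same [cgam (j + 1)] as the form with X x on [cidem j]. *)
Lemma cE_centr : centr ceul.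
Proof.
apply: centr_cyc.
- rewrite /ceul mulrDl mulrDr; congr (_ + _).
    rewrite [t * (x * X)]mulrA (cy_tx ax) -scalerAl -[x * t * X]mulrA (cy_tX ax) -scalerAr.
    by rewrite scalerA mulfV ?z0 // scale1r mulrA.
  rewrite mulr_suml mulr_sumr; apply: eq_bigr => k _.
  by rewrite [t * _]mulrA -(cy_c ax) -!mulrA -exprS -exprSr.
- apply: eq_ce => j; rewrite -[ceul * x * _]mulrA x_ce mulrA cE_ce -[x * ceul * _]mulrA cE_ce'.
  rewrite mulrDl mulrDr -[x * X * _ * x]mulrA -[cgam _ * _ * x]mulrA -x_ce !mulrA.
  by rewrite (gam_centr _ x).
- apply: eq_ce => j; rewrite -[ceul * X * _]mulrA X_ce mulrA cE_ce' -[X * ceul * _]mulrA cE_ce.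
  rewrite mulrDl mulrDr -[X * x * _ * X]mulrA -[cgam _ * _ * X]mulrA -X_ce subrK !mulrA.
  by rewrite (gam_centr _ X).
Qed.

Lemma eg_centr a : centr (ceul - cgam a).
Proof. exact: centrB cE_centr (gam_centr a). Qed.

Lemma t_exp (y : H) w n : t * y = w *: (y * t) -> t * y ^+ n = w ^+ n *: (y ^+ n * t).
Proof.
move=> E; elim: n => [|n IHn]; first by rewrite !expr0 mulr1 mul1r scale1r.
rewrite exprS mulrA E -scalerAl -[y * t * _]mulrA IHn -scalerAr scalerA mulrA.
by rewrite -exprS -exprS.
Qed.

Lemma xn_X n j : x ^+ n.+1 * X * cidem j = (ceul - cgam j) * (x ^+ n * cidem j).
Proof.
rewrite exprSr -!mulrA [x * (X * _)]mulrA xX_ce [x ^+ n * _]mulrA.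
by rewrite -(eg_centr j (x ^+ n)) -mulrA.
Qed.

Lemma X_xn n j : X * x ^+ n.+1 * cidem j = (ceul - cgam (j + n%:R + 1)) * (x ^+ n * cidem j).
Proof. by rewrite exprS -!mulrA xn_ce !mulrA Xx_ce. Qed.

Lemma Xn_x n j : X ^+ n.+1 * x * cidem j = (ceul - cgam (j + 1)) * (X ^+ n * cidem j).
Proof.
rewrite exprSr -!mulrA [X * (x * _)]mulrA Xx_ce [X ^+ n * _]mulrA.
by rewrite -(eg_centr _ (X ^+ n)) -mulrA.
Qed.

Lemma x_Xn n j : x * X ^+ n.+1 * cidem j = (ceul - cgam (j - n%:R)) * (X ^+ n * cidem j).
Proof. by rewrite exprS -!mulrA Xn_ce !mulrA xX_ce. Qed.

Lemma x6_centr : centr (x ^+ 6).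
Proof.
apply: centr_cyc; first by rewrite (t_exp _ (cy_tx ax)) (prim_expr_order zp) scale1r.
  by rewrite -exprS -exprSr.
apply: eq_ce => j; rewrite xn_X X_xn; congr ((_ - cgam _) * _).
by rewrite -addrA -[LHS]addr0; congr (_ + _); exact: val_inj.
Qed.

Lemma X6_centr : centr (X ^+ 6).
Proof.
apply: centr_cyc.
- by rewrite (t_exp _ (cy_tX ax)) exprVn (prim_expr_order zp) invr1 scale1r.
- apply: eq_ce => j; rewrite Xn_x x_Xn; congr ((_ - cgam _) * _).
- by rewrite -exprS -exprSr.
Qed.

Lemma Xnxn_ce n j : X ^+ n * x ^+ n * cidem j = \prod_(i < n) (ceul - cgam (j + 1 + i%:R)) * cidem j.
Proof.
elim: n => [|n IHn]; first by rewrite big_ord0 !expr0 mulr1.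
have -> : X ^+ n.+1 * x ^+ n.+1 * cidem j = X ^+ n * (X * x * cidem (j + n%:R)) * x ^+ n.
  by rewrite exprSr exprS -!mulrA xn_ce.
rewrite Xx_ce mulrA -(eg_centr _ (X ^+ n)) -!mulrA -xn_ce [X ^+ n * _]mulrA IHn.
by rewrite big_ord_recr /= -(eg_centr (j + 1 + n%:R)) -mulrA (addrAC j 1).
Qed.

Lemma prod_rot j : \prod_(i < 6) (ceul - cgam (j + 1 + i%:R)) = \prod_(i < 6) (ceul - cgam (i : 'I_6)).
Proof.
pose G j := \prod_(i < 6) (ceul - cgam (j + i%:R)).
have GS k : G (k + 1) = G k.
  rewrite /G big_ord_recr [RHS]big_ord_recl /= -(eg_centr (k + 1 + 5%:R)); congr (_ * _).
    by congr (_ - cgam _); rewrite -addrA; congr (_ + _); exact: val_inj.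
  apply: eq_bigr => i _; congr (_ - cgam _); rewrite -addrA; congr (k + _).
  by rewrite (_ : bump 0 i = i.+1) // mulrS.
have G0 (n : nat) : G n%:R = G 0 by elim: n => // n IHn; rewrite -natr1 GS.
rewrite -/(G (j + 1)) -[j + 1]natr_Zp G0; apply: eq_bigr => i _.
by rewrite add0r; congr (_ - cgam _); exact: (natr_Zp (i : 'Z_6)).
Qed.

(** Peeling off the inner products X x one by one meets each [cgam] exactly once, from whichever
    idempotent one starts. *)
Lemma X6x6 : X ^+ 6 * x ^+ 6 = \prod_(i < 6) (ceul - cgam (i : 'I_6)).
Proof. by apply: eq_ce => j; rewrite Xnxn_ce prod_rot. Qed.

End Cyclic.

(** * Characters of the cyclic algebra with prescribed Fourier coefficients *)

Section CyclicCharacters.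
Variables (C : numClosedFieldType) (z : C) (zp : 6.-primitive_root z) (H : algType C).
Variables (t x X : H) (c : 'Z_6 -> H).
Hypothesis ax : is_cyc z t x X c.
Local Notation centr := (@centr C H).
Local Notation gam := (cgam z c).
Local Notation ce := (cidem z t).
Local Notation cE := (ceul t x X c).
Local Notation ev := (ev2 (@mev C 2)).
Local Notation chart := (on_chart (@mev C 2) (csG2 'X_(inord 0) 'X_(inord 1))).

(* The values 3(A+B), -3(A+B), 3(A-B), -3(A-B), 0, 0 prescribed to the [cgam]. *)
Definition lamv (A B : C) (a : nat) : C :=
  nth 0 [:: 3 * (A + B); - (3 * (A + B)); 3 * (A - B); - (3 * (A - B))] a.

(** As [cgam 0] and [cgam 2] are to take the values 3(A+B) and 3(A-B), this combination recovers A,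
    and the next one B. *)
Definition ca0 : H := 6%:R^-1 *: (gam 0 + gam 2%:R).
Definition ca1 : H := 6%:R^-1 *: (gam 0 - gam 2%:R).

(** The condition [cc_lam] restricts to the parameters coming from a pair (A, B), that is, to the
    base change of the Calogero-Moser family. *)
Record cyc_char (chi : H -> C) : Prop := CycChar {
  cc_lin : forall a s u, centr s -> centr u -> chi (a *: s + u) = a * chi s + chi u;
  cc_1 : chi 1 = 1;
  cc_M : forall s u, centr s -> centr u -> chi (s * u) = chi s * chi u;
  cc_lam : forall a : 'Z_6, chi (gam a) = lamv (chi ca0) (chi ca1) a }.

Local Notation prm := (chi_params ca0 ca1).
Local Notation gn := (chi_gens (x ^+ 6) (X ^+ 6) cE).
Local Notation gamC := (gam_centr ax).

Lemma ca0_centr : centr ca0.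
Proof. by apply: centrZ; apply: centrD; exact: gamC. Qed.
Lemma ca1_centr : centr ca1.
Proof. by apply: centrZ; apply: centrB; exact: gamC. Qed.

Section Chi.
Variable chi : H -> C.
Hypothesis cc : cyc_char chi.

Lemma cc_D s u : centr s -> centr u -> chi (s + u) = chi s + chi u.
Proof. by move=> sC uC; rewrite -[s]scale1r (cc_lin cc) // mul1r scale1r. Qed.

Lemma cc_0 : chi 0 = 0.
Proof.
have c0 : centr 0 := @centr0 C H.
by have := cc_lin cc (-1) c0 c0; rewrite scaler0 addr0 mulN1r addNr.
Qed.

Lemma cc_Z a s : centr s -> chi (a *: s) = a * chi s.
Proof. by move=> sC; rewrite -[_ *: _]addr0 (cc_lin cc) ?cc_0 ?addr0 //; exact: centr0. Qed.

Lemma cc_B s u : centr s -> centr u -> chi (s - u) = chi s - chi u.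
Proof. by move=> sC uC; rewrite -scaleN1r addrC (cc_lin cc) // mulN1r addrC. Qed.

Lemma cc_prod (I : Type) (r : seq I) (F : I -> H) : (forall i, centr (F i)) ->
  centr (\prod_(i <- r) F i) /\ chi (\prod_(i <- r) F i) = \prod_(i <- r) chi (F i).
Proof.
move=> FC; elim: r => [|i r [rC IHr]].
  by rewrite !big_nil; split; [exact: centr1 | exact: (cc_1 cc)].
by rewrite !big_cons; split; [exact: centrM | rewrite (cc_M cc) // IHr].
Qed.

Lemma cyc_rel : ev (prm chi) (gn chi) (relG2 C) = 0.
Proof.
have := X6x6 zp ax; move/(congr1 chi).
rewrite (cc_M cc) ?(X6_centr zp ax) ?(x6_centr zp ax) //; try exact: (X6_centr zp ax); try exact: (x6_centr zp ax).
have [_ ->] := cc_prod (index_enum 'I_6) (fun i => eg_centr zp ax (i : 'I_6)).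
have T (i : 'I_6) : chi (cE - gam i) = chi cE - lamv (chi ca0) (chi ca1) i.
  by rewrite cc_B ?(cc_lam cc) //; [exact: (cE_centr zp ax)|exact: gamC].
under eq_bigr => i _ do rewrite T.
rewrite !big_ord_recl big_ord0 /= /lamv /= => E.
by apply: rel_of_chi; rewrite [RHS]mulrC E; ring.
Qed.
End Chi.

Definition lampoly (s : H) := centr s /\ exists p, forall chi, cyc_char chi -> chi s = ev (prm chi) (gn chi) p.

Lemma lampolyM s u : lampoly s -> lampoly u -> lampoly (s * u).
Proof.
move=> [sC [p Ep]] [uC [q Eq]]; split; first exact: centrM.
by exists (p * q) => chi cc; rewrite (cc_M cc) // Ep // Eq // rmorphM.
Qed.

Lemma lampoly_lin a s u : lampoly s -> lampoly u -> lampoly (a *: s + u).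
Proof.
move=> [sC [p Ep]] [uC [q Eq]]; split; first exact: centr_lin.
exists (a%:MP%:MP * p + q) => chi cc.
by rewrite (cc_lin cc) // Ep // Eq // rmorphD rmorphM /= ev2C /= mevalC.
Qed.

Lemma lampoly1 : lampoly 1.
Proof. by split; [exact: centr1|exists 1 => chi cc; rewrite (cc_1 cc) rmorph1]. Qed.

Lemma lampoly0 : lampoly 0.
Proof. by split; [exact: centr0|exists 0 => chi cc; rewrite (cc_0 cc) rmorph0]. Qed.

Lemma lampolyZ a s : lampoly s -> lampoly (a *: s).
Proof. by move=> cspan; rewrite -[_ *: _]addr0; apply: lampoly_lin => //; exact: lampoly0. Qed.

Lemma lampolyB s u : lampoly s -> lampoly u -> lampoly (s - u).
Proof. by move=> cspan up; rewrite -scaleN1r addrC; apply: lampoly_lin. Qed.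

Lemma lampoly_a0 : lampoly ca0.
Proof.
by split; [exact: ca0_centr|exists ('X_(inord 0))%:MP => chi cc; rewrite ev2C [RHS]mevX prm0].
Qed.
Lemma lampoly_a1 : lampoly ca1.
Proof.
by split; [exact: ca1_centr|exists ('X_(inord 1))%:MP => chi cc; rewrite ev2C [RHS]mevX prm1].
Qed.
Lemma lampoly_x6 : lampoly (x ^+ 6).
Proof. by split; [exact: (x6_centr zp ax)|exists 'X_(inord 0) => chi cc; rewrite ev2X gn0]. Qed.
Lemma lampoly_X6 : lampoly (X ^+ 6).
Proof. by split; [exact: (X6_centr zp ax)|exists 'X_(inord 1) => chi cc; rewrite ev2X gn1]. Qed.
Lemma lampoly_E : lampoly cE.
Proof. by split; [exact: (cE_centr zp ax)|exists 'X_(inord 2) => chi cc; rewrite ev2X gn2]. Qed.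

Lemma lampoly_gam a : lampoly (gam a).
Proof.
have S : lampoly (3 *: (ca0 + ca1)) by apply: lampolyZ; rewrite -[ca0]scale1r; apply: lampoly_lin; [exact: lampoly_a0|exact: lampoly_a1].
have D : lampoly (3 *: (ca0 - ca1)) by apply: lampolyZ; apply: lampolyB; [exact: lampoly_a0|exact: lampoly_a1].
have key u : lampoly u -> (forall chi, cyc_char chi -> chi (gam a) = chi u) -> lampoly (gam a).
  move=> [_ [p Ep]] E; split; first exact: gamC.
  by exists p => chi cc; rewrite E // Ep.
have ES chi : cyc_char chi -> chi (3 *: (ca0 + ca1)) = 3 * (chi ca0 + chi ca1).
  move=> cc; rewrite (cc_Z cc) ?(cc_D cc) //; try apply: centrD; try exact: ca0_centr; exact: ca1_centr.
have ED chi : cyc_char chi -> chi (3 *: (ca0 - ca1)) = 3 * (chi ca0 - chi ca1).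
  move=> cc; rewrite (cc_Z cc) ?(cc_B cc) //; try apply: centrB; try exact: ca0_centr; exact: ca1_centr.
have N u : lampoly u -> forall chi, cyc_char chi -> chi (-1 *: u) = - chi u.
  by move=> [uC _] chi cc; rewrite (cc_Z cc) // mulN1r.
have E chi : cyc_char chi -> chi (gam a) = lamv (chi ca0) (chi ca1) a by move=> cc; exact: (cc_lam cc).
move: E; case: (nat_of_ord a) => [|[|[|[|n]]]] E.
- by apply: key S _ => chi cc; rewrite E // ES.
- by apply: key (lampolyZ (-1) S) _ => chi cc; rewrite E // N // ES.
- by apply: key D _ => chi cc; rewrite E // ED.
- by apply: key (lampolyZ (-1) D) _ => chi cc; rewrite E // N // ED.
- by apply: key lampoly0 _ => chi cc; rewrite E // (cc_0 cc) /lamv /= nth_nil.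
Qed.

Lemma c_fourier k : c k = 6%:R^-1 *: \sum_(a < 6) (z ^- k) ^+ a *: gam (a : 'I_6).
Proof.
rewrite /cgam; under eq_bigr => a _ do rewrite scaler_sumr.
rewrite exchange_big (bigD1 k) //= [X in _ + X]big1 ?addr0 => [|l lk].
  under eq_bigr => a _ do rewrite scalerA exprAC -exprMn mulVf ?zn0 // expr1n scale1r.
  by rewrite sumr_const card_ord -(scaler_nat 6 (c k)) scalerA mulVf ?scale1r // pnatr_eq0.
under eq_bigr => a _ do rewrite scalerA exprAC -exprMn.
rewrite -scaler_suml sum_pow6; last by rewrite exprMn exprVn !z6X // invr1 mulr1.
rewrite -(zetaN zp) -(zetaD zp) (_ : (z ^+ (- k + l)%R == 1) = false) ?scale0r //.
by apply/negbTE; apply: contra_neq lk => /(zeta_eq1 zp)/eqP; rewrite addrC subr_eq0 => /eqP.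
Qed.

Lemma lampoly_c k : lampoly (c k).
Proof.
rewrite c_fourier; apply: lampolyZ; elim: (index_enum _) => [|a s IHs]; first by rewrite big_nil; exact: lampoly0.
by rewrite big_cons; apply: lampoly_lin => //; exact: lampoly_gam.
Qed.

(** On an idempotent x X and X x are central, so powers of x or of X alone suffice, with
    coefficients that characters evaluate polynomially. *)
Inductive cspan : H -> Prop :=
| Cspan0 : cspan 0
| Cspan_x a n j u : lampoly a -> cspan u -> cspan (a * (x ^+ n * ce j) + u)
| Cspan_X a n j u : lampoly a -> cspan u -> cspan (a * (X ^+ n * ce j) + u).

Lemma cspan_x a n j : lampoly a -> cspan (a * (x ^+ n * ce j)).
Proof. by move=> ap; rewrite -[_ * _]addr0; apply: Cspan_x => //; exact: Cspan0. Qed.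

Lemma cspan_X a n j : lampoly a -> cspan (a * (X ^+ n * ce j)).
Proof. by move=> ap; rewrite -[_ * _]addr0; apply: Cspan_X => //; exact: Cspan0. Qed.

Lemma cspanD u v : cspan u -> cspan v -> cspan (u + v).
Proof.
elim=> [|a n j w ap _ IH|a n j w ap _ IH] sv; first by rewrite add0r.
- by rewrite -addrA; apply: Cspan_x => //; exact: IH.
- by rewrite -addrA; apply: Cspan_X => //; exact: IH.
Qed.

Lemma cspan_mul (y : H) : (forall n j, cspan (y * (x ^+ n * ce j))) ->
  (forall n j, cspan (y * (X ^+ n * ce j))) ->
  (forall a u, lampoly a -> cspan u -> cspan (a * u)) -> forall u, cspan u -> cspan (y * u).
Proof.
move=> Hx HX Ha u; elim=> [|a n j w ap _ IH|a n j w ap _ IH]; first by rewrite mulr0; exact: Cspan0.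
  by rewrite mulrDr mulrA -(ap.1 y) -mulrA; apply: cspanD => //; apply: Ha.
by rewrite mulrDr mulrA -(ap.1 y) -mulrA; apply: cspanD => //; apply: Ha.
Qed.

Lemma cspan_pa a u : lampoly a -> cspan u -> cspan (a * u).
Proof.
move=> ap; elim=> [|b n j w bp _ IH|b n j w bp _ IH]; first by rewrite mulr0; exact: Cspan0.
  by rewrite mulrDr mulrA; apply: Cspan_x => //; exact: lampolyM.
by rewrite mulrDr mulrA; apply: Cspan_X => //; exact: lampolyM.
Qed.

Lemma cspan_lin (a : C) u v : cspan u -> cspan v -> cspan (a *: u + v).
Proof.
move=> su sv; apply: cspanD => //; rewrite -[u]mul1r scalerAl.
by apply: cspan_pa => //; apply: lampolyZ; exact: lampoly1.
Qed.

Lemma cspan_t u : cspan u -> cspan (t * u).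
Proof.
apply: cspan_mul => [n j|n j|]; last exact: cspan_pa.
- rewrite mulrA (t_exp _ (cy_tx ax)) -scalerAl -mulrA -[t in t * ce j]expr1 (tXe zp ax) -scalerAr scalerA.
  by rewrite -[_ * ce j]mul1r scalerAl; apply: cspan_x; apply: lampolyZ; exact: lampoly1.
- rewrite mulrA (t_exp _ (cy_tX ax)) -scalerAl -mulrA -[t in t * ce j]expr1 (tXe zp ax) -scalerAr scalerA.
  by rewrite -[_ * ce j]mul1r scalerAl; apply: cspan_X; apply: lampolyZ; exact: lampoly1.
Qed.

Lemma cspan_xl u : cspan u -> cspan (x * u).
Proof.
apply: cspan_mul => [n j|[|n] j|]; last exact: cspan_pa.
- by rewrite mulrA -exprS -[_ * _]mul1r; apply: cspan_x; exact: lampoly1.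
- by rewrite expr0 mul1r -[_ * _]mul1r -{1}[x]expr1; apply: cspan_x; exact: lampoly1.
- by rewrite mulrA (x_Xn zp ax); apply: cspan_X; apply: lampolyB; [exact: lampoly_E|exact: lampoly_gam].
Qed.

Lemma cspan_Xl u : cspan u -> cspan (X * u).
Proof.
apply: cspan_mul => [[|n] j|n j|]; last exact: cspan_pa.
- by rewrite expr0 mul1r -[_ * _]mul1r -{1}[X]expr1; apply: cspan_X; exact: lampoly1.
- by rewrite mulrA (X_xn zp ax); apply: cspan_x; apply: lampolyB; [exact: lampoly_E|exact: lampoly_gam].
- by rewrite mulrA -exprS -[_ * _]mul1r; apply: cspan_X; exact: lampoly1.
Qed.

Lemma cspan_all h j : cspan (h * ce j).
Proof.
apply: (cy_ind ax (P := fun h => cspan (h * ce j))) => {h} [|a u v su sv|u su|u su|u su|k u su].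
- by have := cspan_x 0 j lampoly1; rewrite expr0 !mul1r.
- by rewrite mulrDl -scalerAl; exact: cspan_lin.
- by rewrite -mulrA; exact: cspan_t.
- by rewrite -mulrA; exact: cspan_xl.
- by rewrite -mulrA; exact: cspan_Xl.
- by rewrite -mulrA; apply: cspan_pa => //; exact: lampoly_c.
Qed.

Lemma lampoly_exp a n : lampoly a -> lampoly (a ^+ n).
Proof.
by move=> ap; elim: n => [|n IHn]; [rewrite expr0; exact: lampoly1|rewrite exprS; exact: lampolyM].
Qed.

Lemma natZ6_eq0 n : n%:R = 0 :> 'Z_6 -> exists m, n = (6 * m)%N.
Proof.
move=> /(congr1 val) /=; rewrite val_Zp_nat // => n6.
by exists (n %/ 6)%N; rewrite {1}(divn_eq n 6) n6 addn0 mulnC.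
Qed.

(** A power x^n or X^n shifts idempotents by n or -n and has a diagonal part only if 6 divides n,
    when it is a power of the central element x^6 or X^6. *)
Lemma cspan_diag i u : cspan u -> exists2 a, lampoly a & ce i * u * ce i = a * ce i.
Proof.
have key (y : H) (k : 'Z_6) a n j : lampoly a -> lampoly (y ^+ 6) -> y ^+ n * ce j = ce k * y ^+ n ->
    (k = j -> exists m, n = (6 * m)%N) ->
    exists2 b, lampoly b & ce i * (a * (y ^+ n * ce j)) * ce i = b * ce i.
  move=> ap y6 E kj; have -> : ce i * (a * (y ^+ n * ce j)) * ce i = a * (ce i * (y ^+ n * ce j) * ce i).
    by rewrite !mulrA (ap.1 (ce i)).
  rewrite -mulrA -[y ^+ n * ce j * ce i]mulrA (ce_ce zp ax).
  case: eqP => [ji|_]; last by exists 0; [exact: lampoly0|rewrite !mulr0 mul0r].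
  rewrite -ji E mulrA (ce_ce zp ax); case: eqP => [jk|_]; last by exists 0; [exact: lampoly0|rewrite mul0r mulr0 mul0r].
  have [m Em] := kj (esym jk); exists (a * (y ^+ 6) ^+ m); first by apply: lampolyM => //; exact: lampoly_exp.
  by rewrite -E Em exprM mulrA.
elim=> [|a n j w ap _ [b bp Eb]|a n j w ap _ [b bp Eb]].
- by exists 0; [exact: lampoly0|rewrite mulr0 !mul0r].
- have [|b' b'p Eb'] := key x (j + n%:R) a n j ap lampoly_x6 (xn_ce zp ax n j).
    by rewrite -[X in _ = X -> _]addr0 => /addrI; exact: natZ6_eq0.
  exists (1 *: b' + b); first exact: lampoly_lin.
  by rewrite mulrDr mulrDl Eb Eb' scale1r mulrDl.
- have [|b' b'p Eb'] := key X (j - n%:R) a n j ap lampoly_X6 (Xn_ce zp ax n j).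
    rewrite -[X in _ = X -> _]addr0 => /addrI /eqP; rewrite oppr_eq0 => /eqP.
    exact: natZ6_eq0.
  exists (1 *: b' + b); first exact: lampoly_lin.
  by rewrite mulrDr mulrDl Eb Eb' scale1r mulrDl.
Qed.

Lemma centr_diag s : centr s -> exists P : 'Z_6 -> H, forall j, lampoly (P j) /\ s * ce j = P j * ce j.
Proof.
move=> sC; have D j : exists a, lampoly a /\ s * ce j = a * ce j.
  have [a ap E] := cspan_diag j (cspan_all s j); exists a; split => //.
  rewrite -E (sC (ce j)) mulrA (ce_ce zp ax) eqxx -sC -mulrA.
  by rewrite (ce_ce zp ax) eqxx.
by exists (fun j => sval (cid (D j))) => j; exact: (svalP (cid (D j))).
Qed.

(** The j-th factor kills [cidem j], and the idempotents add up to 1. *)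
Lemma centr_prod s (P : 'Z_6 -> H) : centr s -> (forall j, centr (P j)) ->
  (forall j, s * ce j = P j * ce j) -> \prod_j (s - P j) = 0.
Proof.
move=> sC PC E; have dC j : centr (s - P j) by exact: centrB.
have K (l : seq 'Z_6) i : i \in l -> \prod_(j <- l) (s - P j) * ce i = 0.
  elim: l => [//|k l IHl]; rewrite in_cons big_cons => /orP[/eqP <-|/IHl IH]; last by rewrite -mulrA IH mulr0.
  by rewrite dC -mulrA mulrBl E subrr mulr0.
apply: (eq_ce (t := t) zp) => j; rewrite mul0r; apply: K; exact: mem_index_enum.
Qed.

Local Notation M := {ffun 'Z_6 -> C^o}.

Definition fourier (gv : 'Z_6 -> C) (k : 'Z_6) : C := 6%:R^-1 * \sum_(a < 6) (z ^- k) ^+ a * gv (a : 'I_6).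

(** A six-dimensional module on which t has each eigenvalue zeta^i once and x, X are weighted shifts
    in opposite directions. The weights are such that x X acts at i as e - gv i, and X^6 as
    rho^6. *)
Record is_shift (rho e : C) (gv : 'Z_6 -> C) (op : H -> M -> M) : Prop := IsShift {
  sh_lin : forall (a : C) (h h' : H) (phi : M), op (a *: h + h') phi = a *: op h phi + op h' phi;
  sh_1 : forall phi : M, op 1 phi = phi;
  sh_M : forall h h' phi, op (h * h') phi = op h (op h' phi);
  sh_Z : forall (h : H) (a : C) (phi : M), op h (a *: phi) = a *: op h phi;
  sh_t : forall phi, op t phi = [ffun i : 'Z_6 => z ^+ i *: phi i];
  sh_x : forall phi, op x phi = [ffun i : 'Z_6 => (rho^-1 * (e - gv i)) *: phi (i - 1)];
  sh_X : forall phi, op X phi = [ffun i : 'Z_6 => rho *: phi (i + 1)];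
  sh_c : forall (k : 'Z_6) (phi : M), op (c k) phi = fourier gv k *: phi }.

Lemma zVX (k b : nat) : (z ^- k) ^+ b = (z ^- b) ^+ k.
Proof. by rewrite -!exprVn -!exprM mulnC. Qed.

Lemma fourier_inv gv (a : 'Z_6) : \sum_(k : 'Z_6) (z ^+ a) ^+ k * fourier gv k = gv a.
Proof.
transitivity (\sum_(b : 'Z_6) (6%:R^-1 * gv b) * \sum_(k < 6) (z ^+ a * z ^- b) ^+ k).
  under [RHS]eq_bigr => b _ do rewrite mulr_sumr.
  rewrite exchange_big; apply: eq_bigr => k _; rewrite /fourier !mulr_sumr.
  by apply: eq_bigr => b _; rewrite exprMn -(zVX k b); ring.
rewrite (bigD1 a) //= [X in _ + X]big1 ?addr0 => [|b ba]; rewrite sum_pow6 ?exprMn ?exprVn ?z6X ?invr1 ?mulr1 //.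
  by rewrite mulfV ?zn0 // eqxx mulrAC mulVf ?mul1r // pnatr_eq0.
rewrite -(zetaN zp) -(zetaD zp) (_ : (z ^+ (a - b)%R == 1) = false) ?mulr0 //.
by apply/negbTE; apply: contra_neq ba => /(zeta_eq1 zp)/eqP; rewrite subr_eq0 => /eqP.
Qed.

Section Shift.
Variables (rho e : C) (gv : 'Z_6 -> C) (op : H -> M -> M).
Hypothesis rho0 : rho != 0.
Hypothesis sh : is_shift rho e gv op.

Definition dlt (j : 'Z_6) : M := [ffun i => (i == j)%:R].

Lemma sh_0 phi : op 0 phi = 0.
Proof.
have := sh_lin sh 1 0 0 phi; rewrite scaler0 addr0 scale1r => E.
by apply: (addrI (op 0 phi)); rewrite addr0 -E.
Qed.

Lemma sh_scale a h phi : op (a *: h) phi = a *: op h phi.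
Proof. by rewrite -[_ *: h]addr0 (sh_lin sh) sh_0 addr0. Qed.

Lemma sh_D h h' phi : op (h + h') phi = op h phi + op h' phi.
Proof. by rewrite -[h]scale1r (sh_lin sh) !scale1r. Qed.

Lemma sh_sum (I : Type) (r : seq I) (F : I -> H) phi : op (\sum_(i <- r) F i) phi = \sum_(i <- r) op (F i) phi.
Proof. exact: (big_morph (op^~ phi) (fun h h' => sh_D h h' phi) (sh_0 phi)). Qed.

Lemma sh_te n phi : op (t ^+ n) phi = [ffun i : 'Z_6 => (z ^+ i) ^+ n *: phi i].
Proof.
elim: n => [|n IHn]; first by rewrite (sh_1 sh); apply/ffunP=> i; rewrite ffunE expr0 scale1r.
by rewrite exprS (sh_M sh) IHn (sh_t sh); apply/ffunP=> i; rewrite !ffunE scalerA exprS.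
Qed.

Lemma sh_ce j phi : op (ce j) phi = [ffun i : 'Z_6 => (i == j)%:R *: phi i].
Proof.
rewrite /cidem sh_scale sh_sum; apply/ffunP=> i; rewrite !ffunE sum_ffunE.
have T (k : 'I_6) : op ((z ^- j *: t) ^+ k) phi i = (z ^- j * z ^+ i) ^+ k *: phi i.
  by rewrite exprZn sh_scale sh_te !ffunE scalerA exprMn.
under eq_bigr => k _ do rewrite T.
rewrite -scaler_suml sum_pow6; last by rewrite exprMn exprVn !z6X // invr1 mulr1.
rewrite -(zetaN zp) -(zetaD zp) scalerA.
have -> : (z ^+ (- j + i)%R == 1) = (i == j).
  apply/eqP/eqP=> [/(zeta_eq1 zp)/eqP|->]; last by rewrite addNr.
  by rewrite addrC subr_eq0 => /eqP.
by case: eqP => _; rewrite ?mulr0 ?scale0r // mulVf ?pnatr_eq0.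
Qed.

Definition shift_chi (h : H) : C := op h (dlt 0) 0.

(** Commuting with the idempotents makes h diagonal; commuting with X, a shift with nonzero weight
    [rho], makes the diagonal constant. *)
Lemma sh_delta h : centr h -> forall j, op h (dlt j) = shift_chi h *: dlt j.
Proof.
move=> hC j.
have dE k : op (ce k) (dlt k) = dlt k.
  by rewrite sh_ce; apply/ffunP=> i; rewrite !ffunE; case: eqP => _; rewrite ?scale1r ?scale0r.
have diag k : op h (dlt k) = op h (dlt k) k *: dlt k.
  rewrite -{1}dE -(sh_M sh) hC (sh_M sh) sh_ce; apply/ffunP=> i; rewrite !ffunE.
  by case: eqP => [->|_]; [rewrite scale1r; exact/esym/mulr1|rewrite scale0r; exact/esym/mulr0].
have step k : op h (dlt k) k = op h (dlt (k + 1)) (k + 1).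
  have XE : op X (dlt (k + 1)) = rho *: dlt k.
    by rewrite (sh_X sh); apply/ffunP=> i; rewrite !ffunE (inj_eq (addIr 1)).
  have : op (h * X) (dlt (k + 1)) k = op (X * h) (dlt (k + 1)) k by rewrite hC.
  rewrite !(sh_M sh) XE (sh_Z sh) ffunE (diag (k + 1)) (sh_Z sh) XE !ffunE eqxx.
  move=> E; apply: (mulfI rho0); transitivity (op h (dlt (k + 1)) (k + 1) * (rho * 1) : C); first exact: E.
  rewrite eqxx mulr1 mulrC; congr (_ * _); exact/esym/mulr1.
have all (n : nat) : op h (dlt n%:R) n%:R = shift_chi h.
  by elim: n => // n IHn; rewrite -natr1 -step.
by rewrite diag -[j]natr_Zp all.
Qed.

Lemma shift_lin a s u : shift_chi (a *: s + u) = a * shift_chi s + shift_chi u.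
Proof. by rewrite /shift_chi (sh_lin sh) !ffunE. Qed.

Lemma shift_M s u : centr s -> centr u -> shift_chi (s * u) = shift_chi s * shift_chi u.
Proof.
move=> sC uC; rewrite {1}/shift_chi (sh_M sh) (sh_delta uC) (sh_Z sh) (sh_delta sC) !ffunE eqxx.
by rewrite [RHS]mulrC; congr (_ * _); exact: mulr1.
Qed.

Lemma shift_Z a s : shift_chi (a *: s) = a * shift_chi s.
Proof. by rewrite /shift_chi sh_scale ffunE. Qed.

Lemma shift_c k : shift_chi (c k) = fourier gv k.
Proof. by rewrite /shift_chi (sh_c sh) !ffunE eqxx; exact: mulr1. Qed.

Lemma shift_sum (I : Type) (r : seq I) (F : I -> H) : shift_chi (\sum_(i <- r) F i) = \sum_(i <- r) shift_chi (F i).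
Proof. by rewrite /shift_chi sh_sum sum_ffunE. Qed.

Lemma shift_gam a : shift_chi (gam a) = gv a.
Proof.
rewrite /cgam shift_sum -[RHS]fourier_inv; apply: eq_bigr => k _.
by rewrite shift_Z shift_c.
Qed.

Lemma sh_Xn n phi : op (X ^+ n) phi = [ffun i : 'Z_6 => rho ^+ n *: phi (i + n%:R)].
Proof.
elim: n => [|n IHn].
  by rewrite (sh_1 sh); apply/ffunP=> i; rewrite ffunE scale1r addr0.
rewrite exprS (sh_M sh) IHn (sh_X sh); apply/ffunP=> i.
by rewrite !ffunE scalerA -exprS -addrA mulrS.
Qed.

Lemma shift_X6 : shift_chi (X ^+ 6) = rho ^+ 6.
Proof.
rewrite /shift_chi sh_Xn !ffunE (_ : 0 + 6%:R == 0 :> 'Z_6) //; exact: mulr1.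
Qed.

Lemma shift_eu : shift_chi cE = e.
Proof.
have E0 : shift_chi (gam 0) = shift_chi (\sum_(k : 'Z_6) c k * t ^+ k).
  rewrite /cgam !shift_sum; apply: eq_bigr => k _; rewrite shift_Z expr1n mul1r.
  by rewrite /shift_chi (sh_M sh) !(sh_c sh) sh_te !ffunE expr1n scale1r.
rewrite /ceul -[x * X]scale1r shift_lin -E0 shift_gam mul1r.
rewrite /shift_chi (sh_M sh) (sh_X sh) (sh_x sh) !ffunE subrK eqxx scalerA mulrAC.
rewrite mulVf // mul1r; rewrite -[RHS](subrK (gv 0)); congr (_ + _); exact: mulr1.
Qed.

End Shift.

(** The sum of [gv] is six times the parameter at k = 0, which must vanish because the identity is
    not a reflection. *)
Definition has_shifts := forall rho e gv, rho != 0 -> \sum_(a : 'Z_6) gv a = 0 -> exists op, is_shift rho e gv op.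
Hypothesis shifts : has_shifts.

Lemma lamv_sum A B : \sum_(a : 'Z_6) lamv A B (a : 'I_6) = 0.
Proof. by rewrite !big_ord_recl big_ord0 /lamv /=; ring. Qed.

Lemma cyc_chart_op b v : chart b v -> exists rho op, [/\ rho != 0,
  is_shift rho (v (inord 2)) (fun a => lamv (b (inord 0)) (b (inord 1)) a) op, cyc_char (shift_chi op),
  prm (shift_chi op) = b & gn (shift_chi op) = v].
Proof.
move=> bv; have [R0 _] := bv; pose rho := 6.-root (v (inord 1)).
have r6 : rho ^+ 6 = v (inord 1) by rewrite rootCK.
have r0 : rho != 0 by apply: contra_neq R0 => r0; rewrite -r6 r0 expr0n.
set gv := fun a : 'Z_6 => lamv (b (inord 0)) (b (inord 1)) a.
have [op sh] := shifts (v (inord 2)) r0 (lamv_sum (b (inord 0)) (b (inord 1)) : \sum_a gv a = 0).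
have six : (6%:R : C) != 0 by rewrite pnatr_eq0.
have E0 : shift_chi op ca0 = b (inord 0).
  rewrite /ca0 (shift_Z sh) -[gam 0]scale1r (shift_lin sh) !(shift_gam sh) /gv /lamv /=.
  by field.
have E1 : shift_chi op ca1 = b (inord 1).
  rewrite /ca1 (shift_Z sh) -scaleN1r addrC (shift_lin sh) !(shift_gam sh) /gv /lamv /=.
  by field.
have cc : cyc_char (shift_chi op).
  split=> [a s u _ _||s u|a].
  - exact: (shift_lin sh).
  - by rewrite /shift_chi (sh_1 sh) ffunE eqxx.
  - exact: (shift_M r0 sh).
  - by rewrite (shift_gam sh) E0 E1.
have Eb : prm (shift_chi op) = b by exact: prmP.
have rel := cyc_rel cc; rewrite Eb in rel.
have G1 : gn (shift_chi op) (inord 1) = v (inord 1) by rewrite gn1 (shift_X6 sh).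
have G2 : gn (shift_chi op) (inord 2) = v (inord 2) by rewrite gn2 (shift_eu r0 sh).
exists rho, op; split=> //; apply: gnP; [|by rewrite (shift_X6 sh)|exact: (shift_eu r0 sh)].
rewrite -(gn0 (x ^+ 6) (X ^+ 6) cE); exact: (chart_r bv rel G1 G2).
Qed.

(* [s] acts as [P j] on the idempotent [ce j], so chi(s) is one of the chi(P j);
   these coincide on the shift modules, hence everywhere. *)
Lemma cyc_poly s : centr s -> exists p, forall chi, cyc_char chi -> chi s = ev (prm chi) (gn chi) p.
Proof.
move=> sC; have [P PE] := centr_diag sC.
have pP j : exists p, forall chi, cyc_char chi -> chi (P j) = ev (prm chi) (gn chi) p by case: (PE j) => -[_ pj] _.
have PC j : centr (P j) by case: (PE j) => -[].
pose p j := sval (cid (pP j)).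
have pE j chi : cyc_char chi -> chi (P j) = ev (prm chi) (gn chi) (p j) := svalP (cid (pP j)) chi.
exists (p 0) => chi cc.
have same j : chi (P j) = ev (prm chi) (gn chi) (p 0).
  rewrite pE //; have [|q Eq] := chart_vanish (@mev_sep C 2) (cs := csG2 'X_(inord 0) 'X_(inord 1)) (p := p j - p 0).
    move=> b v /cyc_chart_op [rho [op [r0 sh ccs Eb Ev]]].
    have E k : shift_chi op s = ev b v (p k).
      rewrite -{1}Eb -{1}Ev -pE // -[LHS]mulr1.
      have := congr1 (fun h => op h (dlt k) k) (proj2 (PE k)).
      rewrite /= !(sh_M sh) (sh_ce sh).
      have -> : [ffun i : 'Z_6 => (i == k)%:R *: dlt k i] = dlt k.
        by apply/ffunP=> i; rewrite !ffunE; case: eqP => _; rewrite ?scale1r ?scale0r.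
      rewrite (sh_delta r0 sh sC) (sh_delta r0 sh (PC k)) !ffunE eqxx => E.
      by transitivity (shift_chi op (P k) * 1); [exact: E|exact: mulr1].
    by rewrite rmorphB /= -!E subrr.
  by apply/eqP; rewrite -subr_eq0 -rmorphB Eq rmorphM /= (cyc_rel cc) mulr0.
have /(congr1 chi) := centr_prod sC PC (fun j => proj2 (PE j)).
have [_ ->] := cc_prod cc (index_enum 'Z_6) (fun j => centrB sC (PC j)).
rewrite (cc_0 cc) => /eqP; rewrite prodf_seq_eq0 => /hasP[j _ /=].
by rewrite (cc_B cc) // same subr_eq0 => /eqP.
Qed.

End CyclicCharacters.

(** * The cyclic group of order 6 as a reflection group, and its Calogero-Moser points *)

Section CyclicGroup.
Variables (C : numClosedFieldType) (z : C) (zp : 6.-primitive_root z).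

Definition cyc_mx (k : 'Z_6) : 'M[C]_1 := (z ^+ k)%:M.

Lemma cyc_mx_repr : mx_repr [set: 'Z_6] cyc_mx.
Proof.
split=> [|k l _ _]; first by rewrite /cyc_mx expr0.
by rewrite /cyc_mx -scalar_mxM -(zetaD zp).
Qed.

Definition cyc_repr := MxRepresentation cyc_mx_repr.

Lemma scalar1_inj (a b : C) : a%:M = b%:M :> 'M[C]_1 -> a = b.
Proof. by move/matrixP/(_ 0 0); rewrite !mxE eqxx !mulr1n. Qed.

Lemma cyc_faithful : mx_faithful cyc_repr.
Proof.
apply/fintype.subsetP=> k; rewrite inE => /andP[_ /eqP].
rewrite mul1mx /= /cyc_mx => /scalar1_inj /(zeta_eq1 zp) ->.
exact/set1P.
Qed.

Lemma cyc_is_refl (k : 'Z_6) : is_refl cyc_repr k = (k != 0).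
Proof.
rewrite /is_refl /= /cyc_mx -raddfB /=.
have [->|k0] := eqVneq k 0; first by rewrite expr0 subrr raddf0 mxrank0.
rewrite mxrank_unit ?eqxx // unitmxE det_scalar1 unitfE subr_eq0.
by apply: contra_neq k0; exact: zeta_eq1.
Qed.

Lemma cyc_gen : <<[set s | is_refl cyc_repr s]>>%g = [set: 'Z_6].
Proof.
apply/eqP; rewrite finset.eqEsubset finset.subsetT /=; apply/fintype.subsetP=> k _.
have [->|k0] := eqVneq k 0; first exact: group1.
by apply: mem_gen; rewrite inE cyc_is_refl.
Qed.

Lemma cyc_rootP s : is_refl cyc_repr s -> forall v : 'cV[C]_1,
  cyc_repr s *m v = v <-> (1%:M : 'rV[C]_1) *m v = 0.
Proof.
rewrite cyc_is_refl => s0 v; rewrite mul1mx /= /cyc_mx mul_scalar_mx.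
split=> [/eqP|->]; last by rewrite scaler0.
rewrite -subr_eq0 -{2}[v]scale1r -scalerBl scaler_eq0 subr_eq0.
by case/orP=> [/eqP /(zeta_eq1 zp)/eqP|/eqP //]; rewrite (negPf s0).
Qed.

Lemma cyc_corootP s : is_refl cyc_repr s -> forall v : 'cV[C]_1,
  (exists a, v = a *: (1%:M : 'cV[C]_1)) <-> (exists u, v = cyc_repr s *m u - u).
Proof.
rewrite cyc_is_refl => s0 v; rewrite /= /cyc_mx; split=> _; last first.
  by exists (v 0 0); rewrite scalemx1 -mx11_scalar.
exists ((z ^+ s - 1)^-1 *: v).
rewrite mul_scalar_mx -{2}[_ *: v]scale1r -scalerBl scalerA mulfV ?scale1r // subr_eq0.
by apply: contra_neq s0; exact: zeta_eq1.
Qed.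

Definition cyc6 : refl_group C :=
  ReflGroup cyc_faithful cyc_gen cyc_rootP cyc_corootP.

Local Notation W := cyc6.
Local Notation H := (cher W).

Definition ct : H := hgrp (W := W) (1%R : 'Z_6).
Definition cx : H := hvec (W := W) 1%:M.
Definition cX : H := hcov (W := W) 1%:M.
(* The value at k = 0, which is not a reflection, is 0. *)
Definition cc (k : 'Z_6) : H :=
   if insub k : option (Ref W) is Some s then hpar s else 0.

Lemma cc_val (s : Ref W) : cc (val s) = hpar s.
Proof. by rewrite /cc valK. Qed.

Lemma cc0 : cc 0 = 0.
Proof. by rewrite /cc insubF // cyc_is_refl eqxx. Qed.

Lemma sum_Ref (V : zmodType) (F : 'Z_6 -> V) : F 0 = 0 ->
  \sum_(s : Ref W) F (val s) = \sum_(k : 'Z_6) F k.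
Proof.
move=> F0; rewrite [RHS](bigID (fun k => is_refl cyc_repr k)) /= [X in _ + X]big1 ?addr0 => [|k]; last first.
  by rewrite cyc_is_refl negbK => /eqP ->.
rewrite [RHS](reindex_omap (val : Ref W -> 'Z_6) insub) => [|k Pk]; last by rewrite insubT.
by apply: eq_bigl => s; rewrite valK eqxx (valP s).
Qed.

Lemma ctX n : ct ^+ n = hgrp (W := W) (n%:R : 'Z_6).
Proof.
elim: n => [|n IHn]; first by rewrite expr0 (hgrp1 W).
rewrite exprS IHn -[LHS](hgrpM (W := W) (1%R : 'Z_6) (n%:R : 'Z_6)).
by rewrite mulrS.
Qed.

Lemma hgrp_ct (k : 'Z_6) : hgrp (W := W) k = ct ^+ k.
Proof. by rewrite ctX natr_Zp. Qed.

Lemma hvec_cx (u : 'cV[C]_1) : hvec (W := W) u = u 0 0 *: cx.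
Proof.
have h0 : hvec (W := W) 0 = 0.
  have /(congr1 (fun h => h - hvec 0)) := hvec_lin (W := W) 1 0 0.
  by rewrite scaler0 add0r scale1r subrr addrK.
have {1}-> : u = u 0 0 *: 1%:M + 0 by rewrite addr0 scalemx1 -mx11_scalar.
by rewrite (hvec_lin (W := W)) h0 addr0.
Qed.

Lemma hcov_cX (u : 'rV[C]_1) : hcov (W := W) u = u 0 0 *: cX.
Proof.
have h0 : hcov (W := W) 0 = 0.
  have /(congr1 (fun h => h - hcov 0)) := hcov_lin (W := W) 1 0 0.
  by rewrite scaler0 add0r scale1r subrr addrK.
have {1}-> : u = u 0 0 *: 1%:M + 0 by rewrite addr0 scalemx1 -mx11_scalar.
by rewrite (hcov_lin (W := W)) h0 addr0.
Qed.

Lemma cyc_comm_coef (u : 'cV[C]_1) (U : 'rV[C]_1) (k : 'Z_6) :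
  Defs.comm_coef (W := W) u U k = (z ^+ k - 1) * (u 0 0 * U 0 0).
Proof.
rewrite /Defs.comm_coef /pairing /= mul1mx mulmx1 mul1mx /cyc_mx det_scalar1.
by rewrite [(1%:M : 'M[C]_1) 0 0]mxE eqxx divr1.
Qed.

Lemma cher_cyc : is_cyc z ct cx cX cc.
Proof.
split.
- by rewrite ctX -(hgrp1 W); congr (hgrp _); exact: val_inj.
- rewrite /ct /cx (hgrp_vec (W := W)) /= hvec_cx mulmx1 mxE eqxx mulr1n.
  by rewrite -scalerAl expr1.
- rewrite /ct /cX (hgrp_cov (W := W)) /= hcov_cX mul1mx mxE eqxx mulr1n -scalerAl.
  by congr (_ *: _); exact: (zetaN zp 1).
- by move=> k h; rewrite /cc; case: insub => [s|]; rewrite ?hpar_comm // mul0r mulr0.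
- rewrite /cx /cX (hvec_cov (W := W)); congr (_ + _).
  rewrite -(sum_Ref (F := fun k => (z ^+ k - 1) *: (cc k * ct ^+ k))); last by rewrite cc0 mul0r scaler0.
  apply: eq_bigr => s _; rewrite cyc_comm_coef cc_val hgrp_ct [(1%:M : 'M[C]_1) 0 0]mxE eqxx.
  by rewrite !mulr1.
move=> P P1 Plin Pt Px PX Pc; apply: (cher_ind P1 Plin) => -[s|u|U|w] h Ph.
- by have := Pc (val s) h Ph; rewrite cc_val.
- have -> : (pgen (cher_rel (W := W)) (Vec u) : H) = u 0 0 *: cx := hvec_cx u.
  have P0 : P 0 by rewrite -(subrr 1) -scaleN1r addrC; apply: (Plin).
  by rewrite -scalerAl -[_ *: _]addr0; apply: (Plin) => //; exact: Px.
- have -> : (pgen (cher_rel (W := W)) (Cov U) : H) = U 0 0 *: cX := hcov_cX U.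
  have P0 : P 0 by rewrite -(subrr 1) -scaleN1r addrC; apply: (Plin).
  by rewrite -scalerAl -[_ *: _]addr0; apply: (Plin) => //; exact: PX.
- have -> : (pgen (cher_rel (W := W)) (Grp w) : H) = ct ^+ (w : 'Z_6) := hgrp_ct w.
  elim: (nat_of_ord _) => [|n IHn]; first by rewrite expr0 mul1r.
  by rewrite exprS -mulrA; exact: Pt.
Qed.

Section ShiftExists.
Variables (rho e : C) (gv : 'Z_6 -> C).
Hypotheses (rho0 : rho != 0) (gv0 : \sum_(a : 'Z_6) gv a = 0).
Local Notation M := {ffun 'Z_6 -> C^o}.

Definition shift_gen (x : cher_gen W) : M -> M :=
  match x with
  | Par s => fun phi => fourier z gv (val s) *: phi
  | Vec u => fun phi => [ffun i : 'Z_6 => (u 0 0 * (rho^-1 * (e - gv i))) *: phi (i - 1)]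
  | Cov U => fun phi => [ffun i : 'Z_6 => (U 0 0 * rho) *: phi (i + 1)]
  | Grp w => fun phi => [ffun i : 'Z_6 => (z ^+ i) ^+ (w : 'Z_6) *: phi i]
  end.

Lemma shift_gen_lin x : linear (shift_gen x).
Proof.
case: x => [s|u|U|w] a f h /=; first by rewrite scalerDr !scalerA mulrC.
all: by apply/ffunP=> i; rewrite !ffunE scalerDr !scalerA [_ * a]mulrC.
Qed.

Lemma fourier0 : fourier z gv 0 = 0.
Proof.
rewrite /fourier [X in _ * X](_ : _ = 0) ?mulr0 // -[RHS]gv0; apply: eq_bigr => a _.
by rewrite expr0 invr1 expr1n mul1r.
Qed.

Lemma shift_gen_rel t t' : cher_rel (W := W) t t' -> expr_op shift_gen t =1 expr_op shift_gen t'.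
Proof.
case=> [a x y|a x y||w w'|w x|w x|s s' w sw|s x|x y|x y|x y] phi /=.
- by apply/ffunP=> i; rewrite !ffunE !mxE scalerA -scalerDl; congr (_ *: _); ring.
- by apply/ffunP=> i; rewrite !ffunE !mxE scalerA -scalerDl; congr (_ *: _); ring.
- by apply/ffunP=> i; rewrite !ffunE expr0 !scale1r.
- apply/ffunP=> i; rewrite !ffunE scalerA -exprD; congr (_ *: _).
  by rewrite -!exprM; apply: (zeta_mod zp); rewrite modnMmr.
- apply/ffunP=> i; rewrite !ffunE mul_scalar_mx mxE !scalerA; congr (_ *: _).
  have -> : z ^+ i = z ^+ (i - 1)%R * z by rewrite -{3}[z]expr1 -(zetaD zp _ 1) subrK.
  by rewrite exprMn; ring.
- apply/ffunP=> i; rewrite !ffunE mul_mx_scalar mxE !scalerA; congr (_ *: _).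
  have -> : z ^+ (w^-1)%g = z ^- w := zetaN zp w.
  have -> : z ^+ (i + 1)%R = z ^+ i * z by rewrite -{3}[z]expr1 -(zetaD zp _ 1).
  rewrite exprMn; have := zn0 zp w; move: (z ^+ w) ((z ^+ i) ^+ w) => zw zi zw0.
  by field.
- have E (a b : 'Z_6) : - b + (a + b) = a by rewrite addrC addrK.
  by rewrite sw conjgE; exact: esym (congr1 (fun k : 'Z_6 => fourier z gv k *: phi) (E (val s) w)).
- have /= := shift_gen_lin x (fourier z gv (val s)) phi 0; rewrite addr0 => ->.
  have := shift_gen_lin x 1 0 0; rewrite scaler0 scale1r addr0 => E.
  by rewrite (_ : shift_gen x 0 = 0) ?addr0 //; apply: (addIr (shift_gen x 0)); rewrite add0r -E.
- by apply/ffunP=> i; rewrite !ffunE !scalerA; congr (_ *: _); ring.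
- by apply/ffunP=> i; rewrite !ffunE !scalerA; congr (_ *: _); ring.
- rewrite (big_morph (fun t => expr_op shift_gen t phi) (id1 := 0) (op1 := +%R)) //=; last first.
    by rewrite scale0r.
  apply/ffunP=> i; rewrite !ffunE sum_ffunE.
  pose F (k : 'Z_6) : C^o := ((z ^+ k - 1) * (x 0 0 * y 0 0) * (fourier z gv k * (z ^+ i) ^+ k)) *: phi i.
  have T (s : Ref W) : (Defs.comm_coef (W := W) x y (val s) *:
     (fourier z gv (val s) *: [ffun j : 'Z_6 => (z ^+ j) ^+ (val s : 'Z_6) *: phi j])) i = F (val s).
    by rewrite /F !ffunE !scalerA cyc_comm_coef !mulrA.
  rewrite (eq_bigr _ (fun s _ => T s)) sum_Ref; last by rewrite /F expr0 subrr !mul0r scale0r.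
  rewrite /F -scaler_suml subrK addrK !scalerA -scalerDl; congr (_ *: _).
  (* Fourier inversion at i + 1 and at i: the commutator acts as the difference of two consecutive
     values of [gv]. *)
  have -> : \sum_(k : 'Z_6) (z ^+ k - 1) * (x 0 0 * y 0 0) * (fourier z gv k * (z ^+ i) ^+ k) =
      x 0 0 * y 0 0 * (gv (i + 1) - gv i).
    rewrite -!(fourier_inv zp gv) -sumrB mulr_sumr; apply: eq_bigr => k _.
    have -> : z ^+ (i + 1)%R = z ^+ i * z by rewrite -{3}[z]expr1 -(zetaD zp _ 1).
    by rewrite exprMn; ring.
  by field.
Qed.

Lemma shift_exists : exists op, is_shift z ct cx cX cc rho e gv op.
Proof.
have gl x : linear (shift_gen x) := shift_gen_lin x.
have gr := shift_gen_rel.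
exists (fun h => pres_op shift_gen (h : H)); split.
- by move=> a h h' phi; rewrite (pres_opD gl gr) (pres_opZ gl gr).
- by move=> phi; exact: (pres_op1 gl gr).
- by move=> h h' phi; exact: (pres_opM gl gr).
- move=> h a phi; have := pres_op_lin gl h a phi 0.
  have := pres_op_lin gl h 1 0 0; rewrite scaler0 scale1r addr0 => E.
  by rewrite addr0 => ->; rewrite (_ : pres_op _ h 0 = 0) ?addr0 //; apply: (addIr (pres_op shift_gen h 0)); rewrite add0r -E.
- by move=> phi; rewrite (pres_op_gen gl gr) /=; apply/ffunP=> i; rewrite !ffunE.
- by move=> phi; rewrite (pres_op_gen gl gr) /=; apply/ffunP=> i; rewrite !ffunE mxE eqxx mul1r.
- by move=> phi; rewrite (pres_op_gen gl gr) /=; apply/ffunP=> i; rewrite !ffunE mxE eqxx mul1r.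
- move=> k phi; rewrite /cc; case: insubP => [s _ <-|]; first by rewrite (pres_op_gen gl gr).
  rewrite cyc_is_refl negbK => /eqP ->; rewrite fourier0 scale0r.
  by have := pres_opZ gl gr 0 0 phi; rewrite !scale0r.
Qed.

End ShiftExists.

End CyclicGroup.

Section CyclicPoints.
Local Open Scope classical_set_scope.
Variables (C : numClosedFieldType) (z : C) (zp : 6.-primitive_root z).
Local Notation W' := (cyc6 zp).
Local Notation Z' := (centre W').
Local Notation ax := (cher_cyc zp).
Local Notation cc := (@cc C z zp).
Local Notation cyc_char := (cyc_char z cc).
Local Notation ev := (ev2 (@mev C 2)).

Lemma cher_shifts : has_shifts z (ct zp) (cx zp) (cX zp) cc.
Proof. by move=> rho e gv rho0 gv0; exact: shift_exists. Qed.

Definition zgam (a : 'Z_6) : Z' := Sub (cgam z cc a) (mem_centre (gam_centr ax a)).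
Definition zca0 : Z' := Sub (ca0 z cc) (mem_centre (ca0_centr ax)).
Definition zca1 : Z' := Sub (ca1 z cc) (mem_centre (ca1_centr ax)).
Definition zcr : Z' := Sub (cx zp ^+ 6) (mem_centre (x6_centr zp ax)).
Definition zcR : Z' := Sub (cX zp ^+ 6) (mem_centre (X6_centr zp ax)).
Definition zcE : Z' := Sub (ceul (ct zp) (cx zp) (cX zp) cc) (mem_centre (cE_centr zp ax)).

Definition cpts (chi : Z' -> C) : Prop := (scalar chi /\ GRing.monoid_morphism chi) /\
  forall a : 'Z_6, chi (zgam a) = lamv (chi zca0) (chi zca1) a.

Local Notation prm := (chi_params zca0 zca1).
Local Notation gn := (chi_gens zcr zcR zcE).

Lemma cyc_ext chi : cpts chi -> cyc_char (ext chi).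
Proof.
case=> -[chiL [chi1 chiM]] chiF; split=> [a s u /centr_val[s' <-] /centr_val[u' <-]||
  s u /centr_val[s' <-] /centr_val[u' <-]|a].
- by rewrite -val_linP !ext_val chiL.
- by rewrite -val_1 ext_val chi1.
- by rewrite -val_M !ext_val chiM.
- by rewrite -[cgam z cc a]/(val (zgam a)) -[ca0 z cc]/(val zca0) -[ca1 z cc]/(val zca1) !ext_val chiF.
Qed.

Lemma cyc_res chi : cyc_char chi -> cpts (chi \o val).
Proof.
move=> cch; split=> [|a]; last exact: (cc_lam cch a).
split=> [a s t|].
  have E : val (a *: (s : Z') + t) = a *: val s + val t by rewrite linearP.
  exact: etrans (congr1 chi E) (cc_lin cch a (val_centr s) (val_centr t)).
split=> [|s t]; first exact: etrans (congr1 chi (val_1 W')) (cc_1 cch).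
exact: etrans (congr1 chi (val_M s t)) (cc_M cch (val_centr s) (val_centr t)).
Qed.

Lemma cpts_char chi : cpts chi -> scalar chi /\ GRing.monoid_morphism chi.
Proof. by case. Qed.

Lemma prm_ext chi : chi_params (ca0 z cc) (ca1 z cc) (ext chi) = prm chi.
Proof. by apply: prmP; rewrite ?prm0 ?prm1 -?ext_val. Qed.

Lemma gn_ext chi : chi_gens (cx zp ^+ 6) (cX zp ^+ 6) (ceul (ct zp) (cx zp) (cX zp) cc) (ext chi) = gn chi.
Proof. by apply: gnP; rewrite ?gn0 ?gn1 ?gn2 -?ext_val. Qed.

Lemma cpts_rel chi : cpts chi -> ev (prm chi) (gn chi) (relG2 C) = 0.
Proof. by move=> /cyc_ext cch; have := cyc_rel zp ax cch; rewrite prm_ext gn_ext. Qed.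

Lemma cpts_poly (s : Z') : exists p, forall chi, cpts chi -> chi s = ev (prm chi) (gn chi) p.
Proof.
have [p Ep] := cyc_poly zp ax cher_shifts (val_centr s).
by exists p => chi /cyc_ext cch; rewrite -ext_val Ep // prm_ext gn_ext.
Qed.

Lemma gn_val (h : cher W' -> C) :
  gn (h \o val) = chi_gens (cx zp ^+ 6) (cX zp ^+ 6) (ceul (ct zp) (cx zp) (cX zp) cc) h.
Proof.
have T0 : (h \o val) zcr = h (cx zp ^+ 6) by [].
have T1 : (h \o val) zcR = h (cX zp ^+ 6) by [].
have T2 : (h \o val) zcE = h (ceul (ct zp) (cx zp) (cX zp) cc) by [].
by apply: gnP; [rewrite gn0; exact: T0|rewrite gn1; exact: T1|rewrite gn2; exact: T2].
Qed.

Lemma cpts_chart b v : on_chart (@mev C 2) (csG2 'X_(inord 0) 'X_(inord 1)) b v ->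
  exists2 chi, cpts chi & prm chi = b /\ gn chi = v.
Proof.
move=> /(cyc_chart_op zp ax cher_shifts) [rho [op [_ _ cch <- <-]]].
exists (shift_chi op \o val); [exact: cyc_res|split].
  by apply: prmP; rewrite ?prm0 ?prm1.
exact: gn_val.
Qed.

(** Central elements lifting [lamv]: the condition in [cpts] becomes an equality of values at two
    central elements, hence a closed one. *)
Definition zlamv (a : nat) : Z' :=
  nth 0 [:: 3 *: (zca0 + zca1); - (3 *: (zca0 + zca1)); 3 *: (zca0 - zca1); - (3 *: (zca0 - zca1))] a.

Lemma chi_lamv (chi : Z' -> C) a : scalar chi -> chi (zlamv a) = lamv (chi zca0) (chi zca1) a.
Proof.
move=> chiL; have chi0 : chi 0 = 0 by have := chiL (-1) 0 0; rewrite scaler0 addr0 mulN1r addNr.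
have chiZ k s : chi (k *: s) = k * chi s by rewrite -[_ *: _]addr0 chiL chi0 addr0.
have chiD s s' : chi (s + s') = chi s + chi s' by rewrite -[s]scale1r chiL mul1r scale1r.
have chiN s : chi (- s) = - chi s by rewrite -scaleN1r chiZ mulN1r.
by case: a => [|[|[|[|a]]]]; rewrite /zlamv /lamv /= ?nth_nil ?chiN ?chiZ ?chiD ?chiN ?chi0.
Qed.

Lemma cpts_closed chi : scalar chi -> GRing.monoid_morphism chi ->
  (forall s s', (forall chi', cpts chi' -> chi' s = chi' s') -> chi s = chi s') -> cpts chi.
Proof.
move=> chiL chiM chiE; split=> // a; rewrite -chi_lamv //; apply: chiE => chi' [[chiL' _] ->].
by rewrite chi_lamv.
Qed.

End CyclicPoints.

(** * Components of the fixed point variety *)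

Section Components.
Local Open Scope classical_set_scope.
Variables (C : numClosedFieldType) (z : C) (zp : 6.-primitive_root z).
Local Notation W := (G2 zp).
Local Notation X := (cm_fixed W 6).
Local Notation pts := (vpts (v := X)).
Local Notation prm := (chi_params (zA zp) (zB zp)).
Local Notation gn := (chi_gens (zr zp) (zR zp) (zE zp)).
Local Notation ev := (ev2 (@mev C 2)).

Lemma pts_irreducible : zariski_irreducible pts.
Proof.
have fch := fixed_gen_chart zp.
split.
  have [|chi hchi _] := fch (fun=> 0) (pt3 0 1 0).
    (* A point exists already at parameters zero, with r = eu = 0 and R = 1. *)
    split; first by rewrite pt3_1 oner_neq0.
    rewrite -/(relG2 C) ev2_relG2 !mevX pt3_0 pt3_1 pt3_2; ring.
  by exists chi.
move=> F1 F2 [E1 E1r ->] [E2 E2r ->] cover; apply: contrapT => /not_orP[N1 N2].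
have pick (E : set (vtype X -> C)) : (forall f, E f -> regular f) ->
    ~ (pts `<=` [set x | vpts x /\ forall f, E f -> f x = 0]) ->
    exists p, (exists f, E f /\ forall chi, pts chi -> f chi = ev (prm chi) (gn chi) p) /\
      ~ exists q, p = q * relG2 C.
  move=> Er; apply: contra_notP => np chi hchi; split=> // f Ef.
  have [p Ep] := (regularE f).1 (Er f Ef).
  rewrite Ep //; apply: contrapT => nz; apply: np; exists p; split; first by exists f.
  move=> [q Eq]; apply: nz; rewrite Eq rmorphM /= fixed_rel ?mulr0 //.
have [p1 [[f1 [Ef1 Ep1]] n1]] := pick E1 E1r N1.
have [p2 [[f2 [Ef2 Ep2]] n2]] := pick E2 E2r N2.
have [|//|//] := chart_irreducible (@mev_sep C 2) (cs := csG2 'X_(inord 0) 'X_(inord 1)) (p1 := p1) (p2 := p2).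
move=> b v /fch [chi hchi [<- <-]]; rewrite rmorphM /= -Ep1 // -Ep2 //.
by case: (cover chi hchi) => -[_ h]; [rewrite (h f1 Ef1) mul0r|rewrite (h f2 Ef2) mulr0].
Qed.

Lemma component_all (F : set (vtype X)) : irreducible_component F -> F = pts.
Proof.
case=> Fc Fi Fmax; apply/esym/Fmax; last 1 first.
- by case: Fc => E _ -> x [].
- exists set0 => //; by apply/seteqP; split=> [x hx|x []//]; split.
- exact: pts_irreducible.
Qed.

Local Notation W' := (cyc6 zp).
Local Notation Z' := (centre W').
Local Notation prm' := (chi_params (zca0 zp) (zca1 zp)).
Local Notation gn' := (chi_gens (zcr zp) (zcR zp) (zcE zp)).
Local Notation s0 := (refl_s zp 0).
Local Notation s1 := (refl_s zp 1).

(** The inverse Fourier transform of the roots of the relation, viewed as polynomials in eu; this is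
    the cyclic parameter whose [cgam] are those roots. *)
Definition lam_fun (c : {ffun Ref W -> C^o}) : {ffun Ref W' -> C^o} :=
  [ffun s => @fourier C z (fun a => @lamv C (c s0) (c s1) a) (val s)].

Lemma lamv_lin (k A B A' B' : C) a : lamv (k * A + A') (k * B + B') a = k * lamv A B a + lamv A' B' a.
Proof. by case: a => [|[|[|[|a]]]]; rewrite /lamv /= ?nth_nil; ring. Qed.

Lemma lamE c s : lam_fun c s = fourier z (fun a => lamv (c s0) (c s1) a) (val s).
Proof. by rewrite ffunE. Qed.

Lemma lam_linear : linear lam_fun.
Proof.
move=> k c c'.
have L (a : nat) : lamv ((k *: c + c') s0) ((k *: c + c') s1) a =
    k * lamv (c s0) (c s1) a + lamv (c' s0) (c' s1) a by rewrite !ffunE; exact: lamv_lin.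
have F gv gv' gv'' (l : 'Z_6) : (forall a, gv a = k * gv' a + gv'' a) ->
    fourier z gv l = k * fourier z gv' l + fourier z gv'' l.
  move=> Egv; rewrite /fourier mulrCA -mulrDr; congr (_ * _).
  by rewrite mulr_sumr -big_split; apply: eq_bigr => a _; rewrite Egv /=; ring.
apply/ffunP=> s; transitivity (k * lam_fun c s + lam_fun c' s).
  by rewrite !lamE; exact: F.
by rewrite [RHS]ffunE; congr (_ + _); rewrite [RHS]ffunE.
Qed.

HB.instance Definition _ :=
  GRing.isLinear.Build C {ffun Ref W -> C^o} {ffun Ref W' -> C^o} _ lam_fun lam_linear.

Definition lam : {linear {ffun Ref W -> C^o} -> {ffun Ref W' -> C^o}} := lam_fun.

Lemma lam_param c : vpts (v := param_space W') (lam c).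
Proof.
move=> s s' w E; congr (lam_fun c _); apply: val_inj; rewrite E conjgE.
have A (a b : 'Z_6) : - b + (a + b) = a by rewrite addrC addrK.
exact: A.
Qed.

Lemma param_parity (c : {ffun Ref W -> C^o}) i : vpts (v := param_space W) c ->
  c (refl_s zp i) = if odd i then c s1 else c s0.
Proof.
move=> cP; have -> : (if odd i then c s1 else c s0) = c (refl_s zp (odd i)%:R).
  by case: (odd i).
by apply: (cP _ _ (- (i./2)%:R, false)); rewrite /= -s_conj -Zp6_odd2.
Qed.

Lemma prm_param chi : prm chi (inord 0) = cm_param chi s0 /\ prm chi (inord 1) = cm_param chi s1.
Proof. by rewrite prm0 prm1 !ffunE. Qed.

Lemma cm_param_pts chi : pts chi -> vpts (v := param_space W) (cm_param chi).
Proof.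
move=> hchi s s' w E; rewrite !ffunE; congr (chi _); apply: val_inj.
exact/esym/(hpar_conj E).
Qed.

Lemma cm_param_inj chi (c : {ffun Ref W -> C^o}) : pts chi -> vpts (v := param_space W) c ->
  prm chi (inord 0) = c s0 -> prm chi (inord 1) = c s1 -> cm_param chi = c.
Proof.
move=> hchi cP E0 E1; apply/ffunP=> s; have [r _ rK] := refl_s_bij zp.
rewrite -[s]rK (param_parity _ (cm_param_pts hchi)) (param_parity _ cP).
by rewrite -E0 -E1; case: (prm_param chi) => -> ->.
Qed.

Lemma cpts_cm_param chi (c : {ffun Ref W -> C^o}) : cpts chi ->
  prm' chi (inord 0) = c s0 -> prm' chi (inord 1) = c s1 ->
  cm_param chi = lam c.
Proof.
move=> /cyc_ext cch; rewrite prm0 prm1 => E0 E1; apply/ffunP=> s; rewrite !ffunE.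
rewrite -ext_val -[val (zpar s)]/(hpar s) -cc_val (c_fourier zp).
have GC (r : seq 'I_6) : centr (\sum_(a <- r) (z ^- (val s : 'Z_6)) ^+ a *: cgam z (@cc C z zp) (a : 'I_6)).
  by apply: centr_sum => a; apply: centrZ; exact: (gam_centr (cher_cyc zp)).
rewrite (cc_Z cch) // /fourier; congr (_ * _).
elim: (index_enum _) => [|a r IHr]; first by rewrite !big_nil (cc_0 cch).
rewrite !big_cons (cc_lin cch) ?IHr //; last exact: (gam_centr (cher_cyc zp)).
by rewrite (cc_lam cch) -E0 -E1 -!ext_val.
Qed.

Lemma ext_lin (chi : Z' -> C) a (h h' : cher W') : scalar chi -> centr h -> centr h' ->
  ext chi (a *: h + h') = a * ext chi h + ext chi h'.
Proof. by move=> chiL /centr_val[s <-] /centr_val[s' <-]; rewrite -val_linP !ext_val chiL. Qed.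

(** Fourier inversion recovers the [cgam] from the parameters, and from them A and B; so the points
    of the base change are the characters in [cpts]. *)
Lemma cm_param_cpts (chi : Z' -> C) (c : {ffun Ref W -> C^o}) : 
  scalar chi -> GRing.monoid_morphism chi -> cm_param chi = lam c ->
  [/\ cpts chi, prm' chi (inord 0) = c s0 & prm' chi (inord 1) = c s1].
Proof.
move=> chiL chiM E.
have chi0 : chi 0 = 0 by have := chiL (-1) 0 0; rewrite scaler0 addr0 mulN1r addNr.
pose gv (a : 'Z_6) := @lamv C (c s0) (c s1) a.
have Ec k : ext chi (cc zp k) = fourier z gv k.
  rewrite /cc; case: insubP => [s _ <-|].
    have := congr1 (fun f : {ffun Ref W' -> C^o} => f s) E; rewrite /= !ffunE => <-.
    by rewrite -ext_val.
  rewrite cyc_is_refl negbK => /eqP ->; rewrite fourier0 ?lamv_sum //.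
  by rewrite -[RHS]chi0 -[0 in LHS]/(val (0 : Z')) ext_val.
have Eg (a : 'Z_6) : chi (zgam zp a) = gv a.
  rewrite -ext_val -[val (zgam zp a)]/(cgam z (@cc C z zp) a) -(fourier_inv zp gv) /cgam.
  elim: (index_enum _) => [|k r IHr].
    by rewrite !big_nil -[RHS]chi0 -[0 in LHS]/(val (0 : Z')) ext_val.
  rewrite !big_cons ext_lin ?IHr ?Ec //; first exact: (cyc_c_centr (cher_cyc zp)).
  by apply: centr_sum => l; apply: centrZ; exact: (cyc_c_centr (cher_cyc zp)).
have chiZ k s : chi (k *: s) = k * chi s by rewrite -[_ *: _]addr0 chiL chi0 addr0.
have chiD s s' : chi (s + s') = chi s + chi s' by rewrite -[s]scale1r chiL mul1r scale1r.
have chiB s s' : chi (s - s') = chi s - chi s' by rewrite -scaleN1r addrC chiL mulN1r addrC.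
have E0 : chi (zca0 zp) = c s0.
  have -> : zca0 zp = 6%:R^-1 *: (zgam zp 0 + zgam zp 2%:R) by apply: val_inj.
  by rewrite chiZ chiD !Eg /gv /lamv /=; field.
have E1 : chi (zca1 zp) = c s1.
  have -> : zca1 zp = 6%:R^-1 *: (zgam zp 0 - zgam zp 2%:R) by apply: val_inj.
  by rewrite chiZ chiB !Eg /gv /lamv /=; field.
by rewrite prm0 prm1; split=> //; split=> // a; rewrite Eg E0 E1.
Qed.

(** Both families of characters realize every zero of the same relation, so the coordinates of a
    fixed point are also those of a cyclic character. *)
Lemma transfer_exists : exists g : vtype X -> Z' -> C, forall chi, pts chi ->
  [/\ cpts (g chi), prm' (g chi) = prm chi & gn' (g chi) = gn chi].
Proof.
suff : forall chi, exists chi', pts chi -> [/\ cpts chi', prm' chi' = prm chi & gn' chi' = gn chi].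
  by move=> /choice[g gP]; exists g.
move=> chi; have [hchi|nchi] := pselect (pts chi); last by exists (fun=> 0).
have [chi' h' [Eb Ev]] := pts_at (@cpts_char C z zp) (@cpts_closed C z zp) (@cpts_rel C z zp)
  (@cpts_poly C z zp) (@cpts_chart C z zp) (fixed_rel hchi).
by exists chi'.
Qed.

Lemma pts_inj chi chi' : pts chi -> pts chi' -> prm chi = prm chi' -> gn chi = gn chi' -> chi = chi'.
Proof.
move=> h h' Eb Ev; apply/funext=> s; have [p Ep] := fixed_poly s.
by rewrite !Ep // Eb Ev.
Qed.

Lemma cpts_inj chi chi' : cpts chi -> cpts chi' -> prm' chi = prm' chi' -> gn' chi = gn' chi' -> chi = chi'.
Proof.
move=> h h' Eb Ev; apply/funext=> s; have [p Ep] := cpts_poly s.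
by rewrite !Ep // Eb Ev.
Qed.

Definition polyish (F : vtype X -> C) := exists p, forall chi, pts chi -> F chi = ev (prm chi) (gn chi) p.

Lemma polyish_D F G : polyish F -> polyish G -> polyish (fun chi => F chi + G chi).
Proof. by move=> [p Ep] [q Eq]; exists (p + q) => chi h; rewrite rmorphD /= Ep // Eq. Qed.

Lemma polyish_M F G : polyish F -> polyish G -> polyish (fun chi => F chi * G chi).
Proof. by move=> [p Ep] [q Eq]; exists (p * q) => chi h; rewrite rmorphM /= Ep // Eq. Qed.

Lemma polyish_const a : polyish (fun=> a).
Proof. by exists a%:MP%:MP => chi _; rewrite ev2C [RHS]mevalC. Qed.

Lemma polyish_sum (k : nat) (F : 'I_k -> vtype X -> C) : (forall i, polyish (F i)) ->
  polyish (fun chi => \sum_i F i chi).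
Proof.
move=> FP; elim: (index_enum _) => [|i r IHr].
  by have [p Ep] := polyish_const 0; exists p => chi h; rewrite big_nil; exact: Ep.
by have [p Ep] := polyish_D (FP i) IHr; exists p => chi h; rewrite big_cons Ep.
Qed.

Lemma polyish_param (a : {ffun Ref W -> C^o} -> C) : vfun (v := param_space W) a ->
  polyish (fun chi => a (cm_param chi)).
Proof.
move=> [p Ep]; suff [q Eq] : polyish (fun chi => p.@[fun i => chi (zpar (enum_val i))]).
  exists q => chi h; rewrite Ep -Eq //; apply: meval_eq => i; by rewrite ffunE.
elim/mpoly_gen_ind: p {Ep} => [b|i|p q Pp Pq|p q Pp Pq].
- by have [q Eq] := polyish_const b; exists q => chi h; rewrite mevalC; exact: Eq.
- have [q Eq] := fixed_poly (zpar (enum_val i) : centre W).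
  by exists q => chi h; rewrite mevalXU Eq.
- by have [r Er] := polyish_D Pp Pq; exists r => chi h; rewrite mevalD Er.
- by have [r Er] := polyish_M Pp Pq; exists r => chi h; rewrite mevalM Er.
Qed.

Lemma G2_not_iso_cyc6 : ~ refl_group_iso W W'.
Proof.
move=> [f [P [Q [fb _ _ _ _]]]]; have := bij_eq_card fb.
by rewrite card_dih6 card_ord.
Qed.

(** The fixed point variety is its own only component. Points on both sides are determined by the
    same five coordinates, and regular functions on both sides are the polynomials in them. *)
Lemma G2_FIX : conjecture_FIX W 6.
Proof.
move=> F /component_all ->; exists W'; first exact: G2_not_iso_cyc6.
exists lam; split; first by move=> c _; exact: lam_param.
have [g gP] := transfer_exists.
exists (fun chi => (cm_param chi, g chi)) => [|//].
have onto p : vpts (v := cm_base_change lam) p -> exists2 chi, pts chi & (cm_param chi, g chi) = p.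
  case: p => c chi' [/= cP [chiL chiM] E].
  have [h' E0 E1] := cm_param_cpts chiL chiM E.
  have rel := cpts_rel h'.
  have [chi hchi [Eb Ev]] := pts_at (@fixed_char_pts C z zp) (@fixed_closed C z zp) (@fixed_rel C z zp)
    (@fixed_poly C z zp) (@fixed_gen_chart C z zp) rel.
  exists chi => //; have [gh gb gv] := gP chi hchi; congr (_, _).
    by apply: cm_param_inj => //; rewrite Eb.
  by apply: cpts_inj => //; rewrite ?gb ?gv.
split.
  split.
  - move=> chi hchi /=; have [gh gb gv] := gP chi hchi; split=> /=.
    + exact: cm_param_pts.
    + by case: gh.
    + by apply: cpts_cm_param => //; rewrite gb; case: (prm_param chi).
  - move=> chi chi' /set_mem h /set_mem h' [Ec Eg].
    have [_ gb gv] := gP chi h; have [_ gb' gv'] := gP chi' h'.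
    by apply: pts_inj => //; rewrite -?gb -?gb' -?gv -?gv' Eg.
  - by move=> p /onto[chi hchi <-]; exists chi.
move=> u; split=> [[u' [k [a [b [aP bP Eu']]]] Eu]|/regularE [p Ep]].
  apply/regularE; have [p Ep] : polyish (fun chi => \sum_i a i (cm_param chi) * b i (g chi)).
    apply: polyish_sum => i; apply: polyish_M; first exact: polyish_param.
    have [s Es] := bP i; have [q Eq] := cpts_poly s.
    by exists q => chi h; have [gh gb gv] := gP chi h; rewrite Es Eq // gb gv.
  exists p => chi h; rewrite -Ep //= Eu ?Eu' //.
  have [gh gb gv] := gP chi h; split=> /=.
  - exact: cm_param_pts.
  - by case: gh.
  - by apply: cpts_cm_param => //; rewrite gb; case: (prm_param chi).
have [s Es] := poly_pts (zca0 zp) (zca1 zp) (zcr zp) (zcR zp) (zcE zp) (@cpts_char C z zp) p.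
exists (fun q => q.2 s).
  exists 1%N, (fun _ _ => 1), (fun _ chi => chi s); split=> [i|i|q].
  - by exists 1 => c; rewrite meval1.
  - by exists s.
  - by rewrite big_ord1 mul1r.
move=> q /onto[chi h <-]; have [gh gb gv] := gP chi h.
by rewrite [RHS]Es // gb gv -Ep.
Qed.

End Components.

Theorem proposition8p13 (R : realType) (zeta : R[i])
    (zeta_prim : 6.-primitive_root zeta) :
  (exists r R' eu : centre (G2 zeta_prim),
    [/\ val r = hx zeta_prim ^+ 6 + hy zeta_prim ^+ 6,
        val R' = hX zeta_prim ^+ 6 + hY zeta_prim ^+ 6,
        is_trunc_inv (var_x * var_X + var_y * var_Y) eu
      & presented_by (X := cm_fixed (G2 zeta_prim) 6)
          (fun (i : 'I_2) chi => chi (tnth [tuple zA zeta_prim; zB zeta_prim] i))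
          (fun (j : 'I_3) chi => chi (tnth [tuple r; R'; eu] j))
          (let A := ('X_(inord 0) : {mpoly R[i][2]})%:MP in
           let B := ('X_(inord 1) : {mpoly R[i][2]})%:MP in
           let r := 'X_(inord 0) in
           let R' := 'X_(inord 1) in
           let eu := 'X_(inord 2) in
           (eu - 3 * (A + B)) * (eu + 3 * (A + B))
           * (eu - 3 * (A - B)) * (eu + 3 * (A - B)) * eu ^+ 2 - r * R')])
  /\ conjecture_FIX (G2 zeta_prim) 6.
Proof.
split; last exact: G2_FIX.
exists (zr zeta_prim), (zR zeta_prim), (zE zeta_prim); split.
- exact: haE0.
- exact: haE6.
- exact: eu_trunc_inv.
- exact: G2_presented.
Qed.
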